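(* Let $G$ be the free semigroup generated by continuous maps $f_1,\dots,f_m$ acting on a compact metric space $(X,d)$, and let $\mu$ be a $G$-ergodic Borel probability measure on $X$ with full support. If $h_\mu(G)<+\infty$ and the limit process of $h(\omega,x)$ is uniform with respect to $x$ for almost every $\omega$, then for every real $q\ge1$ the entropy $h_{cor}(G,\mu,q)$ exists (i.e. $\overline{h}_{cor}(G,\mu,q)=\underline{h}_{cor}(G,\mu,q)$) and $$h_\mu(G)=h_{cor}(G,\mu,q).$$ In particular, for $\mu$-a.e. $x\in X$, $h_{cor}(G,x)$ exists (i.e. $\overline{h}_{cor}(G,x)=\underline{h}_{cor}(G,x)$) and $$h_\mu(G)=h_{cor}(G,\mu,2)=h_{cor}(G,x).$$
   Context: Setting. $(X,d)$ is a compact metric space, $f_1,\dots,f_m:X\to X$ are continuous, $G$ is the free semigroup generated by $\{f_1,\dots,f_m\}$ acting on $X$. Fix a probability vector $p=(p_1,\dots,p_m)$ with all $p_i>0$ and $\sum_i p_i=1$; let $\Sigma_m^+=\{1,\dots,m\}^{\mathbb{N}}$, let $\mathbb{P}$ be the Bernoulli (product) measure on $\Sigma_m^+$ generated by $p$, and let $\sigma$ be the left shift on $\Sigma_m^+$. For $\omega=(i_1,i_2,\dots)\in\Sigma_m^+$ put $f_{\omega,0}=\mathrm{id}$ and $f_{\omega,n}=f_{i_n}\circ\cdots\circ f_{i_1}$ for $n\ge1$. For $k\ge 1$ put $$d^G_{\omega,k}(x,y)=\max_{0\le i\le k-1} d(f_{\omega,i}(x),f_{\omega,i}(y)),\qquad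 B^G_{\omega,k}(x,\varepsilon)=\{y\in X: d^G_{\omega,k}(x,y)\le\varepsilon\}.$$ The skew product is $F(\omega,x)=(\sigma(\omega),f_{\omega,1}(x))$ on $\Sigma_m^+\times X$. A Borel probability measure $\mu$ on $X$ is $G$-ergodic if $\mathbb{P}\times\mu$ is invariant and ergodic with respect to $F$. Measure-theoretic entropy. For a finite Borel measurable partition $\xi$ of $X$, $h_\mu(G,\xi)=\lim_{k\to+\infty}\frac1k\int_{\Sigma_m^+}H_\mu\big(\bigvee_{i=0}^{k-1}f_{\omega,i}^{-1}\xi\big)d\mathbb{P}(\omega)$, where $H_\mu(\eta)=-\sum_{A\in\eta}\mu(A)\log\mu(A)$; $h_\mu(G)=\sup_\xi h_\mu(G,\xi)$. Lower local entropy. $h(\omega,x)=\lim_{\varepsilon\to0}\liminf_{k\to+\infty}-\frac1k\log\mu(B^G_{\omega,k}(x,\varepsilon))$. The limit process of $h(\omega,x)$ is uniform with respect to $x$ for almost every $\omega$ if for $\mathbb{P}$-a.e. $\omega$ there is a set $A(\omega)\subseteq X$ with $\mu(A(\omega))=1$ such that for every $\delta>0$ there is $\varepsilon_0=\varepsilon_0(\omega,\delta)>0$ such that for every $0<\varepsilon\le\varepsilon_0$ there is $K=K(\omega,\delta,\varepsilon)$ such that for all $k>K$, $$h(\omega,x)-\delta\le-\frac1k\log\mu(B^G_{\omega,k}(x,\varepsilon))\quad\text{for all }x\in A(\omega).$$ Correlation entropy. For $q\neq1$, $c(G,\mu,\varepsilon,k,q)=\frac1{q-1}\int_{\Sigma_m^+}\log\big(\int_X\mu(B^G_{\omega,k}(x,\varepsilon))^{q-1}d\mu(x)\big)d\mathbb{P}(\omega)$,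 and $c(G,\mu,\varepsilon,k,1)=\int_{\Sigma_m^+}\int_X\log\mu(B^G_{\omega,k}(x,\varepsilon))\,d\mu(x)\,d\mathbb{P}(\omega)$. Then $\overline{h}_{cor}(G,\mu,q)=\lim_{\varepsilon\to0}\limsup_{k\to+\infty}-\frac1kc(G,\mu,\varepsilon,k,q)$ and $\underline{h}_{cor}(G,\mu,q)=\lim_{\varepsilon\to0}\liminf_{k\to+\infty}-\frac1kc(G,\mu,\varepsilon,k,q)$; if they coincide the common value is $h_{cor}(G,\mu,q)$. Local correlation entropy. For $x\in X$, $\varepsilon>0$, $k,n\ge1$, let $$C(G,x,\varepsilon,\omega,k,n)=\frac1{n^2}\int_{\Sigma_m^+}\sharp\{(i,j):0\le i,j\le n-1,\ d^G_{\omega,k}(f_{\upsilon,i}(x),f_{\upsilon,j}(x))\le\varepsilon\}\,d\mathbb{P}(\upsilon),$$ $\underline{C}(G,x,\varepsilon,\omega,k)=\liminf_{n\to+\infty}C(G,x,\varepsilon,\omega,k,n)$, $\overline{C}(G,x,\varepsilon,\omega,k)=\limsup_{n\to+\infty}C(G,x,\varepsilon,\omega,k,n)$. Then $\overline{h}_{cor}(G,x)=\lim_{\varepsilon\to0}\limsup_{k\to+\infty}-\frac1k\int\log\underline{C}(G,x,\varepsilon,\omega,k)\,d\mathbb{P}(\omega)$ and $\underline{h}_{cor}(G,x)=\lim_{\varepsilon\to0}\liminf_{k\to+\infty}-\frac1k\int\log\overline{C}(G,x,\varepsilon,\omega,k)\,d\mathbb{P}(\omega)$; if they coincide the common value is $h_{cor}(G,x)$.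 *)

(* Defs.v *)
From HB Require Import structures.
From mathcomp Require Import all_boot all_order all_algebra.
From mathcomp Require Import all_classical all_reals all_analysis.

Set Implicit Arguments.
Unset Strict Implicit.
Unset Printing Implicit Defensive.

Import Order.TTheory GRing.Theory Num.Theory.
Import numFieldNormedType.Exports.

Local Open Scope classical_set_scope.
Local Open Scope ring_scope.
Local Open Scope ereal_scope.

(* Measurable types must be pointed.  A space carrying a probability measure is
   nonempty, so asking for a point of a metric space loses no generality. *)
#[short(type="pmetricType")]
HB.structure Definition PointedMetric (K : numDomainType) :=
  { M of Pointed M & Metric K M }.

Notation borel X := (g_sigma_algebraType (@open X)).

HB.instance Definition _ (m : nat) := isPointed.Build 'I_m.+1 ord0.

(* One-sided sequences over an alphabet of m.+1 >= 1 letters; the word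
   (i_1, i_2, ...) is encoded by w 0 = i_1, w 1 = i_2, ... *)
Definition cylinders1 (m : nat) : set (set (nat -> 'I_m.+1)) :=
  [set C | exists n a, C = [set w : nat -> 'I_m.+1 | w n = a]].

Notation words m := (g_sigma_algebraType (@cylinders1 m)).

Definition left_shift (m : nat) (w : words m) : words m := fun n => w n.+1.

(* The cylinders form a pi-system generating the sigma-algebra, so this
   determines P. *)
Definition bernoulli_measure (R : realType) (m : nat) (p : 'I_m.+1 -> R)
    (P : probability (words m) R) : Prop :=
  forall (n : nat) (a : 'I_n -> 'I_m.+1),
    P [set w : words m | forall i : 'I_n, w i = a i] = (\prod_(i < n) p (a i))%:E.

Definition measure_invariant (R : realType) d (T : measurableType d)
    (nu : set T -> \bar R) (g : T -> T) : Prop :=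
  forall E : set T, measurable E -> nu (g @^-1` E) = nu E.

Definition measure_ergodic (R : realType) d (T : measurableType d)
    (nu : set T -> \bar R) (g : T -> T) : Prop :=
  forall E : set T, measurable E -> g @^-1` E = E -> nu E = 0 \/ nu E = 1.

Definition full_support (R : realType) (X : pmetricType R)
    (mu : set (borel X) -> \bar R) : Prop :=
  forall U : set X, open U -> U !=set0 -> 0 < mu U.

Section semigroup_action.
Context {R : realType} {X : pmetricType R} {m : nat}.
Context (f : 'I_m.+1 -> X -> X).
Implicit Types (w : words m) (x y : X) (eps q : R) (k n : nat).

Fixpoint fiber_iter w n x : X :=
  if n is n'.+1 then f (w n') (fiber_iter w n' x) else x.

Definition skew_product (z : words m * borel X) : words m * borel X :=
  (left_shift z.1, fiber_iter z.1 1 z.2).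

Definition bowen_dist w k x y : R :=
  \big[Num.max/0%R]_(i < k) mdist (fiber_iter w i x) (fiber_iter w i y).

Definition bowen_ball w k x eps : set X :=
  [set y | (bowen_dist w k x y <= eps)%R].

Context (P : probability (words m) R) (mu : probability (borel X) R).

Definition G_ergodic : Prop :=
  measure_invariant (P \x mu) skew_product /\
  measure_ergodic (P \x mu) skew_product.

(* 0 * log 0 = 0 holds in \bar R since 0 * -oo = 0. *)
Definition shannon_entropy (I : finType) (eta : I -> set (borel X)) : \bar R :=
  - \sum_(i : I) mu (eta i) * lne (mu (eta i)).

(* The join of the f_{w,i}^{-1} xi, i < k, indexed by xi-names of length k;
   names of empty atoms do not contribute to the entropy. *)
Definition partition_join w k n (xi : 'I_n -> set (borel X))
    (a : {ffun 'I_k -> 'I_n}) : set (borel X) :=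
  \bigcap_(i in [set: 'I_k]) (fiber_iter w i @^-1` xi (a i)).

(* For P \x mu invariant under the skew product the integrals are subadditive in
   k, so the limit exists. *)
Definition partition_entropy n (xi : 'I_n -> set (borel X)) : \bar R :=
  limn (fun k => (k%:R^-1)%:E *
    \int[P]_w shannon_entropy (@partition_join w k n xi)).

Definition metric_entropy : \bar R :=
  ereal_sup [set h | exists n (xi : 'I_n -> set (borel X)),
    [/\ partition [set: 'I_n] xi [set: borel X],
        forall i, measurable (xi i) & h = partition_entropy xi]].

(* The limits as eps -> 0^+ below are limits of monotone functions of eps. *)

Definition local_entropy w x : \bar R :=
  lim (limn_einf (fun k => (- k%:R^-1)%:E * lne (mu (bowen_ball w k x eps)))
       @[eps --> 0^'+]).

Definition uniform_local_entropy : Prop :=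
  {ae P, forall w, exists A : set (borel X), [/\ measurable A, mu A = 1 &
    forall delta : R, (0 < delta)%R ->
    exists eps0 : R, (0 < eps0)%R /\
    forall eps : R, (0 < eps <= eps0)%R ->
    exists K : nat, forall k, (K < k)%N ->
    forall x, A x ->
      local_entropy w x - delta%:E <=
      (- k%:R^-1)%:E * lne (mu (bowen_ball w k x eps))]}.

Definition cor_integral eps k q : \bar R :=
  if q == 1%R then
    \int[P]_w \int[mu]_x lne (mu (bowen_ball w k x eps))
  else
    ((q - 1)^-1)%:E *
    \int[P]_w lne (\int[mu]_x (mu (bowen_ball w k x eps) `^ (q - 1))).

Definition upper_cor_entropy q : \bar R :=
  lim (limn_esup (fun k => (- k%:R^-1)%:E * cor_integral eps k q)
       @[eps --> 0^'+]).

Definition lower_cor_entropy q : \bar R :=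
  lim (limn_einf (fun k => (- k%:R^-1)%:E * cor_integral eps k q)
       @[eps --> 0^'+]).

(* "h_cor(G, mu, q) exists and equals h" *)
Definition is_cor_entropy q (h : \bar R) : Prop :=
  upper_cor_entropy q = h /\ lower_cor_entropy q = h.

Definition cor_sum x eps w k n : \bar R :=
  ((n%:R ^+ 2)^-1)%:E *
  \int[P]_v (#|[pred ij : 'I_n * 'I_n |
    (bowen_dist w k (fiber_iter v ij.1 x) (fiber_iter v ij.2 x) <= eps)%R]|%:R)%:E.

Definition lower_cor_sum x eps w k : \bar R := limn_einf (cor_sum x eps w k).

Definition upper_cor_sum x eps w k : \bar R := limn_esup (cor_sum x eps w k).

(* The upper entropy uses the lower correlation sum, and conversely. *)
Definition upper_local_cor_entropy x : \bar R :=
  lim (limn_esup (fun k =>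
         (- k%:R^-1)%:E * \int[P]_w lne (lower_cor_sum x eps w k))
       @[eps --> 0^'+]).

Definition lower_local_cor_entropy x : \bar R :=
  lim (limn_einf (fun k =>
         (- k%:R^-1)%:E * \int[P]_w lne (upper_cor_sum x eps w k))
       @[eps --> 0^'+]).

(* "h_cor(G, x) exists and equals h" *)
Definition is_local_cor_entropy x (h : \bar R) : Prop :=
  upper_local_cor_entropy x = h /\ lower_local_cor_entropy x = h.

End semigroup_action.

(* Main.v *)
Require Import Defs.
From HB Require Import structures.
From mathcomp Require Import all_boot all_order all_algebra.
From mathcomp Require Import all_classical all_reals all_analysis.
From mathcomp Require Import measurable_realfun.
From mathcomp Require Import ring lra.

Set Implicit Arguments.
Unset Strict Implicit.
Unset Printing Implicit Defensive.

Import Order.TTheory GRing.Theory Num.Theory.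
Import numFieldNormedType.Exports.

Local Open Scope classical_set_scope.
Local Open Scope ring_scope.

(** Write h for the metric entropy.  At a fixed scale e the correlation
    integrals of order q, normalised by the length k of the Bowen balls, are
    shown to stay below h in the limit, and above any c < h once e is small;
    both correlation entropies are then equal to h.

    Upper bound.  By Jensen's inequality the order 1 has the largest cost
    (cor_loss_le1).  A Bowen ball of radius e contains the atom of any
    partition of mesh e around the same centre, so this cost is at most the
    entropy of the partition refined along k steps, whose rate converges by
    subadditivity and is at most h (limsup_loss_rate_le).

    Lower bound.  If the local entropy is at least h almost everywhere, the
    uniformity hypothesis provides, in almost every fibre, one scale at
    which the masses of the Bowen balls decay at a rate above c for almost
    all centres, and Fatou's lemma integrates this over the fibres
    (liminf_loss_rate_ge).

    What remains is the lower half of the Brin-Katok formula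
    (local_entropy_gt_ae).  The set where the local entropy exceeds c is
    mapped into itself by taking preimages, because one step costs the
    measure only a factor 1 / p_i; by ergodicity it is null or conull.
    Suppose it is null.  Then almost every point has arbitrarily long heavy
    balls, of mass at least exp (- c' k) for a c' slightly above c.  Given a
    partition, cut the orbit greedily into blocks along heavy balls and a
    few single steps (tiling_bound).  A heavy ball makes the symbols of its
    block likely, since most of the points that stay close to an orbit
    produce nearly the same symbols; this turns the tiling into an explicit
    code, with weights that sum up to at most 1 (tsum_code), which spends
    little more than c nats per symbol (code_length_block).  By Gibbs'
    inequality no code beats the entropy, so every partition has entropy at
    most c (partition_entropy_le), which is impossible for c < h.  The
    tiling replaces the almost sure convergence of the information
    functions.

    Local version.  The same greedy tiling proves Birkhoff's theorem for
    sets (birkhoff_visits).  Applied to countably many cells it shows that,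
    for almost every x, pairs of points of the random orbits of x
    equidistribute over pairs of cells of small mesh.  The correlation sums
    of x at scale e therefore lie between the correlation integrals of order
    2 at scales e / 2 and 2 e (corr_sum_sandwich_ae), and the case q = 2
    applies. *)

(** * Limits inferior, and limits at scale zero *)

Section limit_inferior.
Context {R : realType}.
Implicit Types (u v : nat -> \bar R) (c : \bar R).
Local Open Scope ereal_scope.

Lemma limn_einfE u : limn_einf u = ereal_sup (range (einfs u)).
Proof. by rewrite limn_einf_lim; apply/cvg_lim => //; exact: cvg_einfs_sup. Qed.

Lemma limn_einf_ge u c N : (forall n, (N <= n)%N -> c <= u n) ->
  c <= limn_einf u.
Proof.
move=> cu; rewrite limn_einfE.
apply: (@le_trans _ _ (einfs u N)); last by apply: ereal_sup_ubound; exists N.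
by apply: le_ereal_inf_tmp => _ [n /= Nn <-]; exact: cu.
Qed.

Lemma limn_einf_gt u c : c < limn_einf u ->
  exists N, forall n, (N <= n)%N -> c < u n.
Proof.
rewrite limn_einfE => /ereal_sup_gt[_ [N _ <-]] cN; exists N => n Nn.
by apply: (lt_le_trans cN); apply: ereal_inf_lbound; exists n.
Qed.

Lemma le_limn_einf u v N : (forall n, (N <= n)%N -> u n <= v n) ->
  limn_einf u <= limn_einf v.
Proof.
move=> uv; rewrite [leLHS]limn_einfE.
apply: ge_ereal_sup => _ [M _ <-].
apply: (@limn_einf_ge _ _ (maxn N M)) => n; rewrite geq_max => /andP[Nn Mn].
by apply: le_trans (uv _ Nn); apply: ereal_inf_lbound; exists n.
Qed.

Lemma le_limn_esup u v N : (forall n, (N <= n)%N -> u n <= v n) ->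
  limn_esup u <= limn_esup v.
Proof.
move=> uv; rewrite -[leLHS]oppeK -[leRHS]oppeK -!limn_einfN leeN2.
by apply: (@le_limn_einf _ _ N) => n Nn /=; rewrite leeN2 uv.
Qed.

Lemma limn_esup_le_lim u v N l : (forall n, (N <= n)%N -> u n <= v n) ->
  v @ \oo --> l -> limn_esup u <= l.
Proof.
move=> uv vl; have [_ <-] := cvg_limn_einf_sup vl.
exact: le_limn_esup uv.
Qed.

Lemma limn_einf_ge_lim u v N l : (forall n, (N <= n)%N -> v n <= u n) ->
  v @ \oo --> l -> l <= limn_einf u.
Proof.
move=> uv vl; have [<- _] := cvg_limn_einf_sup vl.
exact: le_limn_einf uv.
Qed.

End limit_inferior.

Section right_limit_at_zero.
Context {R : realType}.
Implicit Types (g : R -> \bar R) (h : \bar R).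
Local Open Scope ereal_scope.

Lemma harmonic_lt (e : R) : (0 < e)%R -> exists n, ((n.+1%:R)^-1 < e)%R.
Proof.
move=> e0; exists (Num.truncn e^-1).
by rewrite invf_plt ?posrE ?ltr0n// truncnS_gt.
Qed.

Lemma lim_at0_nonincreasing g :
  (forall a b : R, (0 < a <= b)%R -> g b <= g a) ->
  lim (g e @[e --> 0^'+]) = ereal_sup (range (fun n => g (n.+1%:R^-1)%R)).
Proof.
move=> ng; have -> : lim (g e @[e --> 0^'+]) = ereal_sup (g @` `]0%R, +oo[).
  apply/cvg_lim => //; apply: nonincreasing_at_right_cvge => //.
  move=> a b; rewrite !in_itv/= => /andP[a0 _] _ ab.
  by apply: ng; rewrite a0.
apply/eqP; rewrite eq_le; apply/andP; split; apply: ge_ereal_sup => x.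
  move=> [e] /=; rewrite in_itv/= andbT => e0 <-.
  have [n ne] := harmonic_lt e0.
  apply: (@le_trans _ _ (g (n.+1%:R^-1)%R)).
    by apply: ng; rewrite invr_gt0 ltr0n/= ltW.
  by apply: ereal_sup_ubound; exists n.
move=> [n _ <-]; apply: ereal_sup_ubound; exists (n.+1%:R^-1)%R => //=.
by rewrite in_itv/= invr_gt0 ltr0n.
Qed.

(** The quantities at a fixed scale are known only up to comparable scales, so
    the lower one is bounded below by each c < h at small scales alone, and the
    upper one by h at every scale.  That is enough for both limits to be h. *)
Lemma lim_at0_sandwich (lo hi : R -> \bar R) h :
  (forall e, (0 < e)%R -> lo e <= hi e) ->
  (forall e, (0 < e)%R -> hi e <= h) ->
  (forall c : R, c%:E < h -> exists2 e0 : R, (0 < e0)%R &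
     forall e, (0 < e <= e0)%R -> c%:E <= lo e) ->
  lim (lo e @[e --> 0^'+]) = h /\ lim (hi e @[e --> 0^'+]) = h.
Proof.
move=> lohi hih clo.
have aux (g : R -> \bar R) : (forall e, (0 < e)%R -> lo e <= g e <= h) ->
    lim (g e @[e --> 0^'+]) = h.
  move=> gh; apply/cvg_lim => //.
  have hl (c : R) : c%:E < h -> \forall e \near 0^'+, c%:E <= g e.
    move=> /clo[e0 e00 cl]; near=> e.
    have e_gt0 : (0 < e)%R by near: e; exact: nbhs_right_gt.
    apply: le_trans (cl e _) _; last by have /andP[] := gh _ e_gt0.
    by rewrite e_gt0/=; near: e; exact: nbhs_right_le.
  have hg : \forall e \near 0^'+, g e <= h.
    near=> e; have e_gt0 : (0 < e)%R by near: e; exact: nbhs_right_gt.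
    by have /andP[] := gh _ e_gt0.
  case: h {hih clo gh} hl hg => [r| |] hl hg.
  - apply/fine_cvgP; split.
      near=> e; rewrite fin_numE; apply/andP; split.
        have : (r - 1)%:E <= g e.
          by near: e; apply: hl; rewrite lte_fin ltrBlDr ltrDl.
        by case: (g e).
      have : g e <= r%:E by near: e.
      by case: (g e).
    apply/cvgrPdist_le => e e0; near=> x.
    have : (r - e)%:E <= g x.
      by near: x; apply: hl; rewrite lte_fin ltrBlDr ltrDl.
    have : g x <= r%:E by near: x.
    rewrite /= ; case: (g x) => //= s; rewrite !lee_fin => sr res.
    by rewrite ger0_norm ?subr_ge0// lerBlDr -lerBlDl.
  - by apply/cvgeyPge => M; apply: hl; rewrite ltry.
  - apply/cvgeNyPle => M; apply: filterS hg => e.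
    by rewrite leeNy_eq => /eqP ->; rewrite leNye.
split; apply: aux => e e0.
  by rewrite lexx/= (le_trans (lohi _ e0))// hih.
by rewrite lohi//= hih.
Unshelve. all: by end_near. Qed.

End right_limit_at_zero.

(** * Words, orbits and Bowen balls *)

Section words_measurability.
Context {m : nat}.
Implicit Types (w : words m) (k : nat).

Definition same_prefix k w w' := forall i, (i < k)%N -> w i = w' i.

Definition extend_word k (a : {ffun 'I_k -> 'I_m.+1}) : words m :=
  fun i => if insub i is Some j then a j else ord0.

Lemma extend_wordE k (a : {ffun 'I_k -> 'I_m.+1}) (i : 'I_k) :
  extend_word a i = a i.
Proof. by rewrite /extend_word valK. Qed.

Lemma same_prefix_extend k w :
  same_prefix k w (extend_word [ffun i : 'I_k => w i]).
Proof.
by move=> i ik; have := extend_wordE [ffun i : 'I_k => w i] (Ordinal ik);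
  rewrite ffunE/= => ->.
Qed.

Lemma measurable_cylinder k (a : 'I_k -> 'I_m.+1) :
  measurable [set w : words m | forall i : 'I_k, w i = a i].
Proof.
have -> : [set w : words m | forall i : 'I_k, w i = a i] =
    \bigcap_(i in [set: 'I_k]) [set w : words m | w i = a i].
  by apply/seteqP; split => w /= aw i; [move=> _|]; exact: aw.
apply: fin_bigcap_measurable => // i _; apply: sub_sigma_algebra.
by exists (i : nat), (a i).
Qed.

(** A quantity that reads only finitely many letters has, on each of finitely
    many cylinders, the sections of a single word. *)
Lemma measurable_fun_prefix d1 (T1 : measurableType d1) d2
    (T2 : measurableType d2) k (g : words m * T1 -> T2) :
  (forall w, measurable_fun setT (fun x => g (w, x))) ->
  (forall w w' x, same_prefix k w w' -> g (w, x) = g (w', x)) ->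
  measurable_fun setT g.
Proof.
move=> mg gk _ B mB; rewrite setTI.
have -> : g @^-1` B = \bigcup_(a in [set: {ffun 'I_k -> 'I_m.+1}])
    ([set w : words m | forall i : 'I_k, w i = a i] `*`
     ((fun x => g (extend_word a, x)) @^-1` B)).
  apply/seteqP; split => [[w x] /= Bwx|[w x] [a _ [/= wa Bax]]].
    exists [ffun i : 'I_k => w i] => //; split => [i|] /=;
        first by rewrite ffunE.
    by rewrite -(gk w)//; exact: same_prefix_extend.
  rewrite /= (gk _ (extend_word a))// => i ik.
  by rewrite (wa (Ordinal ik)) -extend_wordE.
apply: fin_bigcup_measurable => // a _; apply: measurableX.
  exact: measurable_cylinder.
by rewrite -[X in measurable X]setTI; exact: mg.
Qed.

Lemma measurable_fun_prefix1 d (T : measurableType d) k (g : words m -> T) :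
  (forall w w', same_prefix k w w' -> g w = g w') -> measurable_fun setT g.
Proof.
move=> gk.
have mg : measurable_fun setT (fun z : words m * unit => g z.1).
  by apply: (@measurable_fun_prefix _ _ _ _ k) => // w w' x; exact: gk.
have mp : measurable_fun setT (fun w : words m => (w, tt)).
  exact: measurable_fun_pair.
exact: (measurableT_comp mg mp).
Qed.

Lemma measurable_left_shift : measurable_fun setT (@left_shift m).
Proof.
apply: (@measurability _ _ (words m) (words m) setT _ (@cylinders1 m)) => //.
move=> _ [_ [n [a ->]] <-].
by rewrite setTI; apply: sub_sigma_algebra; exists n.+1, a.
Qed.

End words_measurability.

Section orbits.
Context {R : realType} {X : pmetricType R} {m : nat}.
Context (f : 'I_m.+1 -> X -> X).
Implicit Types (w : words m) (x y : X) (eps : R) (k n : nat).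

Definition shift_word k w : words m := fun i => w (k + i)%N.

Lemma fiber_iterD w k n x :
  fiber_iter f w (k + n) x =
  fiber_iter f (shift_word k w) n (fiber_iter f w k x).
Proof. by elim: n => [|n IH]; rewrite ?addn0// addnS /= IH. Qed.

Lemma iter_skew_product n (z : words m * borel X) :
  iter n (skew_product f) z = (shift_word n z.1, fiber_iter f z.1 n z.2).
Proof.
elim: n => [|n IH]; first by case: z.
rewrite iterS IH /skew_product/=; congr pair; last by rewrite /shift_word addn0.
by apply/funext => i; rewrite /left_shift /shift_word addSnnS.
Qed.

Lemma eq_fiber_iter k w w' n x : same_prefix k w w' -> (n <= k)%N ->
  fiber_iter f w n x = fiber_iter f w' n x.
Proof.
by move=> ww'; elim: n => //= n IH nk; rewrite IH ?ww'// ltnW.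
Qed.

Lemma bowen_ballP w k x eps y : 0 <= eps ->
  bowen_ball f w k x eps y <->
  forall i, (i < k)%N -> mdist (fiber_iter f w i x) (fiber_iter f w i y) <= eps.
Proof.
move=> e0; rewrite /bowen_ball /bowen_dist/=; split.
  by move=> /bigmax_leP[_ h] i ik; exact: (h (Ordinal ik)).
by move=> h; apply/bigmax_leP; split => // i _; exact: h.
Qed.

Lemma bowen_ball_le w k x eps eps' : eps <= eps' ->
  bowen_ball f w k x eps `<=` bowen_ball f w k x eps'.
Proof. by move=> ee y; rewrite /bowen_ball/= => /le_trans; exact. Qed.

Lemma eq_bowen_dist k w w' x y : same_prefix k w w' ->
  bowen_dist f w k x y = bowen_dist f w' k x y.
Proof.
move=> ww'; apply: eq_bigr => i _.
by rewrite !(eq_fiber_iter _ ww')// ltnW.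
Qed.

Lemma eq_bowen_ball k w w' x eps : same_prefix k w w' ->
  bowen_ball f w k x eps = bowen_ball f w' k x eps.
Proof.
move=> ww'; rewrite /bowen_ball; apply/funext => y /=.
by rewrite (eq_bowen_dist _ _ ww').
Qed.

Hypothesis hf : forall i, continuous (f i).

Lemma open_of_nbhs (A : set X) : (forall x, A x -> nbhs x A) -> open A.
Proof. by rewrite openE. Qed.

Lemma open_metric_ball x (r : R) : open (ball x r).
Proof.
apply: open_of_nbhs => y; rewrite ballEmdist/= => xyr.
apply/nbhs_ballP; exists (r - mdist x y); first by rewrite /= subr_gt0.
move=> z; rewrite !ballEmdist/= ltrBrDl; apply: le_lt_trans.
exact: metric_triangle.
Qed.

Lemma continuous_fiber_iter w n : continuous (fiber_iter f w n).
Proof.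
elim: n => [|n IH] x /=; first exact: cvg_id.
apply: (@continuous_comp _ _ _ (fiber_iter f w n) (f (w n))).
  exact: IH.
exact: hf.
Qed.

Lemma measurable_open (U : set X) : open U -> measurable (U : set (borel X)).
Proof. exact: sub_sigma_algebra. Qed.

Lemma measurable_closed (U : set X) :
    closed U -> measurable (U : set (borel X)).
Proof.
move=> cU; rewrite -[U]setCK; apply: measurableC.
by apply: measurable_open; rewrite openC.
Qed.

Lemma continuous_measurable_borel (g : X -> X) : continuous g ->
  measurable_fun setT (g : borel X -> borel X).
Proof.
move=> /continuousP cg;
    apply: (@measurability _ _ (borel X) (borel X) setT _ (@open X)) => //.
move=> _ [U oU <-].
by rewrite setTI; apply: measurable_open; exact: cg.
Qed.

Lemma measurable_fiber_iter w n :
  measurable_fun setT (fiber_iter f w n : borel X -> borel X).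
Proof. by apply: continuous_measurable_borel; exact: continuous_fiber_iter. Qed.

Lemma measurable_bowen_ball w k x eps :
  measurable (bowen_ball f w k x eps : set (borel X)).
Proof.
have [e0|e0] := leP 0 eps; last first.
  have -> : bowen_ball f w k x eps = set0 :> set (borel X).
    apply/seteqP; split => // y; rewrite /bowen_ball/= => /bigmax_leP[].
    by rewrite leNgt e0.
  exact: measurable0.
have -> : bowen_ball f w k x eps = \bigcap_(i in [set: 'I_k])
    (fiber_iter f w i @^-1` [set y | mdist (fiber_iter f w i x) y <= eps])
    :> set (borel X).
  apply/seteqP; split => y.
    by move=> /(bowen_ballP _ _ _ _ e0) h i _ /=; exact: h.
  by move=> h; apply/(bowen_ballP _ _ _ _ e0) => i ik; exact: (h (Ordinal ik)).
apply: fin_bigcap_measurable => // i _.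
rewrite -[X in measurable X]setTI; apply: measurable_fiber_iter => //.
set a := fiber_iter f w i x.
have -> : [set y | mdist a y <= eps] =
    \bigcap_n ball a (eps + n.+1%:R^-1) :> set (borel X).
  apply/seteqP; split => y /=.
    by move=> aye n _; rewrite ballEmdist/= (le_lt_trans aye)// ltrDl.
  move=> h; rewrite leNgt; apply/negP; rewrite -subr_gt0 => /harmonic_lt[n].
  have := h n I; rewrite ballEmdist/= => h1.
  by rewrite ltrBrDl ltNge (ltW h1).
apply: bigcap_measurable; first by exists 0.
by move=> n _; apply: measurable_open; exact: open_metric_ball.
Qed.

Lemma nbhs_bowen w k x eps : 0 < eps ->
  \forall y \near x, forall i, (i < k)%N ->
    mdist (fiber_iter f w i x) (fiber_iter f w i y) < eps.
Proof.
move=> e0.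
have : \forall y \near x, forall i : 'I_k,
    mdist (fiber_iter f w i x) (fiber_iter f w i y) < eps.
  apply: filter_forall => i.
  have := @continuous_fiber_iter w i x.
  move=> /(_ _ (nbhsx_ballx (fiber_iter f w i x) eps e0)).
  by rewrite ballEmdist.
by apply: filterS => y h i ik; exact: (h (Ordinal ik)).
Qed.

Lemma bowen_ballD w k x y z a b : 0 <= a -> 0 <= b ->
  bowen_ball f w k x a y -> bowen_ball f w k y b z ->
  bowen_ball f w k x (a + b) z.
Proof.
move=> a0 b0 /(bowen_ballP _ _ _ _ a0) xy /(bowen_ballP _ _ _ _ b0) yz.
apply/(bowen_ballP _ _ _ _ (addr_ge0 a0 b0)) => i ik;
    apply: le_trans (metric_triangle _ (fiber_iter f w i y) _) _.
by rewrite lerD ?xy ?yz.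
Qed.

Context (mu : probability (borel X) R).

(** A closed ball is the decreasing intersection of larger ones, so the measure
    of closed balls of a fixed radius is upper semicontinuous in the centre. *)
Lemma open_measure_bowen_ball_lt w k eps (t : \bar R) :
  open [set x | (mu (bowen_ball f w k x eps) < t)%E].
Proof.
have [e0|e0] := leP 0 eps; last first.
  have -> : [set x | (mu (bowen_ball f w k x eps) < t)%E] =
      [set x : X | (0 < t)%E].
    apply/funext => x /=; congr (is_true (_ < _)%E).
    rewrite -[RHS](measure0 mu); congr (mu _).
    apply/seteqP; split => // y; rewrite /bowen_ball/= => /bigmax_leP[].
    by rewrite leNgt e0.
  have [t0|t0] := pselect (0 < t)%E.
    by rewrite (_ : [set _ | _] = setT); [exact: openT|apply/seteqP; split].
  by rewrite (_ : [set _ | _] = set0); [exact: open0|apply/seteqP; split].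
apply: open_of_nbhs => x /= xt.
pose B n : set (borel X) := bowen_ball f w k x (eps + n.+1%:R^-1).
have BE : \bigcap_n B n = bowen_ball f w k x eps :> set (borel X).
  apply/seteqP; split => y; last first.
    by move=> xy n _; apply: bowen_ball_le xy; rewrite lerDl.
  move=> h; apply/(bowen_ballP _ _ _ _ e0) => i ik; rewrite leNgt; apply/negP.
  rewrite -subr_gt0 => /harmonic_lt[n].
  have e1 : 0 <= eps + n.+1%:R^-1 by rewrite addr_ge0.
  have /(bowen_ballP _ _ _ _ e1)/(_ _ ik) h1 := h n I.
  by rewrite ltrBrDl ltNge h1.
have Bcvg : mu (B n) @[n --> \oo] --> mu (\bigcap_n B n).
  apply: nonincreasing_cvg_mu.
  - by rewrite (le_lt_trans (probability_le1 _ _)) ?ltry//;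
      exact: measurable_bowen_ball.
  - by move=> n; exact: measurable_bowen_ball.
  - by rewrite BE; exact: measurable_bowen_ball.
  - move=> a b ab; apply/subsetPset; apply: bowen_ball_le.
    by rewrite lerD2l lef_pV2 ?posrE// ler_nat.
have [n Bn] : exists n, (mu (B n) < t)%E.
  apply: contrapT => /forallNP nB; move: xt; rewrite -BE; apply/negP.
  rewrite -leNgt -(cvg_lim _ Bcvg)//; apply: lime_ge; first exact: cvgP Bcvg.
  by apply: nearW => n; rewrite leNgt; apply/negP; exact: nB.
have n0 : 0 < n.+1%:R^-1 :> R by [].
have := @nbhs_bowen w k x _ n0; apply: filterS => y xy /=.
apply: le_lt_trans Bn; apply: le_measure; rewrite ?inE.
- exact: measurable_bowen_ball.
- exact: measurable_bowen_ball.
rewrite /B addrC; move=> z; apply: bowen_ballD => //.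
by apply/(bowen_ballP _ _ _ _ (ltW n0)) => i ik; exact/ltW/xy.
Qed.

Lemma measurable_measure_bowen_ball k eps :
  measurable_fun [set: words m * borel X]
    (fun z => mu (bowen_ball f z.1 k z.2 eps)).
Proof.
apply: (@measurable_fun_prefix _ _ _ _ _ k) => [w|w w' x ww'] /=; last first.
  by rewrite (eq_bowen_ball _ _ ww').
apply: (measurability _ (ErealGenCInfty.measurableE R)).
move=> _ [_ [t ->] <-]; rewrite setTI -[X in measurable X]setCK.
apply: measurableC; apply: measurable_open.
rewrite (_ : ~` _ = [set x | (mu (bowen_ball f w k x eps) < t%:E)%E]).
  exact: open_measure_bowen_ball_lt.
apply/seteqP; split => x /=; rewrite in_itv/= andbT.
  by move/negP; rewrite -ltNge.
by move=> h; apply/negP; rewrite -ltNge.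
Qed.

Lemma measurable_skew_product : measurable_fun setT (skew_product f).
Proof.
apply: measurable_fun_pair.
  exact: measurableT_comp measurable_left_shift measurable_fst.
apply: (@measurable_fun_prefix _ _ _ _ _ 1%N) => [w|w w' x ww'] /=.
  by apply: continuous_measurable_borel; exact: hf.
by rewrite ww'.
Qed.

End orbits.

(** * Visits of an orbit and greedy tilings *)

Section archimedean_comparison.
Context {R : realType}.

Lemma le_of_affine_le (a b C : R) :
  (forall n : nat, a * n%:R <= b * n%:R + C) -> a <= b.
Proof.
move=> h; rewrite leNgt; apply/negP; rewrite -subr_gt0 => ab.
have := h (Num.truncn (C / (a - b))).+1.
have := truncnS_gt (C / (a - b)); rewrite ltr_pdivrMr// => C1 C2.
by move: C1; rewrite ltNge => /negP; apply; nra.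
Qed.

End archimedean_comparison.

Section visits.
Context {T : Type} (F : T -> T).
Implicit Types (E : set T) (z : T) (n k : nat).

Definition visits E n z : nat := (\sum_(i < n) (iter i F z \in E))%N.

Lemma visits0 E z : visits E 0 z = 0%N.
Proof. by rewrite /visits big_ord0. Qed.

Lemma visitsD E k n z :
  visits E (k + n) z = (visits E k z + visits E n (iter k F z))%N.
Proof.
rewrite /visits big_split_ord/=; congr addn; apply: eq_bigr => i _ /=.
by rewrite addnC iterD.
Qed.

Lemma visitsS E n z : visits E n.+1 z = ((z \in E) + visits E n (F z))%N.
Proof. by rewrite -add1n visitsD /visits big_ord1. Qed.

Lemma visitsC E n z : (visits E n z + visits (~` E) n z = n)%N.
Proof.
rewrite /visits -big_split/= -[RHS]card_ord -sum1_card; apply: eq_bigr => i _.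
by rewrite in_setC; case: (_ \in _).
Qed.

(** Cut the orbit greedily: from a point outside E2 jump along a block on
    which u grows at most at the rate c, from a point of E2 make a single step
    at the price M.  Only the last block can be cut short, which costs at
    most M * K. *)
Lemma tiling_bound {R : realType} (E1 E2 : set T) (c l M : R) (K : nat)
    (u : nat -> T -> R) :
  0 <= c -> 0 <= l -> 0 <= M ->
  (forall z, u 0%N z <= 0) ->
  (forall n z, u n.+1 z <= M + u n (F z)) ->
  (forall z, ~ E2 z -> exists k, (0 < k <= K)%N /\ forall n,
     u (k + n)%N z <=
       c * k%:R + l * (visits E1 k z)%:R + u n (iter k F z)) ->
  forall n z, u n z <= c * n%:R + l * (visits E1 n z)%:R +
                       M * (visits E2 n z)%:R + M * K%:R.
Proof.
move=> c0 l0 M0 u0 u1 uE n.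
have uM : forall n z, u n z <= M * n%:R.
  elim=> [|q IH] z; first by rewrite mulr0.
  rewrite (le_trans (u1 _ _))// -natr1 mulrDr mulr1 addrC lerD2r.
  exact: IH.
elim/ltn_ind: n => n IH z.
have ge0 E : 0 <= (visits E n z)%:R :> R by [].
have [zE2|zE2] := pselect (E2 z).
  case: n IH ge0 => [|n] IH ge0.
    rewrite (le_trans (u0 _))// mulr0 add0r.
    by rewrite !addr_ge0// mulr_ge0.
  apply: (le_trans (u1 _ _)); have := IH n (ltnSn n) (F z).
  rewrite !visitsS (mem_set zE2) !natrD -natr1/=.
  have : 0 <= l * (z \in E1)%:R by rewrite mulr_ge0.
  by nra.
have [k [/andP[k0 kK] uk]] := uE _ zE2.
have [kn|nk] := leqP k n; last first.
  apply: (le_trans (uM _ _)); rewrite -[leLHS]add0r lerD//.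
    by rewrite !addr_ge0// mulr_ge0.
  by rewrite ler_wpM2l// ler_nat (leq_trans (ltnW nk)).
rewrite -(subnKC kn); apply: (le_trans (uk _)).
have := IH (n - k)%N _ (iter k F z); rewrite ltn_subrL k0 (leq_trans k0 kn).
move=> /(_ isT); rewrite !visitsD !natrD.
have : 0 <= M * (visits E2 k z)%:R by rewrite mulr_ge0.
by nra.
Qed.

End visits.

Section measure_preserving.
Context {R : realType} d (T : measurableType d) (nu : probability T R).
Context (F : T -> T) (mF : measurable_fun setT F).
Hypothesis invF : measure_invariant nu F.
Implicit Types (E : set T) (n k : nat).

Lemma measurable_preimage E : measurable E -> measurable (F @^-1` E).
Proof. by move=> mE; rewrite -[X in measurable X]setTI; exact: mF. Qed.

Lemma measurable_iter_preimage n E :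
  measurable E -> measurable (iter n F @^-1` E).
Proof.
elim: n E => // n IH E mE.
rewrite (_ : _ @^-1` _ = iter n F @^-1` (F @^-1` E))//.
by apply: IH; exact: measurable_preimage.
Qed.

Lemma measurable_iter n : measurable_fun setT (iter n F).
Proof. by move=> _ B mB; rewrite setTI; exact: measurable_iter_preimage. Qed.

Lemma invariant_iter n E : measurable E -> nu (iter n F @^-1` E) = nu E.
Proof.
elim: n E => // n IH E mE.
rewrite (_ : _ @^-1` _ = iter n F @^-1` (F @^-1` E))//.
by rewrite IH ?invF//; exact: measurable_preimage.
Qed.

Lemma visitsE E n z :
  (visits F E n z)%:R = \sum_(i < n) \1_(iter i F @^-1` E) z :> R.
Proof.
rewrite /visits natr_sum; apply: eq_bigr => i _; rewrite indicE.
by congr (nat_of_bool _)%:R; apply/idP/idP; rewrite !inE.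
Qed.

Lemma measurable_visits E n : measurable E ->
  measurable_fun setT (fun z => (visits F E n z)%:R : R).
Proof.
move=> mE; under eq_fun do rewrite visitsE.
apply: measurable_sum => i; apply: measurable_indic.
exact: measurable_iter_preimage.
Qed.

Lemma integral_visits E n : measurable E ->
  (\int[nu]_z ((visits F E n z)%:R : R)%:E = (n%:R * fine (nu E))%:E)%E.
Proof.
move=> mE; under eq_integral do rewrite visitsE -sumEFin.
rewrite ge0_integral_sum//; last first.
  move=> i; apply/measurable_EFinP; apply: measurable_indic.
  exact: measurable_iter_preimage.
rewrite (eq_bigr (fun=> nu E)) => [|i _]; last first.
  rewrite integral_indic//; last exact: measurable_iter_preimage.
  by rewrite setIT; exact: invariant_iter.
rewrite big_const_ord; elim: n => [|n IH]; first by rewrite mul0r.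
rewrite iterS IH -natr1 mulrDl mul1r addrC EFinD fineK//.
exact: fin_num_measure.
Qed.

Lemma integral_tiling_bound (E1 E2 : set T) (a l M C : R) n :
  measurable E1 -> measurable E2 -> 0 <= a -> 0 <= l -> 0 <= M -> 0 <= C ->
  (\int[nu]_z (a * n%:R + l * (visits F E1 n z)%:R
               + M * (visits F E2 n z)%:R + C)%:E =
  ((a + l * fine (nu E1) + M * fine (nu E2)) * n%:R + C)%:E)%E.
Proof.
move=> mE1 mE2 a0 l0 M0 C0.
have mv (E : set T) (r : R) : measurable E ->
    measurable_fun setT (EFin \o (fun z => r * (visits F E n z)%:R)).
  move=> mE; apply/measurable_EFinP; apply: measurable_funM => //.
  exact: measurable_visits.
have iv (E : set T) (r : R) : 0 <= r -> measurable E ->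
   (\int[nu]_z (r * (visits F E n z)%:R)%:E = (r * (n%:R * fine (nu E)))%:E)%E.
  move=> r0 mE; under eq_integral do rewrite EFinM.
  rewrite ge0_integralZl//; last first.
    by apply/measurable_EFinP; exact: measurable_visits.
  by rewrite integral_visits.
have ic (r : R) : (\int[nu]_z r%:E = r%:E)%E.
  rewrite (integral_cst nu measurableT r%:E) -[RHS]mule1.
  by congr (_ * _)%E; exact: probability_setT.
have m1 := mv _ l mE1; have m2 := mv _ M mE2.
under eq_integral do rewrite !EFinD.
have v0 (E : set T) (r : R) z : 0 <= r -> (0 <= (r * (visits F E n z)%:R)%:E)%E.
  by move=> r0; rewrite lee_fin mulr_ge0.
have an0 : (0 <= (a * n%:R)%:E)%E by rewrite lee_fin mulr_ge0.
rewrite ge0_integralD//; last 2 first.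
- by move=> x _; rewrite !adde_ge0// v0.
- by do 2!apply: emeasurable_funD => //.
rewrite ge0_integralD//; last 3 first.
- by move=> x _; rewrite !adde_ge0// v0.
- exact: emeasurable_funD.
- by move=> x _; rewrite v0.
rewrite ge0_integralD//; last by move=> x _; rewrite v0.
rewrite !iv// !ic -!EFinD; congr EFin; ring.
Qed.

(** Continuity from below; this is how a property that holds almost everywhere
    with parameters depending on the point is made uniform off a small set. *)
Lemma exhaustion (G : nat -> set T) (e : R) : (forall n, measurable (G n)) ->
  {homo G : n m / (n <= m)%N >-> n `<=` m} ->
  {ae nu, forall z, exists n, G n z} -> 0 < e ->
  exists n, fine (nu (~` G n)) < e.
Proof.
move=> mG ndG aeG e0.
have mU : measurable (\bigcup_n G n) by exact: bigcup_measurable.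
have U1 : nu (\bigcup_n G n) = 1%E.
  have [N [mN N0 sub]] := aeG.
  apply/eqP; rewrite eq_le probability_le1//= -(probability_setT nu).
  rewrite -[leRHS]adde0 -N0; apply: le_trans (measureU2 _ _ _) => //.
  apply: le_measure; rewrite ?inE//; first exact: measurableU.
  move=> z _; have [Nz|Nz] := pselect (N z); [by right|left].
  have [n Gnz] : exists n, G n z by apply: contrapT => h; exact/Nz/sub.
  by exists n.
have Gcvg : nu (G n) @[n --> \oo] --> nu (\bigcup_n G n).
  apply: nondecreasing_cvg_mu => // n k nk; apply/subsetPset; exact: ndG.
have h : ((1 - e)%:E < nu (\bigcup_n G n))%E.
  by rewrite U1 lte_fin ltrBlDr ltrDl.
have [n Gn] : exists n, ((1 - e)%:E < nu (G n))%E.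
  apply: contrapT => /forallNP nG; move: h; apply/negP; rewrite -leNgt.
  rewrite -(cvg_lim _ Gcvg)//; apply: lime_le; first exact: cvgP Gcvg.
  by apply: nearW => n; rewrite leNgt; apply/negP; exact: nG.
exists n; rewrite probability_setC// fineB//; last exact: fin_num_measure.
by move: Gn; rewrite -[X in (_ < X)%E]fineK ?fin_num_measure// lte_fin/=; lra.
Qed.

(** Replacing E by the intersection of its iterated preimages gives an exactly
    invariant set of the same measure, to which ergodicity applies. *)
Lemma decreasing_invariant E : measurable E ->
  measure_ergodic nu F -> F @^-1` E `<=` E -> nu E = 0%E \/ nu E = 1%E.
Proof.
move=> mE ergF FE.
pose E' := \bigcap_n (iter n F @^-1` E).
have mn n : measurable (iter n F @^-1` E) by exact: measurable_iter_preimage.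
have mE' : measurable E' by exact: bigcapT_measurable.
have dec n k : (n <= k)%N -> iter k F @^-1` E `<=` iter n F @^-1` E.
  move=> /subnKC <-; elim: (k - n)%N => [|q IH]; first by rewrite addn0.
  by rewrite addnS => z /= /FE; exact: IH.
have E'E : nu E' = nu E.
  have cv : nu (iter n F @^-1` E) @[n --> \oo] --> nu E'.
    apply: nonincreasing_cvg_mu => //.
      by rewrite (le_lt_trans (probability_le1 _ _)) ?ltry.
    by move=> n k nk; apply/subsetPset; exact: dec.
  rewrite -(cvg_lim _ cv)//; apply: lim_near_cst => //.
  by apply: nearW => n; exact: invariant_iter.
rewrite -E'E; apply: ergF => //; apply/seteqP; split => z.
  move=> h n _; case: n => [|n]; first by apply: FE; exact: (h 0%N I).
  by rewrite /preimage/= -iterS iterSr; exact: (h n I).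
by move=> h n _; rewrite /preimage/= -iterSr; exact: (h n.+1 I).
Qed.

End measure_preserving.

(** * Birkhoff's theorem for sets *)

Section birkhoff.
Context {R : realType} d (T : measurableType d) (nu : probability T R).
Context (F : T -> T) (mF : measurable_fun setT F).
Hypothesis invF : measure_invariant nu F.
Hypothesis ergF : measure_ergodic nu F.
Implicit Types (E : set T) (n k j : nat) (a : R).

(** The points whose visits to E have lower density below a.  The margin in a
    makes the set exactly invariant, as ergodicity requires. *)
Definition low_density E a : set T := [set z | exists j, forall N, exists n,
  (N <= n)%N /\ (visits F E n z)%:R <= n%:R * (a - j.+1%:R^-1) :> R].

Lemma measurable_low_density E a : measurable E -> measurable (low_density E a).
Proof.
move=> mE; have -> : low_density E a = \bigcup_j \bigcap_N \bigcup_(n in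
    [set n | (N <= n)%N])
    [set z | (visits F E n z)%:R <= n%:R * (a - j.+1%:R^-1) :> R].
  apply/seteqP; split => z.
    by move=> [j h]; exists j => // N _; have [n [Nn hn]] := h N; exists n.
  by move=> [j _ h]; exists j => N; have [n Nn hn] := h N I; exists n.
apply: bigcupT_measurable => j; apply: bigcapT_measurable => N.
apply: bigcup_measurable => n _.
rewrite -[X in measurable X]setTI.
apply: measurable_fun_le => //; exact: measurable_visits.
Qed.

Lemma harmonic_split j :
  (j.+1%:R^-1 : R) = j.+2%:R^-1 + (j.+2%:R * j.+1%:R)^-1.
Proof.
have := ler0n R j; rewrite -(natr1 j.+1) -natr1; move: (j%:R : R) => t t0.
by field; apply/andP; split; lra.
Qed.

(** Passing from z to its image changes the number of visits by at most one,
    which for large n is absorbed by a smaller margin. *)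
Lemma low_density_invariant E a : F @^-1` low_density E a = low_density E a.
Proof.
apply/seteqP; split => z /= [j h]; exists j.+1 => N; last first.
  (* For such n the change of margin, 1 / ((j + 1) (j + 2)), times n exceeds the
     at most |a| + 1 by which the bound moves when n becomes n - 1. *)
  have [n [Nn hn]] := h
    (maxn N.+1 (Num.truncn ((`|a| + 1) * j.+2%:R * j.+1%:R)).+1).
  move: Nn; rewrite geq_max => /andP[].
  case: n hn => // n; rewrite ltnS => hn Nn tn; exists n; split => //.
  move: hn; rewrite visitsS natrD.
  have : (`|a| + 1) * j.+2%:R * j.+1%:R <= n.+1%:R.
    by apply/ltW/(lt_le_trans (truncnS_gt _)); rewrite ler_nat.
  rewrite harmonic_split -mulrA; set q := j.+2%:R * j.+1%:R => nq.
  have q0 : 0 < q by rewrite mulr_gt0.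
  have : `|a| + 1 <= n.+1%:R * q^-1 by rewrite ler_pdivlMr.
  have : 0 <= ((z \in E)%:R : R) by [].
  have : 0 <= (j.+2%:R^-1 : R) <= 1.
    by rewrite invr_ge0 ler0n/= invf_le1 ?ler1n.
  have := ler_norm (- a); rewrite normrN.
  have := ler_norm a.
  rewrite -(natr1 n).
  by move: ((visits _ _ _ _)%:R : R) (j.+2%:R^-1 : R) (q^-1 : R) => v x y; nra.
(* One more visit may occur now, hence |a| + 2 instead of |a| + 1. *)
have [n [Nn hn]] := h (maxn N (Num.truncn ((`|a| + 2) * j.+2%:R * j.+1%:R)).+1).
move: Nn; rewrite geq_max => /andP[Nn tn]; exists n.+1; split.
  exact: leq_trans Nn _.
move: hn; rewrite visitsS natrD.
have : (`|a| + 2) * j.+2%:R * j.+1%:R <= n%:R.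
  by apply/ltW/(lt_le_trans (truncnS_gt _)); rewrite ler_nat.
rewrite harmonic_split -mulrA; set q := j.+2%:R * j.+1%:R => nq.
have q0 : 0 < q by rewrite mulr_gt0.
have : `|a| + 2 <= n%:R * q^-1 by rewrite ler_pdivlMr.
have : ((z \in E)%:R : R) <= 1 by case: (_ \in _).
have : 0 <= (j.+2%:R^-1 : R) <= 1.
  by rewrite invr_ge0 ler0n/= invf_le1 ?ler1n.
have := ler_norm (- a); rewrite normrN.
have := ler_norm a.
rewrite -(natr1 n).
by move: ((visits _ _ _ _)%:R : R) (j.+2%:R^-1 : R) (q^-1 : R) => v x y; nra.
Qed.

(** By ergodicity the set is null or conull.  If it were conull, almost all
    orbits could be tiled by blocks in each of which the proportion of visits is
    at most a, so that the mean number of visits per step would be at most a. *)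
Lemma low_density_null E a : measurable E -> a < fine (nu E) ->
  nu (low_density E a) = 0%E.
Proof.
move=> mE aE.
have [//|L1] := ergF (measurable_low_density a mE) (low_density_invariant E a).
suff : fine (nu E) <= a by rewrite leNgt aE.
have mL := measurable_low_density a mE.
have aeL : {ae nu, forall z, low_density E a z}.
  exists (~` low_density E a); split => //; first exact: measurableC.
  by rewrite probability_setC// L1 subee.
have [a0|a0] := ltP a 0.
  have [z Lz] : low_density E a !=set0.
    apply/set0P/eqP => L0; move: L1; rewrite L0 measure0 => /eqP.
    by rewrite eq_sym onee_eq0.
  case: Lz => j /(_ 1%N)[n [n1 hn]].
  suff : (visits F E n z)%:R < 0 :> R by rewrite ltNge ler0n.
  apply: le_lt_trans hn _; rewrite pmulr_rlt0 ?ltr0n//.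
  by rewrite subr_lt0 (lt_trans a0).
apply/ler_addgt0Pr => e e0.
pose G K := [set z | exists k, (0 < k <= K)%N /\
  (visits F E k z)%:R <= a * k%:R :> R].
have mG K : measurable (G K).
  have -> : G K = \bigcup_(k in [set k | (0 < k <= K)%N])
      [set z | (visits F E k z)%:R <= a * k%:R :> R].
    apply/seteqP; split => z; first by move=> [k [kK hk]]; exists k.
    by move=> [k kK hk]; exists k.
  apply: bigcup_measurable => k _; rewrite -[X in measurable X]setTI.
  apply: measurable_fun_le => //; exact: measurable_visits.
have [K GK] : exists K, fine (nu (~` G K)) < e.
  apply: exhaustion => //.
  - move=> k k' kk z [q [/andP[q0 qk] hq]]; exists q; split => //.
    by rewrite q0 (leq_trans qk).
  - apply: filterS aeL => z [j /(_ 1%N)[n [n1 hn]]].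
    exists n, n; rewrite n1 leqnn; split => //.
    by rewrite (le_trans hn)// mulrC ler_wpM2r// gerBl.
have mGC : measurable (~` G K) by exact: measurableC.
have tile : forall n z, (visits F E n z)%:R <=
    a * n%:R + 0 * (visits F set0 n z)%:R
    + 1 * (visits F (~` G K) n z)%:R + 1 * K%:R :> R.
  apply: (@tiling_bound _ F R) => //.
  - by move=> z; rewrite visits0.
  - by move=> n z; rewrite visitsS natrD lerD2r; case: (_ \in _).
  - move=> z /contrapT [k [kK hk]]; exists k; split => // n.
    by rewrite visitsD natrD mul0r addr0 lerD2r.
apply: (@le_trans _ _ (a + 0 * fine (nu set0) + 1 * fine (nu (~` G K)))).
  apply: (@le_of_affine_le _ _ _ (1 * K%:R)) => n.
  rewrite -lee_fin mulrC -(integral_visits mF invF n mE).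
  rewrite -(integral_tiling_bound mF invF)//.
  apply: ge0_le_integral => //.
  - by apply/measurable_EFinP; exact: measurable_visits.
  - apply/measurable_EFinP; do !apply: measurable_funD => //;
      apply: measurable_funM => //; exact: measurable_visits.
  - by move=> z _; rewrite lee_fin; exact: tile.
by rewrite mul0r addr0 mul1r lerD2l ltW.
Qed.

(** The lower density of the visits to E is at least the measure of E, by
    low_density_null; applied to the complement of E, the same bound says that
    the upper density is at most the measure of E. *)
Theorem birkhoff_visits E : measurable E ->
  {ae nu, forall z, (visits F E n z)%:R / n%:R @[n --> \oo] --> fine (nu E)}.
Proof.
move=> mE.
have lowae E' : measurable E' -> {ae nu, forall z, forall j,
    ~ low_density E' (fine (nu E') - j.+1%:R^-1) z}.
  move=> mE'; apply/ae_foralln => j.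
  exists (low_density E' (fine (nu E') - j.+1%:R^-1)); split.
  - exact: measurable_low_density.
  - by apply: low_density_null => //; rewrite ltrBlDr ltrDl.
  - by move=> z /= /contrapT.
have mEC : measurable (~` E) by exact: measurableC.
apply: filterS2 (lowae _ mE) (lowae _ mEC) => z hE hEC.
have freq E' : (forall j, ~ low_density E' (fine (nu E') - j.+1%:R^-1) z) ->
    forall e : R, 0 < e -> \forall n \near \oo,
      fine (nu E') - e <= (visits F E' n z)%:R / n%:R.
  move=> h e e0; have [j je] : exists j, j.+1%:R^-1 < e / 2 :> R.
    by apply: harmonic_lt; rewrite divr_gt0.
  have /forallNP/(_ j)/existsNP[N /forallNP hN] := h j.
  near=> n.
  have n0 : 0 < n%:R :> R by rewrite ltr0n; near: n; exists 1%N.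
  have /not_andP[|/negP] := hN n; first by move=> []; near: n; exists N.
  rewrite -ltNge => hn; rewrite ler_pdivlMr// mulrC ltW// (le_lt_trans _ hn)//.
  rewrite ler_wpM2l//; move: je; move: (j.+1%:R^-1 : R) => t; lra.
apply/cvgrPdist_le => e e0; near=> n.
have n0 : 0 < n%:R :> R by rewrite ltr0n; near: n; exists 1%N.
have h1 : fine (nu E) - e <= (visits F E n z)%:R / n%:R.
  by near: n; exact: freq.
have : fine (nu (~` E)) - e <= (visits F (~` E) n z)%:R / n%:R.
  by near: n; exact: freq.
have -> : (visits F (~` E) n z)%:R / n%:R = 1 - (visits F E n z)%:R / n%:R :> R.
  rewrite -[X in X - _](divff (lt0r_neq0 n0)) -mulrBl; congr (_ / _).
  by rewrite -{2}(visitsC F E n z) natrD addrAC subrr add0r.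
rewrite probability_setC// fineB//; last exact: fin_num_measure.
rewrite ler_norml /=; lra.
Unshelve. all: by end_near. Qed.

End birkhoff.

(** * Subadditive sequences and Gibbs' inequality *)

Section fekete.
Context {R : realType}.

Lemma fekete (a : nat -> R) : (forall n, 0 <= a n) ->
  (forall k n, a (k + n)%N <= a k + a n) ->
  cvgn (fun n => n%:R^-1 * a n).
Proof.
move=> a0 suba.
have amul k q r : a (q * k + r)%N <= q%:R * a k + a r.
  elim: q => [|q IH]; first by rewrite mul0n add0n mul0r add0r.
  rewrite mulSn -addnA (le_trans (suba _ _))// -natr1 mulrDl mul1r.
  by rewrite [leRHS](_ : _ = a k + (q%:R * a k + a r)); [rewrite lerD2l|ring].
pose S := [set k.+1%:R^-1 * a k.+1 | k in [set: nat]].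
have S0 : has_inf S.
  split; first by exists (1%:R^-1 * a 1%N), 0%N.
  by exists 0 => _ [k _ <-]; rewrite mulr_ge0.
apply/cvg_ex; exists (inf S); apply/cvgrPdist_le => e e0.
have [_ [k _ <-] ke] : exists2 x, S x & x < inf S + e / 2.
  by apply: inf_adherent => //; rewrite divr_gt0.
pose C := \sum_(r < k.+1) a r.
have C0 : 0 <= C by apply: sumr_ge0 => r _; exact: a0.
near=> n.
have n0 : 0 < n%:R :> R by rewrite ltr0n; near: n; exists 1%N.
have inS : inf S <= n%:R^-1 * a n.
  apply: ge_inf; first by case: S0.
  exists n.-1 => //; rewrite prednK//.
  by move: n0; rewrite ltr0n.
rewrite ler0_norm ?subr_le0// opprB lerBlDr.
have nC : C / (e / 2) <= n%:R.
  near: n; exists (Num.truncn (C / (e / 2))).+1 => // n /= nn.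
  by apply/ltW/(lt_le_trans (truncnS_gt _)); rewrite ler_nat.
have ar : a (n %% k.+1)%N <= C.
  rewrite /C (bigD1 (Ordinal (ltn_pmod n (ltn0Sn k))))//= lerDl.
  by apply: sumr_ge0 => r _; exact: a0.
have an : a n <= n%:R * (k.+1%:R^-1 * a k.+1) + C.
  rewrite {1}(divn_eq n k.+1) (le_trans (amul _ _ _))// lerD//.
  rewrite mulrA ler_wpM2r// ler_pdivlMr// -natrM ler_nat.
  exact: leq_divM.
rewrite ler_pdivrMr ?divr_gt0// in nC.
rewrite mulrC ler_pdivrMr// (le_trans an)//.
have : n%:R * (k.+1%:R^-1 * a k.+1) <= n%:R * (inf S + e / 2).
  by rewrite ler_wpM2l// ltW.
by move: (n%:R * (_ * a k.+1)) nC => y nC; rewrite mulrDr mulrDl; lra.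
Unshelve. all: by end_near. Qed.

End fekete.

Section finite_valued.
Context {R : realType} d (T : measurableType d) (mu : probability T R).
Context (I : finType) (fn : T -> I).
Hypothesis mfn : forall i, measurable (fn @^-1` [set i]).
Local Open Scope ereal_scope.
Implicit Types (c : I -> \bar R) (g : T -> \bar R) (Q : I -> R).

Lemma measurable_fun_finite d' (T' : measurableType d') (c : I -> T') :
  measurable_fun setT (c \o fn).
Proof.
move=> _ B mB; rewrite setTI.
have -> : (c \o fn) @^-1` B = \bigcup_(i in [set i | B (c i)]) fn @^-1` [set i].
  apply/seteqP; split => x /=; first by move=> Bx; exists (fn x).
  by move=> [i /= Bi ->].
by apply: fin_bigcup_measurable => // i _; exact: mfn.
Qed.

Lemma integral_fibers g : measurable_fun setT g -> (forall x, 0 <= g x) ->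
  \int[mu]_x g x = \sum_(i : I) \int[mu]_(x in fn @^-1` [set i]) g x.
Proof.
move=> mg g0; have <- : \big[setU/set0]_(i <- index_enum I) (fn @^-1` [set i])
    = [set: T].
  apply/seteqP; split => // x _; rewrite -bigcup_seq; exists (fn x) => //=.
  by rewrite mem_index_enum.
rewrite ge0_integral_bigsetU//.
- exact: index_enum_uniq.
- by move=> i j _ _ [x [/= <- <-]].
- exact: measurable_funTS.
Qed.

Lemma integral_finite c : (forall i, 0 <= c i) ->
  \int[mu]_x c (fn x) = \sum_(i : I) c i * mu (fn @^-1` [set i]).
Proof.
move=> c0; rewrite integral_fibers//; last exact: measurable_fun_finite.
apply: eq_bigr => i _; rewrite -integral_cst//.
by apply: eq_integral => x; rewrite inE/= => ->.
Qed.

Lemma sum_fibers : (\sum_i fine (mu (fn @^-1` [set i])) = 1)%R.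
Proof.
apply: EFin_inj; rewrite -sumEFin.
transitivity (\int[mu]_x (cst 1 (fn x))).
  rewrite (@integral_finite (cst 1))//.
  by apply: eq_bigr => i _; rewrite mul1e fineK//; exact: fin_num_measure.
by rewrite (integral_cst mu measurableT 1) mul1e; exact: probability_setT.
Qed.

Lemma entropy_integral :
  - \sum_(i : I) mu (fn @^-1` [set i]) * lne (mu (fn @^-1` [set i])) =
  \int[mu]_x - lne (mu (fn @^-1` [set fn x])).
Proof.
rewrite (integral_finite (c := fun i => - lne (mu (fn @^-1` [set i])))).
  rewrite -fin_num_sumeN.
    by apply: eq_bigr => i _; rewrite muleC mulNe muleC.
  move=> i _; rewrite -[mu _]fineK ?fin_num_measure//.
  have := fine_ge0 (measure_ge0 mu (fn @^-1` [set i])).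
  rewrite le_eqVlt => /predU1P[<-|r0]; first by rewrite mul0e.
  by rewrite lne_EFin.
by move=> i; rewrite oppe_ge0 lne_le0; exact: probability_le1.
Qed.

(** In multiplied-out form, so that both masses may vanish, this is the bound
    ln t <= t - 1 at t = q / r. *)
Lemma gibbs_term (r q : R) : (0 <= r)%R -> (0 <= q)%R ->
  - lne r%:E * r%:E + r%:E <= - lne q%:E * r%:E + q%:E.
Proof.
rewrite le_eqVlt => /predU1P[<-|r0] q0; first by rewrite !mule0 !add0e.
move: q0; rewrite le_eqVlt => /predU1P[<-|q0].
  by rewrite (le0_lneNy (lexx 0)) /= mulyr gtr0_sg// mul1e leey.
rewrite !lne_EFin// -!EFinN -!EFinM -!EFinD lee_fin.
have : (ln (q / r) <= q / r - 1)%R.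
  rewrite -{1}(subrK 1%R (q / r)%R) addrC le_ln1Dx// ltrBrDl subrr.
  exact: divr_gt0.
rewrite ln_div ?posrE// => h.
have : (r * (ln q - ln r) <= r * (q / r - 1))%R by rewrite ler_wpM2l// ltW.
have rqE : (r * (q / r - 1) = q - r)%R by field; exact: lt0r_neq0.
by rewrite rqE mulrBr; lra.
Qed.

(** Gibbs' inequality.  Summing the termwise bound leaves the total mass 1 on
    the left and the sum of Q, at most 1, on the right.  It is used with Q the
    weight of an explicit code of the atoms. *)
Lemma gibbs Q : (forall i, 0 <= Q i)%R -> (\sum_i Q i <= 1)%R ->
  \int[mu]_x - lne (mu (fn @^-1` [set fn x])) <=
  \int[mu]_x - lne (Q (fn x))%:E.
Proof.
move=> Q0 Q1.
have Qle1 i : (Q i <= 1)%R.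
  by rewrite (le_trans _ Q1)// (bigD1 i)//= lerDl sumr_ge0.
have l0 i : 0 <= - lne (mu (fn @^-1` [set i])).
  by rewrite oppe_ge0 lne_le0; exact: probability_le1.
have q0 i : 0 <= - lne (Q i)%:E by rewrite oppe_ge0 lne_le0 lee_fin.
rewrite (integral_finite l0) (integral_finite q0).
have mu1 : \sum_(i : I) mu (fn @^-1` [set i]) = 1.
  rewrite -sum_fibers -sumEFin; apply: eq_bigr => i _.
  by rewrite fineK//; exact: fin_num_measure.
rewrite -(@leeD2rE _ 1)// -{1}mu1 -big_split/=.
apply: (@le_trans _ _ (\sum_(i : I) (- lne (Q i)%:E * mu (fn @^-1` [set i]) +
    (Q i)%:E))).
  apply: lee_sum => i _; have := gibbs_term (fine_ge0 (measure_ge0 mu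
    (fn @^-1` [set i]))) (Q0 i).
  by rewrite fineK//; exact: fin_num_measure.
by rewrite big_split/= leeD2l// sumEFin lee_fin.
Qed.

Lemma entropy_le_ln_card :
  \int[mu]_x - lne (mu (fn @^-1` [set fn x])) <= (ln #|I|%:R)%:E.
Proof.
have I0 : (0 < #|I|)%N.
  have [x _] : [set: T] !=set0.
    apply/set0P/eqP => T0; have := probability_setT mu.
    by rewrite T0 measure0 => /esym/eqP; rewrite onee_eq0.
  by apply/card_gt0P; exists (fn x).
have := @gibbs (fun=> #|I|%:R^-1)%R.
rewrite big_const iter_addr addr0 -(mulr_natl (#|I|%:R^-1)) divff
    ?pnatr_eq0 -?lt0n//.
move=> /(_ _ (lexx _)) h; apply: (le_trans (h _)) => //.
rewrite (integral_cst mu measurableT) lne_EFin ?invr_gt0 ?ltr0n//.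
rewrite [X in _ * X](@probability_setT _ _ _ mu) mule1 lnV ?posrE ?ltr0n//.
by rewrite EFinN oppeK.
Qed.

End finite_valued.

Section invariant_integral.
Context {R : realType} d (T : measurableType d) (nu : probability T R).
Context (F : T -> T) (mF : measurable_fun setT F).
Hypothesis invF : measure_invariant nu F.
Local Open Scope ereal_scope.

Lemma integral_iter_invariant n (g : T -> \bar R) : measurable_fun setT g ->
  (forall z, 0 <= g z) -> \int[nu]_z g (iter n F z) = \int[nu]_z g z.
Proof.
move=> mg g0; have mFn := measurable_iter mF n.
have := @ge0_integral_pushforward _ _ _ _ R _ mFn nu setT g measurableT mg.
rewrite preimage_setT => /(_ (fun z _ => g0 z)) <-.
apply: eq_measure_integral => A mA _.
exact: (invariant_iter mF invF).
Qed.

End invariant_integral.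

(** * Entropy of a partition along random orbits *)

Section labels.
Context {R : realType} {X : pmetricType R} {m : nat}.
Context (f : 'I_m.+1 -> X -> X) (hf : forall i, continuous (f i)).
Context (A : finType) (g : borel X -> A).
Hypothesis mg : forall a, measurable (g @^-1` [set a]).

Lemma measurable_label_iter (w : words m) n (B : set A) :
  measurable ((fun x => g (fiber_iter f w n x)) @^-1` B : set (borel X)).
Proof.
have -> : (fun x => g (fiber_iter f w n x)) @^-1` B =
    \bigcup_(a in B) (fiber_iter f w n @^-1` (g @^-1` [set a])) :> set
        (borel X).
  apply/seteqP; split => x /=; first by exists (g (fiber_iter f w n x)).
  by move=> [a Ba /= ->].
apply: fin_bigcup_measurable => // a _; rewrite -[X in measurable X]setTI.
exact: (measurable_fiber_iter hf).
Qed.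

End labels.

Section coded_partition.
Context {R : realType} {X : pmetricType R} {m : nat}.
Context (f : 'I_m.+1 -> X -> X) (hf : forall i, continuous (f i)).
Context (P : probability (words m) R) (mu : probability (borel X) R).
Hypothesis invF : measure_invariant (P \x mu)%E (skew_product f).
Context (s : nat) (sym : borel X -> 'I_s).
Hypothesis msym : forall i, measurable (sym @^-1` [set i]).
Implicit Types (w : words m) (x : X) (k n : nat) (z : words m * borel X).

Local Notation F := (skew_product f).
Local Notation nu := (P \x mu)%E.
Local Notation xi := (fun i => sym @^-1` [set i]).

Definition atom w k x : set (borel X) :=
  [set y | forall i, (i < k)%N ->
    sym (fiber_iter f w i y) = sym (fiber_iter f w i x)].

Definition information k z : \bar R := (- lne (mu (atom z.1 k z.2)))%E.

Definition itinerary w k x : {ffun 'I_k -> 'I_s} :=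
  [ffun i : 'I_k => sym (fiber_iter f w i x)].

Lemma itinerary_fiber w k x :
  itinerary w k @^-1` [set itinerary w k x] = atom w k x.
Proof.
apply/seteqP; split => y /=.
  by move=> /ffunP h i ik; have := h (Ordinal ik); rewrite !ffunE.
by move=> h; apply/ffunP => i; rewrite !ffunE h.
Qed.

Lemma partition_joinE w k (a : {ffun 'I_k -> 'I_s}) :
  partition_join f w xi a = itinerary w k @^-1` [set a].
Proof.
apply/seteqP; split => y /=.
  by move=> h; apply/ffunP => i; rewrite ffunE; exact: h.
by move=> <- i _ /=; rewrite ffunE.
Qed.

Lemma measurable_itinerary w k a :
  measurable (itinerary w k @^-1` [set a] : set (borel X)).
Proof.
have -> : itinerary w k @^-1` [set a] = \bigcap_(i in [set: 'I_k])
    ((fun x => sym (fiber_iter f w i x)) @^-1` [set a i]) :> set (borel X).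
  apply/seteqP; split => x /=; first by move=> <- i _ /=; rewrite ffunE.
  by move=> h; apply/ffunP => i; rewrite ffunE; exact: (h i).
by apply: fin_bigcap_measurable => // i _;
    exact: (measurable_label_iter hf msym).
Qed.

Lemma measurable_atom w k x : measurable (atom w k x).
Proof. by rewrite -itinerary_fiber; exact: measurable_itinerary. Qed.

Lemma information_ge0 k z : (0 <= information k z)%E.
Proof.
rewrite oppe_ge0 lne_le0; apply: probability_le1; exact: measurable_atom.
Qed.

Lemma eq_atom w w' k x : same_prefix k w w' -> atom w k x = atom w' k x.
Proof.
move=> ww'; apply/seteqP; split => y h i ik.
  by rewrite -!(eq_fiber_iter f _ ww' (ltnW ik)) h.
by rewrite !(eq_fiber_iter f _ ww' (ltnW ik)) h.
Qed.

Lemma measurable_information k :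
  measurable_fun [set: words m * borel X] (information k).
Proof.
apply: (@measurable_fun_prefix _ _ _ _ _ k) => [w|w w' x ww']; last first.
  by rewrite /information/= (eq_atom _ ww').
rewrite (_ : (fun x => _) =
    (fun a => - lne (mu (itinerary w k @^-1` [set a])))%E \o itinerary w k).
  by apply: measurable_fun_finite; exact: measurable_itinerary.
by apply/funext => x; rewrite /information/= itinerary_fiber.
Qed.

Lemma measurable_information_fiber w k :
  measurable_fun [set: borel X] (fun x => information k (w, x)).
Proof. exact: measurableT_comp (measurable_information k)
    (pair1_measurable w). Qed.

Lemma shannon_entropyE w k :
  shannon_entropy mu (@partition_join _ _ _ f w k s xi) =
  (\int[mu]_x information k (w, x))%E.
Proof.
rewrite /shannon_entropy; under eq_bigr do rewrite partition_joinE.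
rewrite entropy_integral; last exact: measurable_itinerary.
by apply: eq_integral => x _; rewrite itinerary_fiber.
Qed.

Lemma integral_shannon_entropy k :
  (\int[P]_w shannon_entropy mu (@partition_join _ _ _ f w k s xi) =
   \int[nu]_z information k z)%E.
Proof.
rewrite fubini_tonelli1//=; first by apply: eq_integral => w _;
  rewrite shannon_entropyE.
- exact: measurable_information.
- exact: information_ge0.
Qed.

Lemma information_fin_num k : (\int[nu]_z information k z)%E \is a fin_num.
Proof.
rewrite ge0_fin_numE; last by apply: integral_ge0 => z _;
    exact: information_ge0.
rewrite -integral_shannon_entropy.
apply: (@le_lt_trans _ _ (\int[P]_w
    (ln #|{ffun 'I_k -> 'I_s}|%:R)%:E)%E).
  apply: ge0_le_integral => //.
  - move=> w _; rewrite shannon_entropyE; apply: integral_ge0 => x _.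
    exact: information_ge0.
  - apply: (@measurable_fun_prefix1 _ _ _ k) => w w' ww'.
    rewrite !shannon_entropyE; apply: eq_integral => x _.
    by rewrite /information/= (eq_atom _ ww').
  - move=> w _; rewrite shannon_entropyE.
    have := @entropy_le_ln_card R _ _ mu _ _ (@measurable_itinerary w k).
    apply: le_trans; rewrite le_eqVlt; apply/orP; left; apply/eqP.
    by apply: eq_integral => x _; rewrite itinerary_fiber.
rewrite (integral_cst P measurableT).
by rewrite [X in (_ * X)%E](@probability_setT _ _ _ P) mule1 ltry.
Qed.

Lemma information_gibbs (I : finType) (fn : borel X -> I) w k (Q : I -> R) :
  (forall i, measurable (fn @^-1` [set i])) ->
  (forall x, fn @^-1` [set fn x] = atom w k x) ->
  (forall i, 0 <= Q i) -> \sum_i Q i <= 1 ->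
  (\int[mu]_x information k (w, x) <= \int[mu]_x - lne (Q (fn x))%:E)%E.
Proof.
move=> mfn fnE Q0 Q1; apply: le_trans (gibbs mu mfn Q0 Q1).
rewrite le_eqVlt; apply/orP; left; apply/eqP.
by apply: eq_integral => x _; rewrite fnE.
Qed.

Lemma oppe_lneM (a b : R) : 0 <= a <= 1 -> 0 <= b <= 1 ->
  (- lne (a * b)%:E = - lne a%:E - lne b%:E)%E.
Proof.
have neqNy (c : R) : c <= 1 -> (- lne c%:E != -oo)%E.
  move=> c1; rewrite gt_eqF// (lt_le_trans ltNy0)//.
  by rewrite oppe_ge0 lne_le0 lee_fin.
have lne0 : (- lne 0%:E = +oo :> \bar R)%E by rewrite le0_lneNy.
move=> /andP[]; rewrite le_eqVlt => /predU1P[<-|a0] a1 /andP[].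
  by move=> _ b1; rewrite mul0r lne0 addye// neqNy.
rewrite le_eqVlt => /predU1P[<-|b0] b1.
  by rewrite mulr0 lne0 addey// neqNy.
by rewrite !lne_EFin ?mulr_gt0// lnM ?posrE// -EFinN opprD EFinD.
Qed.

(** By Gibbs' inequality in each fibre, coding with the product of the laws of
    the first k and of the last n symbols costs at least the information of all
    k + n of them; by invariance the last n symbols cost on average as much as
    the first n. *)
Lemma information_subadditive k n :
  (\int[nu]_z information (k + n) z <=
   \int[nu]_z information k z + \int[nu]_z information n z)%E.
Proof.
have mi := measurable_information; have i0 := information_ge0.
have mF := measurable_skew_product hf.
have mFk : measurable_fun [set: words m * borel X]
    (fun z => information n (iter k F z)).
  exact: measurableT_comp (mi n) (measurable_iter mF k).
rewrite -[X in (_ <= _ + X)%E](integral_iter_invariant mF invF k (mi n))//.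
rewrite -ge0_integralD//.
rewrite fubini_tonelli1// fubini_tonelli1//; last 2 first.
- exact: emeasurable_funD.
- by move=> z; rewrite adde_ge0.
apply: ge0_le_integral => //.
- by move=> w _; apply: integral_ge0.
- exact: measurable_fun_fubini_tonelli_F.
- apply: measurable_fun_fubini_tonelli_F => //.
    exact: emeasurable_funD.
  by move=> z; rewrite adde_ge0.
move=> w _; rewrite /fubini_F.
pose w' := shift_word k w.
pose fn (x : borel X) := (itinerary w k x, itinerary w' n (fiber_iter f w k x)).
pose q1 b := fine (mu (itinerary w k @^-1` [set b])).
pose q2 b := fine (mu (itinerary w' n @^-1` [set b])).
have q_le1 (A : set (borel X)) : measurable A -> 0 <= fine (mu A) <= 1.
  move=> mA; rewrite fine_ge0//= -lee_fin fineK ?fin_num_measure//.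
  exact: probability_le1.
have sum1 w0 k0 : \sum_b fine (mu (itinerary w0 k0 @^-1` [set b])) = 1.
  by apply: sum_fibers; exact: measurable_itinerary.
apply: le_trans (@information_gibbs _ fn w (k + n)
    (fun b => q1 b.1 * q2 b.2) _ _ _ _) _.
- move=> [a b]; rewrite (_ : _ @^-1` _ = itinerary w k @^-1` [set a] `&`
      (fiber_iter f w k @^-1` (itinerary w' n @^-1` [set b]))).
    apply: measurableI; first exact: measurable_itinerary.
    rewrite -[X in measurable X]setTI.
    apply: (measurable_fiber_iter hf) => //; exact: measurable_itinerary.
  by apply/seteqP; split => x [/= <- <-].
- move=> x; apply/seteqP; split => y /=.
    move=> [/ffunP h1 /ffunP h2] i ikn; have [ik|ki] := ltnP i k.
      by have := h1 (Ordinal ik); rewrite !ffunE.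
    have ikn' : (i - k < n)%N by rewrite ltn_subLR.
    have := h2 (Ordinal ikn'); rewrite !ffunE/= /w'.
    by rewrite -!fiber_iterD subnKC.
  move=> h; congr pair; apply/ffunP => i; rewrite !ffunE.
    by apply: h; rewrite (leq_trans (ltn_ord i))// leq_addr.
  by rewrite -!fiber_iterD; apply: h; rewrite ltn_add2l.
- by move=> b; rewrite mulr_ge0// fine_ge0.
- rewrite -(pair_bigA _ (fun a b => q1 a * q2 b))/=.
  under eq_bigr do rewrite -mulr_sumr sum1 mulr1.
  by rewrite sum1.
rewrite le_eqVlt; apply/orP; left; apply/eqP.
apply: eq_integral => x _; rewrite /fn/= iter_skew_product /information/=.
have := q_le1 _ (@measurable_itinerary w k (itinerary w k x)).
have := q_le1 _ (@measurable_itinerary w' n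
    (itinerary w' n (fiber_iter f w k x))).
rewrite /q1 /q2 => b01 a01; rewrite oppe_lneM//.
rewrite !itinerary_fiber !fineK//; apply: fin_num_measure;
    exact: measurable_atom.
Qed.

Lemma cvg_partition_entropy :
  ((k%:R^-1)%:E * \int[nu]_z information k z)%E @[k --> \oo] -->
  partition_entropy f P mu xi.
Proof.
rewrite /partition_entropy.
rewrite (_ : (fun k => _) = fun k =>
    ((k%:R^-1)%:E * \int[nu]_z information k z)%E);
  last first.
  by apply/funext => k; rewrite integral_shannon_entropy.
pose a k := fine (\int[nu]_z information k z)%E.
have aE : (fun k => ((k%:R^-1)%:E * \int[nu]_z information k z)%E) =
    EFin \o (fun k => k%:R^-1 * a k).
  by apply/funext => k/=; rewrite EFinM /a fineK//; exact: information_fin_num.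
have a0 k : 0 <= a k.
  by apply/fine_ge0/integral_ge0 => z _; exact: information_ge0.
have /cvg_ex[l al] : cvgn (fun k => k%:R^-1 * a k).
  apply: fekete => // k n; rewrite -lee_fin EFinD !fineK ?information_fin_num//.
  exact: information_subadditive.
have al' : (EFin \o (fun k => k%:R^-1 * a k)) k @[k --> \oo] --> l%:E.
  by apply/fine_cvgP; split => //; exact: nearW.
by rewrite aE (cvg_lim _ al').
Qed.

End coded_partition.

(** * Closed regularity and separated cores *)

Lemma measure_bigsetU_le {R : realType} d (T : measurableType d)
    (mu : {measure set T -> \bar R}) (I : Type) (r : seq I) (A : I -> set T) :
  (forall i, measurable (A i)) ->
  (mu (\big[setU/set0]_(i <- r) A i) <= \sum_(i <- r) mu (A i))%E.
Proof.
move=> mA; elim: r => [|i r IH]; first by rewrite !big_nil measure0.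
rewrite !big_cons (le_trans (measureU2 _ _ _))// ?leeD2l//.
exact: bigsetU_measurable.
Qed.

Section closed_regularity.
Context {R : realType} {X : pmetricType R} (mu : probability (borel X) R).
Implicit Types (A C : set (borel X)).

Definition closed_regular A := measurable A /\ forall e : R, 0 < e ->
  exists C, [/\ closed (C : set X), C `<=` A & (mu (A `\` C) < e%:E)%E].

Lemma closed_regular_choice (A : nat -> set (borel X)) (e : R) : 0 < e ->
  (forall n, closed_regular (A n)) ->
  exists C : nat -> set (borel X),
    [/\ forall n, closed (C n : set X), forall n, C n `<=` A n &
        (mu (\bigcup_n (A n `\` C n)) < e%:E)%E].
Proof.
move=> e0 rA.
have e2 : 0 < e / 2 by rewrite divr_gt0.
have en n : 0 < (e / 2) / (2 ^ n.+1)%:R.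
  by rewrite divr_gt0// ltr0n expn_gt0.
have /choice[C hC] : forall n, exists C : set (borel X),
    [/\ closed (C : set X), C `<=` A n &
        (mu (A n `\` C) < ((e / 2) / (2 ^ n.+1)%:R)%:E)%E].
  by move=> n; have [_ h] := rA n; exact: h.
have mA n : measurable (A n) by have [] := rA n.
have mC n : measurable (C n) by have [/measurable_closed] := hC n.
exists C; split; [by move=> n; case: (hC n)|by move=> n; case: (hC n)|].
have mD n : measurable (A n `\` C n) by exact: measurableD.
apply: (@le_lt_trans _ _ (\sum_(n <oo) mu (A n `\` C n))%E).
  by apply: measure_sigma_subadditive => //; exact: bigcup_measurable.
apply: (@le_lt_trans _ _ (\sum_(n <oo) ((e / 2) / (2 ^ n.+1)%:R)%:E)%E).
  by apply: lee_nneseries => // n _; have [_ _ /ltW] := hC n.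
apply: (@le_lt_trans _ _ (e / 2)%:E); first exact/epsilon_trick0/ltW.
by rewrite lte_fin; lra.
Qed.

Lemma closed_regular_bigcap (A : nat -> set (borel X)) :
  (forall n, closed_regular (A n)) -> closed_regular (\bigcap_n A n).
Proof.
move=> rA; have mA n : measurable (A n) by have [] := rA n.
split=> [|e e0]; first exact: bigcapT_measurable.
have [C [cC CA Ce]] := closed_regular_choice e0 rA.
have mC n : measurable (C n) by exact: measurable_closed.
exists (\bigcap_n C n); split.
- by apply: closed_bigI => n _; exact: cC.
- by move=> x Cx n _; apply: CA; exact: Cx.
apply: le_lt_trans Ce; apply: le_measure; rewrite ?inE.
- by apply: measurableD; exact: bigcapT_measurable.
- by apply: bigcup_measurable => n _; exact: measurableD.
move=> x [Ax /existsNP[n /not_implyP[_ Cx]]]; exists n => //.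
by split => //; exact: Ax.
Qed.

Lemma closed_regular_bigcup (A : nat -> set (borel X)) :
  (forall n, closed_regular (A n)) -> closed_regular (\bigcup_n A n).
Proof.
move=> rA; have mA n : measurable (A n) by have [] := rA n.
have mUA : measurable (\bigcup_n A n) by exact: bigcup_measurable.
split=> // e e0.
have [C [cC CA Ce]] := closed_regular_choice e0 rA.
have mC n : measurable (C n) by exact: measurable_closed.
pose D N := \bigcup_(n in `I_N) C n.
have cD N : closed (D N : set X).
  by apply: closed_bigcup => // n _; exact: cC.
have mD N : measurable (D N) by exact: measurable_closed.
have mUC : measurable (\bigcup_n C n) by exact: bigcup_measurable.
have cv : mu (\bigcup_n A n `\` D N) @[N --> \oo] -->
    mu (\bigcap_N (\bigcup_n A n `\` D N)).
  apply: nonincreasing_cvg_mu.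
  - rewrite (le_lt_trans (probability_le1 _ _)) ?ltry//; exact: measurableD.
  - by move=> N; exact: measurableD.
  - by apply: bigcapT_measurable => N; exact: measurableD.
  - move=> N M NM; apply/subsetPset => x [Ax Dx]; split => //.
    by apply: contra_not Dx => -[n nN Cx]; exists n => //=; exact: leq_trans NM.
have lt_e : (mu (\bigcap_N (\bigcup_n A n `\` D N)) < e%:E)%E.
  apply: le_lt_trans Ce; apply: le_measure; rewrite ?inE.
  - by apply: bigcapT_measurable => N; exact: measurableD.
  - by apply: bigcup_measurable => n _; exact: measurableD.
  - move=> x h; have [[n _ Ax] _] := h 0%N I; exists n => //; split => //.
    by move=> Cx; have [_] := h n.+1 I; apply; exists n => /=.
have [N hN] : exists N, (mu (\bigcup_n A n `\` D N) < e%:E)%E.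
  apply: contrapT => /forallNP h; move: lt_e; apply/negP; rewrite -leNgt.
  rewrite -(cvg_lim _ cv)//; apply: lime_ge; first exact: cvgP cv.
  by apply: nearW => n; rewrite leNgt; apply/negP; exact: h.
exists (D N); split => //.
by move=> x [n _ Cx]; exists n => //; exact: CA.
Qed.

Lemma closed_regular_closed A : closed (A : set X) -> closed_regular A.
Proof.
move=> cA; split=> [|e e0]; first exact: measurable_closed.
by exists A; split => //; rewrite setDv measure0 lte_fin.
Qed.

Lemma closed_regular_open A : open (A : set X) -> closed_regular A.
Proof.
move=> oA; have -> :
    A = \bigcup_n [set x | forall y, ~ A y -> n.+1%:R^-1 <= mdist x y].
  apply/seteqP; split => x.
    move=> Ax; have /nbhs_ballP[r /= r0 rA] : nbhs x (A : set X).
      exact: open_nbhs_nbhs.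
    have [n nr] := harmonic_lt r0; exists n => // y Ay.
    rewrite leNgt; apply/negP => xyn; apply: Ay; apply: rA.
    by rewrite ballEmdist/= (lt_trans xyn).
  move=> [n _ h]; apply: contrapT => Ax; have := h _ Ax.
  by rewrite mdistxx leNgt invr_gt0 ltr0n.
apply: closed_regular_bigcup => n; apply: closed_regular_closed.
rewrite -[X in closed X]setCK; apply: open_closedC.
apply: open_of_nbhs => x /existsNP[y /not_implyP[Ay /negP]].
rewrite -ltNge => xyn; apply/nbhs_ballP; exists (n.+1%:R^-1 - mdist x y).
  by rewrite /= subr_gt0.
move=> z; rewrite ballEmdist/= => xz /(_ _ Ay); apply/negP; rewrite -ltNge.
apply: le_lt_trans (metric_triangle _ x _) _.
by rewrite metric_sym -ltrBrDr.
Qed.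

(** The sets that are regular together with their complements form a
    sigma-algebra, and it contains the open sets since these are countable
    unions of closed sets. *)
Lemma borel_closed_regular A : measurable A -> closed_regular A.
Proof.
pose G A := closed_regular A /\ closed_regular (~` A).
suff : @measurable _ (borel X) `<=` G by move=> h /h[].
apply: smallest_sub => [|U oU]; last first.
  split; first exact: closed_regular_open.
  by apply: closed_regular_closed; exact: open_closedC.
split.
- by split; apply: closed_regular_closed; rewrite ?setC0;
    [exact: closed0|exact: closedT].
- by move=> B [rB rBC]; rewrite setTD; split => //; rewrite setCK.
- move=> F rF; split.
    by apply: closed_regular_bigcup => n; case: (rF n).
  by rewrite setC_bigcup; apply: closed_regular_bigcap => n; case: (rF n).
Qed.

End closed_regularity.

Section separated_cores.
Context {R : realType} {X : pmetricType R} (mu : probability (borel X) R).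
Context (s : nat) (sym : borel X -> 'I_s).
Hypothesis msym : forall i, measurable (sym @^-1` [set i]).

(** Closed subsets exhaust the cells in measure, and within them the points at
    distance at least 1 / (n + 1) from the other closed subsets exhaust them as
    n grows.  Hence, up to a small measure, the symbol of a point can be read
    off all points close to it, measurably. *)
Lemma separated_cores (eta : R) : 0 < eta ->
  exists (core : set (borel X)) (usym : borel X -> option 'I_s) (e : R),
    [/\ measurable core, fine (mu (~` core)) < eta,
        forall o, measurable (usym @^-1` [set o]), 0 < e &
        forall x z, core x -> mdist x z <= e -> usym z = Some (sym x)].
Proof.
move=> eta0.
have eta2 : 0 < eta / 2 by rewrite divr_gt0.
have s0 : (0 < s)%N := leq_ltn_trans (leq0n _) (ltn_ord (sym point)).
have etas : 0 < eta / 2 / s%:R by rewrite divr_gt0// ltr0n.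
have /choice[C hC] : forall i, exists C : set (borel X),
   [/\ closed (C : set X), C `<=` sym @^-1` [set i] &
       (mu (sym @^-1` [set i] `\` C) < (eta / 2 / s%:R)%:E)%E].
  by move=> i; have [_] := borel_closed_regular mu (msym i); apply.
have mC i : measurable (C i) by have [/measurable_closed] := hC i.
pose G n := [set x : borel X | C (sym x) x /\
  forall b y, b <> sym x -> C b y -> n.+1%:R^-1 <= mdist x y].
have mG n : measurable (G n).
  have -> : G n = \bigcup_(i in [set: 'I_s]) (C i `&`
      (~` \bigcup_(b in [set b | b <> i]) \bigcup_(y in C b) ball y
          n.+1%:R^-1)).
    apply/seteqP; split => x.
      move=> [Cx h]; exists (sym x) => //; split => // -[b bx [y Cy]].
      by rewrite ballEmdist/= metric_sym ltNge (h b).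
    move=> [i _ [Cx h]]; have [_ /(_ _ Cx) xi _] := hC i.
    rewrite /G/= xi; split => // b y bi Cy; rewrite leNgt; apply/negP => xyn.
    apply: h; exists b => //; exists y => //.
    by rewrite ballEmdist/= metric_sym.
  apply: fin_bigcup_measurable => // i _; apply: measurableI => //.
  apply: measurableC.
  apply: measurable_open; apply: bigcup_open => b _; apply: bigcup_open => y _.
  exact: open_metric_ball.
have mUC : measurable (\bigcup_(i in [set: 'I_s]) C i).
  by apply: fin_bigcup_measurable.
have UG : \bigcup_n G n = \bigcup_(i in [set: 'I_s]) C i.
  apply/seteqP; split => x; first by move=> [n _ [Cx _]]; exists (sym x).
  move=> [i _ Cx]; have [_ /(_ _ Cx)/= xi _] := hC i; subst i.
  pose K := \bigcup_(b in [set b | b <> sym x]) C b.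
  have cK : closed (K : set X).
    by apply: closed_bigcup => [|b _]; [exact: finite_finset|have [] := hC b].
  have /nbhs_ballP[r /= r0 rK] : nbhs (x : X) (~` K).
    apply: open_nbhs_nbhs; split; first exact: closed_openC.
    by move=> [b bx Cbx]; have [_ /(_ _ Cbx)/esym] := hC b.
  have [n nr] := harmonic_lt r0; exists n => //; split => // b y bx Cby.
  rewrite leNgt; apply/negP => xyn; apply: (rK y); last by exists b.
  by rewrite ballEmdist/= (lt_trans xyn).
have muUC : fine (mu (~` \bigcup_n G n)) <= eta / 2.
  have -> : ~` (\bigcup_n G n) =
      \big[setU/set0]_(i < s) (sym @^-1` [set i] `\` C i).
    rewrite UG -bigcup_seq; apply/seteqP; split => x.
      move=> h; exists (sym x); rewrite /= ?mem_index_enum//; split => //.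
      by move=> Cx; apply: h; exists (sym x).
    move=> [i _ [/= xi Cx] [j _ Cjx]]; apply: Cx.
    by have [_ /(_ _ Cjx)/= xj _] := hC j; rewrite -xi xj.
  have mD i : measurable (sym @^-1` [set i] `\` C i) by exact: measurableD.
  rewrite -lee_fin fineK; last first.
    by apply: fin_num_measure; exact: bigsetU_measurable.
  apply: (le_trans (measure_bigsetU_le _ _ mD)).
  have -> : (eta / 2)%:E = (\sum_(i < s) (eta / 2 / s%:R)%:E)%E.
    rewrite sumEFin sumr_const card_ord -[_ *+ s]mulr_natr divfK//.
    by rewrite pnatr_eq0 -lt0n.
  by apply: lee_sum => i _; have [_ _ /ltW] := hC i.
have cv : mu (~` G n) @[n --> \oo] --> mu (\bigcap_n ~` G n).
  apply: nonincreasing_cvg_mu.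
  - rewrite (le_lt_trans (probability_le1 _ _)) ?ltry//; exact: measurableC.
  - by move=> n; exact: measurableC.
  - by apply: bigcapT_measurable => n; exact: measurableC.
  - move=> a b ab; apply/subsetPset; apply: subsetC => x [Cx h];
      split => // c y cx Cy.
    by rewrite (le_trans _ (h _ _ cx Cy))// lef_pV2 ?posrE// ler_nat.
have [n hn] : exists n, fine (mu (~` G n)) < eta.
  apply: contrapT => /forallNP h.
  have : (eta%:E <= mu (\bigcap_n ~` G n))%E.
    rewrite -(cvg_lim _ cv)//; apply: lime_ge; first exact: cvgP cv.
    apply: nearW => n; rewrite -[leRHS]fineK ?lee_fin.
      by rewrite leNgt; apply/negP; exact: h.
    by apply: fin_num_measure; exact: measurableC.
  apply/negP; rewrite -ltNge -setC_bigcup -[ltLHS]fineK ?lte_fin.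
    by apply: le_lt_trans muUC _; lra.
  by apply: fin_num_measure; apply: measurableC; exact: bigcup_measurable.
(* Two balls of radius 3 e / 2 that meet have centres at distance less than
   3 e = 1 / (n + 1). *)
pose e : R := n.+1%:R^-1 / 3.
have e0 : 0 < e by rewrite divr_gt0.
pose U i := \bigcup_(x in G n `&` C i) ball (x : X) (e + e / 2).
have U_disj i j z : U i z -> U j z -> i = j.
  move=> [x [[_ Gx] Cx]]; rewrite ballEmdist/= => xz.
  move=> [y [[Cy _] Cjy]]; rewrite ballEmdist/= => yz.
  have [_ /(_ _ Cx)/= xi _] := hC i; have [_ /(_ _ Cjy)/= yj _] := hC j.
  apply: contrapT => ij; have := Gx j y _ Cjy.
  rewrite xi => /(_ (nesym ij)); apply/negP; rewrite -ltNge.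
  apply: le_lt_trans (metric_triangle _ z _) _; rewrite [mdist z y]metric_sym.
  have -> : n.+1%:R^-1 = e * 3 by rewrite /e mulfVK.
  by move: xz yz; lra.
have mU i : measurable (U i : set (borel X)).
  apply: measurable_open; apply: bigcup_open => x _; exact: open_metric_ball.
pose usym z := if pselect (exists i, U i z) is left h
  then Some (projT1 (cid h)) else None.
have usymE i z : U i z -> usym z = Some i.
  move=> Uz; rewrite /usym; case: pselect => [h|]; last by case; exists i.
  by case: cid => j /= Ujz; rewrite (U_disj _ _ _ Uz Ujz).
exists (G n), usym, e; split => //.
  move=> [i|].
    rewrite (_ : _ @^-1` _ = U i)//; apply/seteqP; split => z /=.
      by rewrite /usym; case: pselect => // h [<-]; case: cid.
    exact: usymE.
  rewrite (_ : _ @^-1` _ = ~` \bigcup_(i in [set: 'I_s]) U i).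
    by apply: measurableC; exact: fin_bigcup_measurable.
  apply/seteqP; split => z /=.
    by move=> + [i _ Uz]; rewrite (usymE _ _ Uz).
  move=> h; rewrite /usym; case: pselect => // -[i Uz].
  by exfalso; apply: h; exists i.
move=> x z Gx xz; apply: usymE; exists x; first by split => //; case: Gx.
by rewrite ballEmdist/= (le_lt_trans xz)// ltrDl divr_gt0.
Qed.

End separated_cores.

(** * Coding symbol sequences by Bowen balls *)

Section words_of_symbols.
Context {R : realType} {s : nat}.
Implicit Types (g h : seq 'I_s -> R).

Definition tsum n g : R := \sum_(t : n.-tuple 'I_s) g t.

Lemma tsum0 g : tsum 0 g = g [::].
Proof.
rewrite /tsum (bigD1 [tuple])//= big1 ?addr0// => t /eqP[].
exact: tuple0.
Qed.

Lemma tsumS n g : tsum n.+1 g = \sum_c tsum n (fun a => g (c :: a)).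
Proof.
rewrite /tsum pair_bigA/=.
rewrite (reindex (fun p : 'I_s * n.-tuple 'I_s => [tuple of p.1 :: p.2]))//=.
exists (fun t : n.+1.-tuple 'I_s => (thead t, [tuple of behead t])).
  by move=> [c t] _ /=; congr pair; apply: val_inj.
by move=> t _; rewrite [RHS]tuple_eta; apply: val_inj.
Qed.

Lemma tsum_split k n g h :
  tsum (k + n) (fun a => g (take k a) * h (drop k a)) = tsum k g * tsum n h.
Proof.
elim: k g => [|k IH] g.
  rewrite tsum0 add0n /tsum mulr_sumr; apply: eq_bigr => t _.
  by rewrite take0 drop0.
by rewrite addSn !tsumS mulr_suml; apply: eq_bigr => c _; rewrite -IH.
Qed.

Lemma eq_tsum n g h : (forall a, size a = n -> g a = h a) ->
    tsum n g = tsum n h.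
Proof. by move=> gh; apply: eq_bigr => t _; rewrite gh ?size_tuple. Qed.

Lemma tsum_sum n (I : finType) (g : I -> seq 'I_s -> R) :
  tsum n (fun a => \sum_i g i a) = \sum_i tsum n (g i).
Proof. by rewrite /tsum exchange_big. Qed.

End words_of_symbols.

Section coding.
Context {R : realType} {X : pmetricType R} {m : nat}.
Context (f : 'I_m.+1 -> X -> X) (hf : forall i, continuous (f i)).
Context (mu : probability (borel X) R).
Implicit Types (w : words m) (x : X) (k n : nat) (z : words m * borel X).
Local Notation F := (skew_product f).

Definition orbit_word (A : Type) (g : borel X -> A) w n x : seq A :=
  mkseq (fun i => g (fiber_iter f w i x)) n.

Definition orbit_tuple (A : Type) (g : borel X -> A) w n x : n.-tuple A :=
  Tuple (introT eqP (size_mkseq (fun i => g (fiber_iter f w i x)) n)).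

Lemma take_orbit_word (A : Type) (g : borel X -> A) w k n x :
  take k (orbit_word g w (k + n) x) = orbit_word g w k x.
Proof. by rewrite /orbit_word /mkseq -map_take take_iota
    (minn_idPl (leq_addr n k)). Qed.

Lemma drop_orbit_word (A : Type) (g : borel X -> A) w k n x :
  drop k (orbit_word g w (k + n) x) =
  orbit_word g (shift_word k w) n (fiber_iter f w k x).
Proof.
rewrite /orbit_word /mkseq -map_drop drop_iota addKn add0n -[k in iota k]addn0.
rewrite iotaDl -map_comp; apply: eq_map => i /=.
by rewrite fiber_iterD.
Qed.

Lemma measurable_orbit_tuple (A : finType) (g : borel X -> A) w n
    (t : n.-tuple A) : (forall a, measurable (g @^-1` [set a])) ->
  measurable (orbit_tuple g w n @^-1` [set t] : set (borel X)).
Proof.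
move=> mg; have -> : orbit_tuple g w n @^-1` [set t] =
    \bigcap_(i in [set: 'I_n])
      ((fun x => g (fiber_iter f w i x)) @^-1` [set tnth t i]) :> set (borel X).
  apply/seteqP; split => x /=.
    move=> <- i _ /=; rewrite (tnth_nth (g point)) /=.
    by rewrite nth_mkseq.
  move=> h; apply: eq_from_tnth => i; rewrite -(h i I) (tnth_nth (g point))/=.
  by rewrite nth_mkseq.
apply: fin_bigcap_measurable => // i _; exact: (measurable_label_iter hf mg).
Qed.

Context (s : nat) (sym : borel X -> 'I_s) (usym : borel X -> option 'I_s).
Hypothesis musym : forall o, measurable (usym @^-1` [set o]).
Context (core : set (borel X)) (e : R).
Hypothesis e_gt0 : 0 < e.
Hypothesis coreP : forall x y : X,
  core x -> mdist x y <= e -> usym y = Some (sym x).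
Context (t r : R) (L : nat).
Hypothesis t01 : 0 < t < 1.
Hypothesis r01 : 0 < r < 1.
Hypothesis rL : r ^+ L <= (1 - r) / 2.

Let s_gt0 : (0 < s)%N := leq_ltn_trans (leq0n _) (ltn_ord (sym point)).
Let a0 : 'I_s := sym point.

(** The law of the symbol announced by a label: almost always the label itself,
    but with every symbol keeping some weight. *)
Definition announce (a : 'I_s) (o : option 'I_s) : R :=
  (1 - t) * (o == Some a)%:R + t / s%:R.

Lemma announce_gt0 a o : 0 < announce a o.
Proof.
have /andP[t0 t1] := t01; rewrite ltr_wpDl//.
  by rewrite mulr_ge0// subr_ge0 ltW.
by rewrite divr_gt0// ltr0n.
Qed.

Lemma sum_announce o : \sum_a announce a o <= 1.
Proof.
have /andP[t0 t1] := t01.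
rewrite /announce big_split/= sumr_const card_ord -[_ *+ s]mulr_natr.
rewrite divfK ?pnatr_eq0 -?lt0n// -mulr_sumr.
have : \sum_(a < s) ((o == Some a)%:R : R) <= 1.
  case: o => [a|]; last by rewrite big1.
  rewrite (bigD1 a)//= eqxx big1 ?addr0// => b /negbTE ba.
  by rewrite (inj_eq (@Some_inj _)) eq_sym ba.
by nra.
Qed.

(** The law of the first k symbols of a mu-random point of the fibre of w,
    blurred by announce: a big Bowen ball gives weight to the itineraries of
    all the points in it. *)
Definition block_weight w k (a : seq 'I_s) : R :=
  \sum_(u : k.-tuple (option 'I_s))
    fine (mu (orbit_tuple usym w k @^-1` [set u])) *
    \prod_(i < k) announce (nth a0 a i) (nth None u i).

Lemma tsum_announce k (v : nat -> option 'I_s) :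
  tsum k (fun a => \prod_(i < k) announce (nth a0 a i) (v i)) <= 1.
Proof.
elim: k v => [|k IH] v; first by rewrite tsum0 big_ord0.
rewrite tsumS; apply: le_trans (sum_announce (v 0%N)).
apply: ler_sum => c _.
rewrite (eq_tsum (h := fun a => announce c (v 0%N) *
    \prod_(i < k) announce (nth a0 a i) (v i.+1))); last first.
  by move=> a _; rewrite big_ord_recl.
rewrite /tsum -mulr_sumr ler_piMr//; first exact/ltW/announce_gt0.
exact: (IH (fun i => v i.+1)).
Qed.

Lemma tsum_block_weight w k : tsum k (block_weight w k) <= 1.
Proof.
have <- := @sum_fibers _ _ _ mu _ (orbit_tuple usym w k)
  (fun u => @measurable_orbit_tuple _ usym w k u musym).
rewrite tsum_sum.
apply: ler_sum => u _; rewrite /tsum -mulr_sumr ler_piMr ?fine_ge0//.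
exact: tsum_announce.
Qed.

Lemma block_weight_ge0 w k a : 0 <= block_weight w k a.
Proof.
apply: sumr_ge0 => u _; rewrite mulr_ge0 ?fine_ge0//.
by apply: prodr_ge0 => i _; exact/ltW/announce_gt0.
Qed.

(** Along k steps each point of the ball announces the symbols of x, except at
    the times when the orbit of x is outside the core; each step costs a
    factor 1 - t, and each exceptional one a further factor t / s. *)
Lemma block_weight_ge w k x :
  fine (mu (bowen_ball f w k x e)) *
    ((1 - t) ^+ k * (t / s%:R) ^+ visits F [set z | ~ core z.2] k (w, x)) <=
  block_weight w k (orbit_word sym w k x).
Proof.
have /andP[t0 t1] := t01.
have ts0 : 0 < t / s%:R by rewrite divr_gt0// ltr0n.
set rho := (X in _ * X).
have rho0 : 0 <= rho.
  by rewrite mulr_ge0// exprn_ge0// ?subr_ge0 ltW.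
pose c (u : k.-tuple (option 'I_s)) :=
  \prod_(i < k) announce (nth a0 (orbit_word sym w k x) i) (nth None u i).
have c0 u : 0 <= c u by apply: prodr_ge0 => i _; exact/ltW/announce_gt0.
have mB := measurable_bowen_ball hf w k x e.
have mO := fun u => @measurable_orbit_tuple _ usym w k u musym.
rewrite -lee_fin EFinM fineK; last exact: fin_num_measure.
apply: (@le_trans _ _ (\int[mu]_y (c (orbit_tuple usym w k y))%:E)%E);
    last first.
  rewrite (integral_finite mu mO (c := fun u => (c u)%:E)).
    rewrite /block_weight -sumEFin; apply: lee_sum => u _.
    by rewrite EFinM fineK ?fin_num_measure// muleC.
  by move=> u; rewrite lee_fin.
rewrite muleC.
have -> : (mu (bowen_ball f w k x e) =
    \int[mu]_y (\1_(bowen_ball f w k x e : set (borel X)) y)%:E)%E.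
  by rewrite integral_indic// setIT.
rewrite -ge0_integralZl//; last first.
  by apply/measurable_EFinP; exact: measurable_indic.
apply: ge0_le_integral => //.
- by move=> y _; rewrite mule_ge0// lee_fin.
- apply: emeasurable_funM => //.
  by apply/measurable_EFinP; exact: measurable_indic.
- exact: (measurable_fun_finite mO (fun u => (c u)%:E)).
move=> y _; rewrite -EFinM lee_fin indicE.
have [/set_mem By|_] := boolP (y \in _); last by rewrite mulr0.
rewrite mulr1 /rho /visits -prodrXr.
have -> : (1 - t) ^+ k = \prod_(i < k) (1 - t) by rewrite prodr_const card_ord.
rewrite -big_split/=; apply: ler_prod => i _; apply/andP; split.
  by rewrite mulr_ge0// ?exprn_ge0 ?subr_ge0// ltW.
rewrite !nth_mkseq// iter_skew_product /announce/=.
have [cx|cx] := pselect (core (fiber_iter f w i x)).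
  rewrite (coreP cx) ?eqxx; last first.
    by move/(bowen_ballP f _ _ _ _ (ltW e_gt0)): By; exact.
  rewrite memNset; last by move=> /=; exact.
  by rewrite expr0 !mulr1 lerDl ltW.
rewrite mem_set// expr1 ler_wpDl//; first by rewrite mulr_ge0// subr_ge0 ltW.
by rewrite ler_piMl ?(ltW ts0)// gerBl ltW.
Qed.

(** A sub-probability on words of symbols: read either one symbol, or a block of
    k >= L symbols at the geometric price r ^ k.  Any fuel at least the length
    of the word gives the same value. *)
Fixpoint code fuel w (a : seq 'I_s) : R :=
  if fuel is n.+1 then
    if a is _ :: a' then
      (2 * s%:R)^-1 * code n (shift_word 1 w) a' +
      \sum_(k < size a) (if (L <= k.+1)%N then
         r ^+ k.+1 * (block_weight w k.+1 (take k.+1 a) *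
                      code n (shift_word k.+1 w) (drop k.+1 a)) else 0)
    else 1
  else 1.

Lemma code_fuel n n' w a : (size a <= n)%N -> (size a <= n')%N ->
  code n w a = code n' w a.
Proof.
elim: n n' w a => [|n IH] [|n'] w [|c a]//=; rewrite !ltnS => an an'.
rewrite (IH n')//; congr (_ + _); apply: eq_bigr => k _.
by rewrite (IH n')//= size_drop leq_subLR (leq_trans _ (leq_addl _ _)).
Qed.

Lemma code_gt0 n w a : 0 < code n w a.
Proof.
have /andP[r0 r1] := r01.
elim: n w a => [|n IH] w [|c a]//=.
apply: ltr_pwDl.
  by rewrite mulr_gt0// invr_gt0 mulr_gt0// ltr0n.
apply: sumr_ge0 => k _; case: ifP => // _.
by rewrite !mulr_ge0 ?exprn_ge0 ?block_weight_ge0// ltW.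
Qed.

Lemma sum_geometric n :
    \sum_(k < n) (if (L <= k.+1)%N then r ^+ k.+1 else 0) <= 2^-1.
Proof.
have /andP[r0 r1] := r01.
suff h : (1 - r) * \sum_(k < n) (if (L <= k.+1)%N then r ^+ k.+1 else 0) <=
    r ^+ L - (if (L <= n)%N then r ^+ n.+1 else r ^+ L).
  have : 0 <= (if (L <= n)%N then r ^+ n.+1 else r ^+ L).
    by case: ifP => _; rewrite exprn_ge0// ltW.
  move: h rL; set S := \sum_(_ < _) _; move: (r ^+ L) (if _ then _ else _).
  by move=> x y; nra.
elim: n => [|n IH].
  rewrite big_ord0 mulr0; case: ifP; last by rewrite subrr.
  rewrite leqn0 => /eqP ->; rewrite expr1 expr0 subr_ge0.
  exact: ltW.
rewrite big_ord_recr/= mulrDr; apply: (le_trans (lerD IH (lexx _))).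
rewrite -[(L <= n)%N]ltnS [r ^+ n.+2]exprS.
by case: (ltngtP L n.+1) => [Ln|Ln|->]; move: (r ^+ n.+1) (r ^+ L) => x y; lra.
Qed.

(** By induction on the length: reading a single symbol takes half of the mass,
    and the blocks take at most the other half because their prices sum up to at
    most 1 / 2. *)
Lemma tsum_code n w : tsum n (code n w) <= 1.
Proof.
have /andP[r0 r1] := r01.
elim/ltn_ind: n w => -[|n] IH w; first by rewrite tsum0.
rewrite (eq_tsum (h := fun a =>
    (2 * s%:R)^-1 * code n (shift_word 1 w) (drop 1 a) +
   \sum_(k < n.+1) (if (L <= k.+1)%N then
         r ^+ k.+1 * (block_weight w k.+1 (take k.+1 a) *
           code (n - k)%N (shift_word k.+1 w) (drop k.+1 a)) else 0)));
               last first.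
  move=> [|c a]//= [an]; rewrite drop0 an; congr (_ + _).
  apply: eq_bigr => k _; rewrite (@code_fuel n (n - k)%N)// size_drop an
      ?leq_subr//.
rewrite /tsum big_split/= -mulr_sumr.
have h1 : tsum n.+1 (fun a => code n (shift_word 1 w) (drop 1 a)) <= s%:R.
  rewrite tsumS -[leRHS]mulr1 mulr_natl -[in leRHS](card_ord s) -sumr_const.
  apply: ler_sum => c _; rewrite /tsum; under eq_bigr do rewrite /= drop0.
  exact: IH.
have h2 : tsum n.+1 (fun a => \sum_(k < n.+1) (if (L <= k.+1)%N then
         r ^+ k.+1 * (block_weight w k.+1 (take k.+1 a) *
           code (n - k)%N (shift_word k.+1 w) (drop k.+1 a)) else 0)) <= 2^-1.
  rewrite tsum_sum; apply: le_trans (sum_geometric n.+1).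
  apply: ler_sum => k _; case: ifP => _;
      last by rewrite /tsum sumr_const mul0rn.
  rewrite /tsum -mulr_sumr ler_piMr ?exprn_ge0 ?(ltW r0)//.
  have nE : n.+1 = (k.+1 + (n - k))%N by rewrite addSn subnKC// -ltnS.
  rewrite -/(tsum n.+1 (fun a => block_weight w k.+1 (take k.+1 a) *
    code (n - k)%N (shift_word k.+1 w) (drop k.+1 a))).
  rewrite {1}nE tsum_split.
  rewrite mulr_ile1 ?tsum_block_weight ?IH//.
  - by apply: sumr_ge0 => u _; exact: block_weight_ge0.
  - by apply: sumr_ge0 => u _; exact/ltW/code_gt0.
  - by rewrite ltnS leq_subr.
apply: (@le_trans _ _ ((2 * s%:R)^-1 * s%:R + 2^-1)).
  by apply: lerD => //; rewrite ler_wpM2l// invr_ge0 mulr_ge0.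
by rewrite invfM -mulrA mulVf ?pnatr_eq0 -?lt0n// mulr1; lra.
Qed.

Definition code_length n z : R :=
  - ln (code n z.1 (orbit_word sym z.1 n z.2)).

Lemma code_length0 z : code_length 0 z = 0.
Proof. by rewrite /code_length/= ln1 oppr0. Qed.

Lemma code_lengthS n z :
  code_length n.+1 z <= ln (2 * s%:R) + code_length n (F z).
Proof.
have /andP[r0 r1] := r01.
have s2 : 0 < 2 * s%:R :> R by rewrite mulr_gt0// ltr0n.
case: z => w x; rewrite /code_length.
have -> : orbit_word sym w n.+1 x =
    sym x :: orbit_word sym (shift_word 1 w) n (fiber_iter f w 1 x).
  rewrite -(drop_orbit_word sym w 1 n) add1n -[LHS](cat_take_drop 1).
  by rewrite -(add1n n) take_orbit_word.
rewrite -[X in X + _]opprK -opprD lerN2 -lnV ?posrE//.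
rewrite -lnM ?posrE ?invr_gt0 ?code_gt0//.
rewrite ler_ln ?posrE ?code_gt0 ?mulr_gt0 ?invr_gt0 ?code_gt0//.
rewrite [code n.+1 _ _]/= lerDl; apply: sumr_ge0 => k _; case: ifP => // _.
by rewrite !mulr_ge0 ?exprn_ge0 ?block_weight_ge0 ?(ltW r0)// ltW ?code_gt0.
Qed.

(** Among the ways of reading the word, keep only the one that starts with a
    block of length k. *)
Lemma code_length_block k n (c : R) z : (0 < k)%N -> (L <= k)%N ->
  ((expR (- (c * k%:R)))%:E <= mu (bowen_ball f z.1 k z.2 e))%E ->
  code_length (k + n) z <=
    (c - ln r - ln (1 - t)) * k%:R +
    - ln (t / s%:R) * (visits F [set z | ~ core z.2] k z)%:R +
    code_length n (iter k F z).
Proof.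
have /andP[r0 r1] := r01; have /andP[t0 t1] := t01.
have t1' : 0 < 1 - t by rewrite subr_gt0.
have ts0 : 0 < t / s%:R by rewrite divr_gt0// ltr0n.
case: z => w x; case: k => // k _ Lk.
rewrite iter_skew_product; set V := visits _ _ _ _.
rewrite /code_length -[(w, x).1]/w -[(w, x).2]/x
    -[(_, _).1]/(shift_word k.+1 w).
rewrite -[(_, _).2]/(fiber_iter f w k.+1 x) => muB.
have B0 : 0 < expR (- (c * k.+1%:R)) by exact: expR_gt0.
have C0 := @code_gt0 n (shift_word k.+1 w)
  (orbit_word sym (shift_word k.+1 w) n (fiber_iter f w k.+1 x)).
set C := code n _ _ in C0 *.
have low : r ^+ k.+1 * (expR (- (c * k.+1%:R)) * ((1 - t) ^+ k.+1 *
    (t / s%:R) ^+ V) * C) <= code (k.+1 + n) w (orbit_word sym w (k.+1 + n) x).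
  have sz : size (orbit_word sym w (k.+1 + n) x) = (k.+1 + n)%N.
    by rewrite size_mkseq.
  have codeE (a : seq 'I_s) : size a = (k.+1 + n)%N -> code (k.+1 + n) w a =
      (2 * s%:R)^-1 * code (k + n) (shift_word 1 w) (behead a) +
      \sum_(j < k.+1 + n) (if (L <= j.+1)%N then
         r ^+ j.+1 * (block_weight w j.+1 (take j.+1 a) *
           code (k + n) (shift_word j.+1 w) (drop j.+1 a)) else 0).
    by case: a => [|b a]//= [->].
  move: sz (take_orbit_word sym w k.+1 n x) (drop_orbit_word sym w k.+1 n x).
  move: (orbit_word sym w (k.+1 + n) x) => a sz tka dka; rewrite (codeE _ sz).
  have kn : (k < k.+1 + n)%N by rewrite ltnS leq_addr.
  rewrite (bigD1 (Ordinal kn))//= Lk tka dka.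
  rewrite (@code_fuel (k + n)%N n (shift_word k.+1 w) (orbit_word _ _ _ _));
    rewrite ?size_mkseq ?leq_addl// -/C.
  rewrite addrCA -[leLHS]addr0; apply: lerD.
    rewrite ler_wpM2l ?exprn_ge0 ?(ltW r0)// ler_wpM2r ?(ltW C0)//.
    apply: le_trans (block_weight_ge w k.+1 x).
    rewrite ler_wpM2r//; first by rewrite mulr_ge0// exprn_ge0// ltW.
    by rewrite -lee_fin fineK// fin_num_measure//; exact: measurable_bowen_ball.
  rewrite addr_ge0//.
    by rewrite mulr_ge0 ?invr_ge0 ?mulr_ge0// ltW ?code_gt0.
  apply: sumr_ge0 => j _; case: ifP => // _.
  by rewrite !mulr_ge0 ?exprn_ge0 ?block_weight_ge0 ?(ltW r0)// ltW ?code_gt0.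
have h0 : 0 < expR (- (c * k.+1%:R)) * ((1 - t) ^+ k.+1 * (t / s%:R) ^+ V).
  by rewrite !mulr_gt0// exprn_gt0.
rewrite lerNl; apply: (@le_trans _ _ (ln (r ^+ k.+1 * (expR (- (c * k.+1%:R)) *
    ((1 - t) ^+ k.+1 * (t / s%:R) ^+ V) * C)))); last first.
  by rewrite ler_ln ?posrE ?code_gt0// !mulr_gt0// exprn_gt0.
have lnX (y : R) j : 0 < y -> ln (y ^+ j) = ln y * j%:R.
  by move=> y0; rewrite lnXn// mulr_natr.
move: {h0 low} ts0; move: (t / s%:R) => q q0.
rewrite !lnM ?posrE ?mulr_gt0 ?exprn_gt0 ?expR_gt0// !lnX// expRK; lra.
Qed.

End coding.

(** * Entropy is at most the rate of heavy balls *)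

Section entropy_from_balls.
Context {R : realType} {X : pmetricType R} {m : nat}.
Context (f : 'I_m.+1 -> X -> X) (hf : forall i, continuous (f i)).
Context (P : probability (words m) R) (mu : probability (borel X) R).
Hypothesis invF : measure_invariant (P \x mu)%E (skew_product f).
Context (s : nat) (sym : borel X -> 'I_s).
Hypothesis msym : forall i, measurable (sym @^-1` [set i]).
Implicit Types (w : words m) (x : X) (k n K L : nat) (z : words m * borel X).
Local Notation F := (skew_product f).
Local Notation nu := (P \x mu)%E.
Local Notation xi := (fun i => sym @^-1` [set i]).

Definition heavy_ball (c e : R) k : set (words m * borel X) :=
  [set z | ((expR (- (c * k%:R)))%:E <= mu (bowen_ball f z.1 k z.2 e))%E].

Lemma measurable_heavy_ball c e k : measurable (heavy_ball c e k).
Proof.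
rewrite -[X in measurable X]setTI; apply: emeasurable_fun_c_infty => //.
exact: measurable_measure_bowen_ball.
Qed.

(** The first n symbols cost at most the length of their code, and the greedy
    tiling bounds the average length of the code. *)
Lemma information_le_tiling (usym : borel X -> option 'I_s)
    (core : set (borel X)) (e t r c : R) L K n :
  (forall o, measurable (usym @^-1` [set o])) -> 0 < e -> measurable core ->
  (forall x y : X, core x -> mdist x y <= e -> usym y = Some (sym x)) ->
  0 < t < 1 -> 0 < r < 1 -> r ^+ L <= (1 - r) / 2 -> (0 < L)%N -> 0 <= c ->
  (\int[nu]_z information f mu sym n z <=
   ((c - ln r - ln (1 - t)
     + - ln (t / s%:R) * fine (mu (~` core))
     + ln (2 * s%:R) *
         fine (nu (~` \bigcup_(k in [set k | (L <= k <= K)%N])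
             heavy_ball c e k)))
     * n%:R + ln (2 * s%:R) * K%:R)%:E)%E.
Proof.
move=> musym e0 mcore coreP t01 r01 rL L0 c0.
have /andP[r0 r1] := r01; have /andP[t0 t1] := t01.
have s_gt0 : (0 < s)%N := leq_ltn_trans (leq0n _) (ltn_ord (sym point)).
have s1 : 1 <= s%:R :> R by rewrite ler1n.
have lnr : 0 <= - ln r by rewrite oppr_ge0 ln_le0// ltW.
have lnt : 0 <= - ln (1 - t) by rewrite oppr_ge0 ln_le0// gerBl ltW.
have lnts : 0 <= - ln (t / s%:R).
  rewrite oppr_ge0 ln_le0// ler_pdivrMr ?ltr0n// mul1r.
  by rewrite (le_trans (ltW t1)).
have ln2s : 0 <= ln (2 * s%:R : R) by apply: ln_ge0; lra.
set G := \bigcup_(k in _) _.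
have mG : measurable G.
  by apply: bigcup_measurable => k _; exact: measurable_heavy_ball.
pose E1 : set (words m * borel X) := [set z | ~ core z.2].
have E1E : E1 = setT `*` ~` core by apply/seteqP; split => z; [|case].
have mE1 : measurable E1.
  by rewrite E1E; apply: measurableX => //; exact: measurableC.
have nuE1 : nu E1 = mu (~` core).
  rewrite E1E product_measure1E//; last exact: measurableC.
  by rewrite [X in (X * _)%E](@probability_setT _ _ _ P) mul1e.
have mF := measurable_skew_product hf.
have tile := @tiling_bound _ F R E1 (~` G) (c - ln r - ln (1 - t))
  (- ln (t / s%:R)) (ln (2 * s%:R)) K
  (code_length f mu sym usym t r L).
have {}tile n0 z : code_length f mu sym usym t r L n0 z <=
    (c - ln r - ln (1 - t)) * n0%:R + - ln (t / s%:R) * (visits F E1 n0 z)%:R +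
    ln (2 * s%:R) * (visits F (~` G) n0 z)%:R + ln (2 * s%:R) * K%:R.
  apply: tile => //.
  - by rewrite !addr_ge0.
  - by move=> z'; rewrite code_length0.
  - by move=> n' z'; apply: code_lengthS.
  - move=> z' /contrapT[k /= /andP[Lk kK] hk]; exists k.
    rewrite kK (leq_trans L0 Lk); split=> // n'.
    by apply: (code_length_block hf musym e0) => //; exact: leq_trans Lk.
rewrite -nuE1 -(integral_tiling_bound mF invF)//; last 3 first.
- exact: measurableC.
- by rewrite !addr_ge0.
- by rewrite mulr_ge0.
have mb : measurable_fun [set: words m * borel X] (fun z =>
    ((c - ln r - ln (1 - t)) * n%:R + - ln (t / s%:R) * (visits F E1 n z)%:R +
    ln (2 * s%:R) * (visits F (~` G) n z)%:R + ln (2 * s%:R) * K%:R)%:E).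
  apply/measurable_EFinP; do !apply: measurable_funD => //;
    apply: measurable_funM => //; apply: measurable_visits => //.
  exact: measurableC.
have b0 z : (0 <= ((c - ln r - ln (1 - t)) * n%:R +
    - ln (t / s%:R) * (visits F E1 n z)%:R +
    ln (2 * s%:R) * (visits F (~` G) n z)%:R + ln (2 * s%:R) * K%:R)%:E)%E.
  by rewrite lee_fin !addr_ge0// mulr_ge0// !addr_ge0.
rewrite fubini_tonelli1//; last 2 first.
- exact: measurable_information.
- exact: information_ge0.
rewrite [leRHS]fubini_tonelli1//.
apply: ge0_le_integral => //.
- by move=> w _; apply: integral_ge0 => x _; exact: information_ge0.
- apply: measurable_fun_fubini_tonelli_F; first exact: measurable_information.
  exact: information_ge0.
- exact: measurable_fun_fubini_tonelli_F.
move=> w _; rewrite /fubini_F.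
have mO := fun a => @measurable_orbit_tuple _ _ _ f hf _ sym w n a msym.
apply: le_trans (@information_gibbs _ _ _ f mu s sym _
  (orbit_tuple f sym w n) w n
  (fun a => code f mu sym usym t r L n w (tval a)) mO _ _ _) _.
- move=> x; apply/seteqP; split => y /=.
    move=> /(congr1 val)/= h i i_n.
    by have := congr1 (fun a => nth (sym point) a i) h; rewrite !nth_mkseq.
  by move=> h; apply: val_inj; apply/eq_in_map => i; rewrite mem_iota => /h.
- by move=> a; apply/ltW/code_gt0.
- exact: (tsum_code hf mu sym musym t01 r01 rL).
apply: ge0_le_integral => //.
- move=> x _; rewrite oppe_ge0 lne_le0 lee_fin.
  apply: le_trans (tsum_code hf mu sym musym t01 r01 rL n w).
  rewrite /tsum (bigD1 (orbit_tuple f sym w n x))//= lerDl.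
  by apply: sumr_ge0 => a _; exact/ltW/code_gt0.
- exact: (measurable_fun_finite mO
    (fun a => - lne (code f mu sym usym t r L n w (tval a))%:E)%E).
- exact: measurableT_comp mb (pair1_measurable w).
move=> x _; rewrite lne_EFin; last exact: code_gt0.
by rewrite -EFinN lee_fin; exact: (tile n (w, x)).
Qed.

(** The rate in information_le_tiling exceeds c by terms that are made small one
    after another: the prices r and t first, which determine the least length L
    and the costs of an exceptional step; then the core, which determines the
    scale e; and K last, so that the points without a heavy ball of length
    between L and K have small measure. *)
Theorem partition_entropy_le (c : R) : 0 <= c ->
  (forall (e c' : R) L, 0 < e -> c < c' ->
     {ae nu, forall z, exists k, (L <= k)%N /\ heavy_ball c' e k z}) ->
  (partition_entropy f P mu xi <= c%:E)%E.
Proof.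
move=> c0 heavy; apply/lee_addgt0Pr => d d0.
have s_gt0 : (0 < s)%N := leq_ltn_trans (leq0n _) (ltn_ord (sym point)).
(* Six terms share d: the rate c' - c, the prices - ln r and - ln (1 - t), the
   steps outside the core, the steps without a heavy ball, and M K / n. *)
pose dl := d / 6; have dl0 : 0 < dl by rewrite divr_gt0.
pose r := expR (- dl).
have r01 : 0 < r < 1 by rewrite expR_gt0/= expR_lt1 oppr_lt0.
have /andP[r0 r1] := r01.
pose t := 1 - r.
have t01 : 0 < t < 1 by rewrite subr_gt0 r1/= gtrBl r0.
have [L [L0 rL]] : exists L, (0 < L)%N /\ r ^+ L <= (1 - r) / 2.
  have r2 : 0 < (1 - r) / 2 by rewrite divr_gt0// subr_gt0.
  exists (Num.truncn (- ln ((1 - r) / 2) / dl)).+1; split => //.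
  rewrite -[leRHS](lnK r2) -expRM_natr ler_expR mulNr lerNl.
  by rewrite [leRHS]mulrC -ler_pdivrMr// ltW// truncnS_gt.
pose l := - ln (t / s%:R); pose M := ln (2 * s%:R : R).
have l0 : 0 <= l.
  have /andP[t0 t1] := t01.
  rewrite oppr_ge0 ln_le0// ler_pdivrMr ?ltr0n// mul1r.
  by rewrite (le_trans (ltW t1))// ler1n.
have M0 : 0 <= M.
  rewrite ln_ge0// -[leLHS]mulr1 ler_pM// ?ler1n//.
have l1 : 0 < l + 1 by rewrite ltr_wpDl.
have M1 : 0 < M + 1 by rewrite ltr_wpDl.
have [core [usym [e [mcore coremu musym e0 coreP]]]] :=
  separated_cores mu msym (divr_gt0 dl0 l1).
have cdl : c < c + dl by rewrite ltrDl.
pose G K := \bigcup_(k in [set k | (L <= k <= K)%N]) heavy_ball (c + dl) e k.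
have [K GK] : exists K, fine (nu (~` G K)) < dl / (M + 1).
  apply: exhaustion.
  - by move=> K; apply: bigcup_measurable => k _; exact: measurable_heavy_ball.
  - move=> K K' KK z [k /= /andP[Lk kK] hk]; exists k => //=.
    by rewrite Lk (leq_trans kK).
  - apply: filterS (heavy e (c + dl) L e0 cdl) => z [k [Lk hk]].
    by exists k, k => //=; rewrite Lk leqnn.
  - exact: divr_gt0.
have bound n : (\int[nu]_z information f mu sym n z <=
    ((c + 5 * dl) * n%:R + M * K%:R)%:E)%E.
  have c1 : 0 <= c + dl by rewrite addr_ge0// ltW.
  apply: le_trans (information_le_tiling K n musym e0 mcore coreP t01 r01
      rL L0 c1) _.
  rewrite lee_fin lerD2r ler_wpM2r// -/(G K) -/l -/M /t subKr /r expRK.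
  have : l * fine (mu (~` core)) <= dl.
    apply: (@le_trans _ _ ((l + 1) * (dl / (l + 1)))).
      by rewrite ler_pM ?fine_ge0 ?lerDl// ltW.
    by rewrite mulrC divfK// gt_eqF.
  have : M * fine (nu (~` G K)) <= dl.
    apply: (@le_trans _ _ ((M + 1) * (dl / (M + 1)))).
      by rewrite ler_pM ?fine_ge0 ?lerDl// ltW.
    by rewrite mulrC divfK// gt_eqF.
  lra.
have cvP := cvg_partition_entropy hf invF msym.
rewrite -(cvg_lim _ cvP)//; apply: lime_le; first exact: cvgP cvP.
near=> n.
have n0 : 0 < n%:R :> R by rewrite ltr0n; near: n; exists 1%N.
apply: (@le_trans _ _ ((n%:R^-1)%:E * ((c + 5 * dl) * n%:R + M * K%:R)%:E)%E).
  by rewrite lee_wpmul2l// lee_fin invr_ge0 ltW.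
rewrite -EFinM -EFinD lee_fin mulrC ler_pdivrMr//.
have : M * K%:R / dl <= n%:R.
  near: n; exists (Num.truncn (M * K%:R / dl)).+1 => // n /= nn.
  by apply/ltW/(lt_le_trans (truncnS_gt _)); rewrite ler_nat.
rewrite ler_pdivrMr//.
have -> : d = 6 * dl by rewrite /dl mulrC divfK.
by move: (M * K%:R) => y; lra.
Unshelve. all: by end_near. Qed.

End entropy_from_balls.

(** * Local entropy is almost surely at least the metric entropy *)

Section exponential_rates.
Context {R : realType}.

Lemma oppr_mule (a : R) (y : \bar R) :
  ((- a)%:E * y = a%:E * (- y))%E.
Proof. by rewrite EFinN mulNe muleN. Qed.

Lemma rate_geP (a : R) (y : \bar R) k : (0 < k)%N -> (0 <= y)%E ->
  (a%:E <= (- k%:R^-1)%:E * lne y)%E <-> (y <= (expR (- (a * k%:R)))%:E)%E.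
Proof.
move=> k0 y0; have k0' : 0 < k%:R :> R by rewrite ltr0n.
rewrite oppr_mule lee_pdivlMl// leeNr -EFinM -EFinN.
rewrite -(lee_expeR (lne y)) lneK ?in_itv/= ?y0 ?leey// mulrC.
by [].
Qed.

Lemma lte_EFin_slack (c : R) (y : \bar R) : (c%:E < y)%E ->
  exists n, forall j, (n <= j)%N -> ((c + j.+1%:R^-1)%:E < y)%E.
Proof.
case: y => [y| |]//; last by move=> _; exists 0%N => j _; rewrite ltry.
rewrite lte_fin -subr_gt0 => /harmonic_lt[n ncy]; exists n => j nj.
rewrite lte_fin -ltrBrDl (le_lt_trans _ ncy)//.
by rewrite lef_pV2 ?posrE// ler_nat.
Qed.

End exponential_rates.

Section local_entropy.
Context {R : realType} {X : pmetricType R} {m : nat}.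
Context (f : 'I_m.+1 -> X -> X) (hf : forall i, continuous (f i)).
Context (P : probability (words m) R) (mu : probability (borel X) R).
Implicit Types (w : words m) (x : X) (k n K L j : nat) (z : words m * borel X).
Local Notation F := (skew_product f).
Local Notation nu := (P \x mu)%E.

Lemma le_measure_bowen_ball w k x (e e' : R) : e <= e' ->
  (mu (bowen_ball f w k x e) <= mu (bowen_ball f w k x e'))%E.
Proof.
move=> ee; apply: le_measure; rewrite ?inE; try exact: measurable_bowen_ball.
exact: bowen_ball_le.
Qed.

Lemma le_lne_measure (A B : set (borel X)) (k : nat) :
  (mu A <= mu B)%E ->
  ((- k%:R^-1)%:E * lne (mu B) <= (- k%:R^-1)%:E * lne (mu A))%E.
Proof.
move=> AB; rewrite !oppr_mule lee_wpmul2l// ?lee_fin// leeN2.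
by rewrite lee_lne// in_itv/= leey andbT.
Qed.

Lemma local_entropy_sup w x : local_entropy f mu w x =
  ereal_sup (range (fun n => limn_einf (fun k =>
    (- k%:R^-1)%:E * lne (mu (bowen_ball f w k x n.+1%:R^-1)))%E)).
Proof.
rewrite /local_entropy lim_at0_nonincreasing// => a b /andP[a0 ab].
apply: (@le_limn_einf _ _ _ 0%N) => k _; apply: le_lne_measure.
exact: le_measure_bowen_ball.
Qed.

Lemma local_entropy_gtP (c : R) w x : (c%:E < local_entropy f mu w x)%E <->
  exists j K, forall k, (K <= k)%N ->
    (mu (bowen_ball f w k x j.+1%:R^-1) <=
     (expR (- ((c + j.+1%:R^-1) * k%:R)))%:E)%E.
Proof.
rewrite local_entropy_sup; split.
  move=> /ereal_sup_gt[_ [n _ <-]] /lte_EFin_slack[n' h].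
  pose j := maxn n n'; exists j.
  have := h j (leq_maxr _ _) => /limn_einf_gt[K hK].
  exists (maxn K 1) => k; rewrite geq_max => /andP[Kk k0].
  apply/rate_geP => //; apply: le_trans (ltW (hK _ Kk)) _.
  apply: le_lne_measure; apply: le_measure_bowen_ball.
  by rewrite lef_pV2 ?posrE// ler_nat ltnS leq_maxl.
move=> [j [K h]]; apply: (@lt_le_trans _ _ (c + j.+1%:R^-1)%:E).
  by rewrite lte_fin ltrDl.
apply: ereal_sup_ge; eexists; first by exists j.
apply: (@limn_einf_ge _ _ _ (maxn K 1)) => k.
by rewrite geq_max => /andP[Kk k0]; apply/rate_geP => //; exact: h.
Qed.

Definition entropy_above (c : R) : set (words m * borel X) :=
  [set z | (c%:E < local_entropy f mu z.1 z.2)%E].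

Lemma measurable_entropy_above c : measurable (entropy_above c).
Proof.
have -> : entropy_above c =
    \bigcup_j \bigcup_K \bigcap_(k in [set k | (K <= k)%N])
    [set z | (mu (bowen_ball f z.1 k z.2 j.+1%:R^-1) <=
      (expR (- ((c + j.+1%:R^-1) * k%:R)))%:E)%E].
  apply/seteqP; split => z.
    by move=> /local_entropy_gtP[j [K h]]; exists j => //; exists K.
  by move=> [j _ [K _ h]]; apply/local_entropy_gtP; exists j, K.
apply: bigcup_measurable => j _; apply: bigcup_measurable => K _.
apply: bigcap_measurable; first by exists K => /=.
move=> k _; rewrite -[X in measurable X]setTI.
apply: emeasurable_fun_infty_c => //; exact: measurable_measure_bowen_ball.
Qed.

Context (p : 'I_m.+1 -> R) (hp : forall i, 0 < p i).
Hypothesis hP : bernoulli_measure p P.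
Hypothesis invF : measure_invariant nu F.

Lemma measurable_map_preimage i (A : set (borel X)) : measurable A ->
  measurable (f i @^-1` A : set (borel X)).
Proof.
move=> mA; rewrite -[X in measurable X]setTI.
by apply: continuous_measurable_borel => //; exact: hf.
Qed.

(** Stationarity of mu, that is mu = sum_i p_i (f_i)_* mu, in the only form used
    here. *)
Lemma measure_preimage_le i (A : set (borel X)) : measurable A ->
  ((p i)%:E * mu (f i @^-1` A) <= mu A)%E.
Proof.
move=> mA.
have mfA := @measurable_map_preimage i _ mA.
have mT : measurable ([set: words m] `*` A) by exact: measurableX.
have mC := @measurable_cylinder m 1 (fun=> i).
have Pi : P [set w : words m | forall j : 'I_1, w j = i] = (p i)%:E.
  by rewrite hP big_ord1.
have -> : mu A = nu ([set: words m] `*` A).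
  rewrite product_measure1E//.
  by rewrite [X in (X * _)%E](@probability_setT _ _ _ P) mul1e.
rewrite -(invF mT) -Pi -product_measure1E//.
apply: le_measure; rewrite ?inE.
- exact: measurableX.
- exact: (measurable_preimage (measurable_skew_product hf)).
by move=> [w x] [/= wi Ax]; split => //=; rewrite (wi ord0).
Qed.

Lemma bowen_ballS w k x (e : R) : 0 <= e ->
  bowen_ball f w k.+1 x e `<=`
  f (w 0%N) @^-1` bowen_ball f (left_shift w) k (f (w 0%N) x) e.
Proof.
move=> e0 y /(bowen_ballP _ _ _ _ _ e0) h; apply/bowen_ballP => // i ik.
have shiftE x' : fiber_iter f (left_shift w) i (f (w 0%N) x') =
    fiber_iter f w i.+1 x'.
  by rewrite -add1n fiber_iterD.
by rewrite !shiftE; exact: h.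
Qed.

(** The Bowen ball of length k + 1 at x lies in the preimage of the ball of
    length k at the image of x; the preimage costs a factor 1 / p_i, which a
    slightly smaller rate absorbs for large k. *)
Lemma entropy_above_subinvariant c :
  F @^-1` entropy_above c `<=` entropy_above c.
Proof.
move=> [w x] /local_entropy_gtP[j [K h]]; apply/local_entropy_gtP.
rewrite -[(w, x).1]/w -[(w, x).2]/x; set i := w 0%N in h *.
have pi0 := hp i.
pose a1 : R := c + j.+1%:R^-1; pose a2 : R := c + j.+2%:R^-1.
have a12 : 0 < a1 - a2.
  by rewrite opprD addrACA subrr add0r subr_gt0 ltf_pV2 ?posrE// ltr_nat.
(* For such k the gain (a1 - a2) k exceeds ln (1 / p_i), the price of the
   preimage, plus the rate a2 of the additional step. *)
exists j.+1, (maxn K (Num.truncn ((a2 - ln (p i)) / (a1 - a2))).+1).+1.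
move=> [//|k]; rewrite ltnS geq_max => /andP[Kk tk].
have j2 : 0 <= j.+2%:R^-1 :> R by [].
have step : (mu (bowen_ball f w k.+1 x j.+2%:R^-1) <=
    mu (f i @^-1` bowen_ball f (left_shift w) k (f i x) j.+1%:R^-1))%E.
  apply: le_measure; rewrite ?inE; first exact: measurable_bowen_ball.
    by apply: measurable_map_preimage; exact: measurable_bowen_ball.
  move=> y /(bowen_ballS j2); rewrite /preimage/=; apply: bowen_ball_le.
  by rewrite lef_pV2 ?posrE// ler_nat.
apply: (le_trans step).
have := measure_preimage_le i
    (measurable_bowen_ball hf (left_shift w) k (f i x) j.+1%:R^-1).
rewrite muleC -lee_pdivlMr// => /le_trans; apply.
have pV0 : (0 <= ((p i)^-1)%:E :> \bar R)%E by rewrite lee_fin invr_ge0 ltW.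
apply: (le_trans (lee_wpmul2r pV0 (h k Kk))); rewrite -/a1.
rewrite -EFinM lee_fin -/a2 -[X in _ * X](@lnK _ (p i)^-1) ?posrE ?invr_gt0//.
rewrite -expRD ler_expR lnV ?posrE//.
have : (a2 - ln (p i)) / (a1 - a2) <= k%:R.
  by apply/ltW/(lt_le_trans (truncnS_gt _)); rewrite ler_nat.
rewrite ler_pdivrMr// -natr1; nra.
Qed.

Lemma partition_label s (xi : 'I_s -> set (borel X)) :
  partition [set: 'I_s] xi [set: borel X] ->
  exists sym : borel X -> 'I_s, xi = (fun i => sym @^-1` [set i]).
Proof.
move=> [cov tri _].
have /choice[sym hsym] : forall x : borel X, exists i, xi i x.
  move=> x; have : [set: borel X] x by [].
  by rewrite -cov => -[i _ xix]; exists i.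
exists sym; apply/funext => i; apply/seteqP; split => x /=; last first.
  by move=> <-; exact: hsym.
move=> xix; apply: (tri _ _ I I); exists x; split => //; exact: hsym.
Qed.

Hypothesis ergF : measure_ergodic nu F.

(** The set of points with local entropy above c is null or conull.  If it were
    null, almost all points would have arbitrarily long heavy balls at every
    scale and every rate above c, so all partitions would have entropy at
    most c.  This is the lower bound of the Brin-Katok formula. *)
Theorem local_entropy_gt_ae c : 0 <= c -> (c%:E < metric_entropy f P mu)%E ->
  {ae nu, forall z, (c%:E < local_entropy f mu z.1 z.2)%E}.
Proof.
move=> c0 ch.
have mF := measurable_skew_product hf.
have mE := measurable_entropy_above c.
have [E0|E1] := decreasing_invariant mF invF mE ergF
    (entropy_above_subinvariant (c := c)); last first.
  exists (~` entropy_above c); split => //; first exact: measurableC.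
  by rewrite probability_setC// E1 subee.
move: ch; rewrite ltNge => /negP; case; apply: ge_ereal_sup.
move=> _ [s [xi [pxi mxi ->]]].
have [sym symE] := partition_label pxi; subst xi.
apply: (partition_entropy_le hf invF mxi c0) => e c' L e0 cc'.
exists (entropy_above c); split => // z /= nz; apply: contrapT => zE; apply: nz.
apply: contrapT => /forallNP nheavy; apply: zE; apply/local_entropy_gtP.
have [j1 hj1] := harmonic_lt e0.
have [j2 hj2] : exists n, n.+1%:R^-1 < c' - c by apply: harmonic_lt;
    rewrite subr_gt0.
pose j := maxn j1 j2; exists j, L => k Lk.
have /not_andP[//|/negP] := nheavy k; rewrite -ltNge => hk.
apply: (@le_trans _ _ (expR (- (c' * k%:R)))%:E).
  apply: le_trans (ltW hk); apply: le_measure_bowen_ball.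
  apply: le_trans (ltW hj1); rewrite lef_pV2 ?posrE// ler_nat ltnS leq_maxl//.
rewrite lee_fin ler_expR lerN2 ler_wpM2r// -lerBrDl.
by apply: le_trans (ltW hj2); rewrite lef_pV2 ?posrE// ler_nat ltnS leq_maxr.
Qed.

End local_entropy.

(** * Fibres of null sets and fine partitions *)

Section measurability_complements.
Context {R : realType}.

Lemma measurable_lne : measurable_fun [set: \bar R] (@lne R).
Proof.
apply: (measurability _ (ErealGenOInfty.measurableE R)).
move=> _ [_ [t ->] <-]; rewrite setTI.
rewrite (_ : _ @^-1` _ = `](expR t)%:E, +oo[%classic).
  exact: emeasurable_itv.
apply/seteqP; split => y /=; rewrite !in_itv/= !andbT.
  have [y0|y0] := ltP y 0%E; first by rewrite le0_lneNy// ltW.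
  by rewrite -lte_expeR lneK// in_itv/= y0 leey.
move=> ty; have y0 : (0 <= y)%E by rewrite ltW// (lt_trans _ ty)//
    lte_fin expR_gt0.
by rewrite -lte_expeR lneK// in_itv/= y0 leey.
Qed.

Lemma measurable_fun_limn_einf d (T : measurableType d)
    (g : nat -> T -> \bar R) :
  (forall n, measurable_fun setT (g n)) ->
  measurable_fun setT (fun x => limn_einf (g ^~ x)).
Proof.
move=> mg; rewrite /limn_einf; apply: measurableT_comp => //.
by apply: measurable_fun_limn_esup => n; exact: measurableT_comp.
Qed.

Context d1 d2 (T1 : measurableType d1) (T2 : measurableType d2).
Context (P1 : probability T1 R) (P2 : probability T2 R).

Lemma ge0_integral_eq0_ae d (T : measurableType d) (mu : probability T R)
    (g : T -> \bar R) : measurable_fun setT g -> (forall x, 0 <= g x)%E ->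
  (\int[mu]_x g x = 0)%E -> {ae mu, forall x, g x = 0%E}.
Proof.
move=> mg g0 ig; have [h _] := ae_eq_integral_abs mu measurableT mg.
have : ae_eq mu setT g (cst 0%E).
  by apply: h; rewrite -[RHS]ig; apply: eq_integral => x _; rewrite gee0_abs.
by apply: filterS => x /(_ I).
Qed.

Lemma ae_xsection (Q : T1 * T2 -> Prop) :
  {ae (P1 \x P2)%E, forall z, Q z} ->
  {ae P1, forall x, {ae P2, forall y, Q (x, y)}}.
Proof.
move=> [N [mN N0 sub]].
have m1 : measurable_fun setT (fun z => (\1_N z)%:E : \bar R).
  by apply/measurable_EFinP; exact: measurable_indic.
have i0 : (\int[(P1 \x P2)%E]_z (\1_N z)%:E = 0)%E.
  by rewrite integral_indic// setIT; exact: N0.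
have n0 z : (0 <= (\1_N z)%:E :> \bar R)%E by rewrite lee_fin.
have m2 := measurable_fun_fubini_tonelli_F (m2 := P2) _ m1 n0.
rewrite fubini_tonelli1// in i0.
apply: filterS (ge0_integral_eq0_ae m2 _ i0) => [x|x]; last first.
  by apply: integral_ge0 => y _.
rewrite /fubini_F => h; exists (xsection N x); split.
- exact: measurable_xsection.
- transitivity (\int[P2]_y (\1_(xsection N x) y)%:E)%E.
    by rewrite integral_indic// ?setIT//; exact: measurable_xsection.
  rewrite -[RHS]h; apply: eq_integral => y _; congr EFin; rewrite !indicE;
      congr (nat_of_bool _)%:R.
  by apply/idP/idP; rewrite mem_xsection ?inE.
- by move=> y /= nQ; rewrite /xsection/= inE; exact: sub.
Qed.

Lemma ae_ysection (Q : T1 * T2 -> Prop) :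
  {ae (P1 \x P2)%E, forall z, Q z} ->
  {ae P2, forall y, {ae P1, forall x, Q (x, y)}}.
Proof.
move=> [N [mN N0 sub]].
have m1 : measurable_fun setT (fun z => (\1_N z)%:E : \bar R).
  by apply/measurable_EFinP; exact: measurable_indic.
have i0 : (\int[(P1 \x P2)%E]_z (\1_N z)%:E = 0)%E.
  by rewrite integral_indic// setIT; exact: N0.
have n0 z : (0 <= (\1_N z)%:E :> \bar R)%E by rewrite lee_fin.
have m2 := measurable_fun_fubini_tonelli_G (m1 := P1) _ m1 n0.
rewrite fubini_tonelli2// in i0.
apply: filterS (ge0_integral_eq0_ae m2 _ i0) => [y|y]; last first.
  by apply: integral_ge0 => x _.
rewrite /fubini_G => h; exists (ysection N y); split.
- exact: measurable_ysection.
- transitivity (\int[P1]_x (\1_(ysection N y) x)%:E)%E.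
    by rewrite integral_indic// ?setIT//; exact: measurable_ysection.
  rewrite -[RHS]h; apply: eq_integral => x _; congr EFin; rewrite !indicE;
      congr (nat_of_bool _)%:R.
  by apply/idP/idP; rewrite mem_ysection ?inE.
- by move=> x /= nQ; rewrite /ysection/= inE; exact: sub.
Qed.

End measurability_complements.

Section fine_partition.
Context {R : realType} {X : pmetricType R}.
Hypothesis hX : compact [set: X].

Lemma measurable_find_ball (cs : seq X) (r : R) n :
  measurable ([set x | find (fun c => mdist c x < r) cs = n] : set (borel X)).
Proof.
elim: cs n => [|c cs IH] n /=.
  have [->|n0] := eqVneq n 0%N.
    by rewrite (_ : [set _ | _] = setT)//; apply/seteqP; split.
  rewrite (_ : [set _ | _] = set0)//; apply/seteqP; split => // x /= /esym/eqP.
  by rewrite (negbTE n0).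
have mc : measurable (ball c r : set (borel X)).
  by apply: measurable_open; exact: open_metric_ball.
case: n => [|n].
  rewrite (_ : [set _ | _] = ball c r)//; apply/seteqP; split => x;
    rewrite ballEmdist/=; by case: ifP.
rewrite (_ : [set _ | _] = ~` ball c r `&`
    [set x | find (fun c => mdist c x < r) cs = n]).
  by apply: measurableI => //; exact: measurableC.
apply/seteqP; split => x; rewrite ballEmdist/=.
  by case: ifP => // /negbT xr [<-]; split => //; exact/negP.
by move=> [/negP/negbTE -> ->].
Qed.

Lemma fine_partition (e : R) : 0 < e -> exists s (sym : borel X -> 'I_s),
  [/\ forall i, measurable (sym @^-1` [set i]),
      forall i, exists x, sym x = i &
      forall x y : X, sym x = sym y -> mdist x y <= e].
Proof.
move=> e0; have e2 : 0 < e / 2 by rewrite divr_gt0.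
have [D _ cov] : finite_subset_cover [set: X]
    (fun c => ball c (e / 2)) [set: X].
  move: hX; rewrite compact_cover; apply => [c _|x _].
    exact: open_metric_ball.
  by exists x => //; exact: ballxx.
pose cs : seq X := finmap.enum_fset D.
have hascs x : has (fun c => mdist c x < e / 2) cs.
  have [c /= cD] := cov x I; rewrite ballEmdist/= => cx.
  by apply/hasP; exists c.
pose g x : 'I_(size cs) :=
  Ordinal (etrans (esym (has_find (fun c => mdist c x < e / 2) cs)) (hascs x)).
pose I := [set i : 'I_(size cs) | `[< exists x, g x = i >]]%SET.
have gI x : g x \in I by rewrite inE; apply/asboolP; exists x.
exists #|I|, (fun x => enum_rank_in (gI point) (g x)); split.
- move=> i; rewrite (_ : _ @^-1` _ =
      [set x | find (fun c => mdist c x < e / 2) cs = enum_val i]).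
    exact: measurable_find_ball.
  apply/seteqP; split => x /=.
    by move=> <-; rewrite enum_rankK_in.
  move=> h; rewrite -[RHS](enum_valK_in (gI point)); congr enum_rank_in.
  exact: val_inj.
- move=> i; have := enum_valP i; rewrite inE => /asboolP[x gx]; exists x.
  by rewrite gx enum_valK_in.
- move=> x y /(congr1 enum_val);
    rewrite !enum_rankK_in// => /(congr1 val)/= gxy.
  have := nth_find point (hascs x); have := nth_find point (hascs y).
  rewrite gxy; set c := nth _ _ _ => cy cx.
  apply: le_trans (metric_triangle _ c _) _; rewrite metric_sym.
  by move: cx cy; lra.
Qed.

End fine_partition.

(** * Correlation integrals *)

Section correlation_entropy.
Context {R : realType} {X : pmetricType R} {m : nat}.
Context (f : 'I_m.+1 -> X -> X) (hf : forall i, continuous (f i)).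
Context (P : probability (words m) R) (mu : probability (borel X) R).
Implicit Types (w : words m) (x : X) (k n K j : nat) (z : words m * borel X).
Local Notation F := (skew_product f).
Local Notation nu := (P \x mu)%E.
Local Open Scope ereal_scope.

Local Notation ball_mass w k e := (fun x => mu (bowen_ball f w k x e)).

(** The correlation integral of a single fibre, with the sign and the
    normalisation that make it a nonnegative cost. *)
Definition cor_loss (q : R) w k (e : R) : \bar R :=
  if q == 1%R then \int[mu]_x - lne (mu (bowen_ball f w k x e))
  else ((q - 1)^-1)%:E *
    - lne (\int[mu]_x (mu (bowen_ball f w k x e) `^ (q - 1))).

Lemma measurable_ball_mass w k e :
    measurable_fun [set: borel X] (ball_mass w k e).
Proof.
exact: measurableT_comp (measurable_measure_bowen_ball hf mu k e)
  (pair1_measurable w).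
Qed.

Lemma measurable_lne_ball_mass w k e :
  measurable_fun [set: borel X] (fun x => - lne (mu (bowen_ball f w k x e))).
Proof.
apply: measurableT_comp => //.
exact: measurableT_comp measurable_lne (measurable_ball_mass w k e).
Qed.

Lemma measurable_pow_ball_mass w k e r :
  measurable_fun [set: borel X] (fun x => mu (bowen_ball f w k x e) `^ r).
Proof. exact: measurableT_comp (measurable_poweR r)
    (measurable_ball_mass w k e). Qed.

Lemma ball_mass_le1 w k x e : mu (bowen_ball f w k x e) <= 1.
Proof. by apply: probability_le1; exact: measurable_bowen_ball. Qed.

Lemma lne_ball_mass_ge0 w k x e : 0 <= - lne (mu (bowen_ball f w k x e)).
Proof. by rewrite oppe_ge0 lne_le0 ball_mass_le1. Qed.

Lemma integral_cst_probability d (T : measurableType d)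
    (pi : probability T R) c :
  \int[pi]_x cst c x = c.
Proof.
rewrite integral_cst// -[RHS]mule1; congr (_ * _); exact: probability_setT.
Qed.

Lemma integral_opp_ge0 d (T : measurableType d) (pi : probability T R)
    (g : T -> \bar R) :
  (forall y, 0 <= - g y) -> - (\int[pi]_y g y) = \int[pi]_y - g y.
Proof.
move=> g0; have h := @integral_ge0N _ _ _ pi setT (fun y => - g y)
    (fun y _ => g0 y).
rewrite -[RHS]oppeK -h; congr (- _).
by apply: eq_integral => x _; rewrite oppeK.
Qed.

Lemma poweR_le_mono (a b : \bar R) (r : R) : (0 <= r)%R -> 0 <= a -> a <= b ->
  a `^ r <= b `^ r.
Proof.
move=> r0 a0 ab.
by apply: gt0_ler_poweR; rewrite ?in_itv/= ?leey ?andbT// (le_trans a0).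
Qed.

Lemma pow_ball_mass_le1 w k x e r : (0 <= r)%R ->
  mu (bowen_ball f w k x e) `^ r <= 1.
Proof. by move=> r0; rewrite -(poweR1r r) poweR_le_mono// ball_mass_le1. Qed.

Lemma integral_pow_ball_mass_le1 w k e r : (0 <= r)%R ->
  \int[mu]_x (mu (bowen_ball f w k x e) `^ r) <= 1.
Proof.
move=> r0; rewrite -[leRHS](integral_cst_probability mu).
apply: ge0_le_integral => //; try exact: measurable_pow_ball_mass.
- by move=> x _; exact: poweR_ge0.
- by move=> x _; exact: pow_ball_mass_le1.
Qed.

Lemma cor_loss_ge0 q w k e : (1 <= q)%R -> 0 <= cor_loss q w k e.
Proof.
move=> q1; rewrite /cor_loss; case: eqP => _.
  by apply: integral_ge0 => x _; exact: lne_ball_mass_ge0.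
have q0 : (0 <= q - 1)%R by rewrite subr_ge0.
rewrite mule_ge0// ?lee_fin ?invr_ge0//.
by rewrite oppe_ge0 lne_le0 integral_pow_ball_mass_le1.
Qed.

Lemma eq_cor_loss q w w' k e : same_prefix k w w' ->
  cor_loss q w k e = cor_loss q w' k e.
Proof.
move=> ww'; have bE x : bowen_ball f w k x e = bowen_ball f w' k x e.
  exact: eq_bowen_ball.
rewrite /cor_loss; case: eqP => _; last congr (_ * - lne _);
  by apply: eq_integral => x _; rewrite bE.
Qed.

Lemma measurable_cor_loss q k e :
  measurable_fun [set: words m] (fun w => cor_loss q w k e).
Proof. by apply: (@measurable_fun_prefix1 _ _ _ k) => w w';
    exact: eq_cor_loss. Qed.

Lemma cor_integralE q k e : (1 <= q)%R ->
  (- k%:R^-1)%:E * cor_integral f P mu e k q =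
  (k%:R^-1)%:E * \int[P]_w cor_loss q w k e.
Proof.
move=> q1; rewrite oppr_mule; congr (_ * _).
rewrite /cor_integral /cor_loss; case: eqP => [_|/eqP qneq].
  have E w : \int[mu]_x lne (mu (bowen_ball f w k x e)) =
      - (\int[mu]_x - lne (mu (bowen_ball f w k x e))).
    by rewrite -integral_opp_ge0 ?oppeK// => x; exact: lne_ball_mass_ge0.
  have L0 w : 0 <= \int[mu]_x - lne (mu (bowen_ball f w k x e)).
    by apply: integral_ge0 => x _; exact: lne_ball_mass_ge0.
  rewrite integral_opp_ge0; last by move=> w; rewrite E oppeK.
  by apply: eq_integral => w _; rewrite E oppeK.
have q0 : (0 <= q - 1)%R by rewrite subr_ge0.
have I0 w : 0 <= - lne (\int[mu]_x (mu (bowen_ball f w k x e) `^ (q - 1))).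
  by rewrite oppe_ge0 lne_le0 integral_pow_ball_mass_le1.
rewrite ge0_integralZl//; first by rewrite -muleN integral_opp_ge0.
- apply: (@measurable_fun_prefix1 _ _ _ k) => w w' ww'; congr (- lne _).
  by apply: eq_integral => x _; rewrite (eq_bowen_ball f x e ww').
- by rewrite lee_fin invr_ge0.
Qed.

Lemma cor_loss_nonincreasing q w k (e e' : R) : (1 <= q)%R -> (e <= e')%R ->
  cor_loss q w k e' <= cor_loss q w k e.
Proof.
move=> q1 ee; have bl x := le_measure_bowen_ball hf mu w k x ee.
rewrite /cor_loss; case: eqP => _.
  apply: ge0_le_integral => //; try exact: measurable_lne_ball_mass.
  - by move=> x _; exact: lne_ball_mass_ge0.
  - by move=> x _; rewrite leeN2 lee_lne// in_itv/= leey andbT.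
have q0 : (0 <= q - 1)%R by rewrite subr_ge0.
have i0 e0 : 0 <= \int[mu]_x (mu (bowen_ball f w k x e0) `^ (q - 1)).
  by apply: integral_ge0 => x _; exact: poweR_ge0.
rewrite lee_wpmul2l ?lee_fin ?invr_ge0// leeN2 lee_lne ?in_itv/= ?leey ?i0//.
apply: ge0_le_integral => //; try exact: measurable_pow_ball_mass.
- by move=> x _; exact: poweR_ge0.
- by move=> x _; exact: poweR_le_mono.
Qed.

Lemma cor_loss_ge q w k e (a : R) : (1 <= q)%R -> (0 <= a)%R ->
  {ae mu, forall x : borel X,
    mu (bowen_ball f w k x e) <= (expR (- a))%:E} ->
  a%:E <= cor_loss q w k e.
Proof.
move=> q1 a0 ball_le; rewrite /cor_loss; case: eqP => [_|/eqP qneq].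
  rewrite -[leLHS](integral_cst_probability mu).
  apply: ae_ge0_le_integral => //; try exact: measurable_lne_ball_mass.
  - by move=> x _; exact: lne_ball_mass_ge0.
  - apply: filterS ball_le => x h _; rewrite leeNr -EFinN.
    by rewrite -lee_expeR lneK// in_itv/= leey andbT.
have q0 : (0 < q - 1)%R by rewrite subr_gt0 lt_neqAle eq_sym qneq.
rewrite lee_pdivlMl// -EFinM leeNr -EFinN -lee_expeR lneK; last first.
  rewrite in_itv/= leey andbT; apply: integral_ge0 => x _; exact: poweR_ge0.
rewrite -[leRHS](integral_cst_probability mu).
apply: ae_ge0_le_integral => //; try exact: measurable_pow_ball_mass.
- by move=> x _; exact: poweR_ge0.
- by move=> x _; rewrite lee_fin expR_ge0.
- apply: filterS ball_le => x h _.
  apply: le_trans (poweR_le_mono (ltW q0) _ h) _ => //.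
  by rewrite poweR_EFin /powR gt_eqF ?expR_gt0// expRK mulrN.
Qed.

Hypothesis hsupp : full_support mu.

Lemma ball_mass_gt0 w k x e : (0 < e)%R -> 0 < mu (bowen_ball f w k x e).
Proof.
move=> e0; have := nbhs_bowen hf w k x e0.
rewrite -nbhs_nearE nbhsE => -[U [oU Ux] Usub].
apply: (@lt_le_trans _ _ (mu U)); first by apply: hsupp => //; exists x.
apply: le_measure; rewrite ?inE; try exact: measurable_bowen_ball.
  exact: measurable_open.
move=> y /Usub h; apply/(bowen_ballP _ _ _ _ _ (ltW e0)) => i ik.
exact/ltW/h.
Qed.

(** Jensen's inequality for the logarithm, obtained by integrating the bound
    ln t <= t - 1 at t = phi / I, where phi has mean I. *)
Lemma cor_loss_le1 q w k e : (1 <= q)%R -> (0 < e)%R ->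
  cor_loss q w k e <= cor_loss 1 w k e.
Proof.
move=> q1 e0; rewrite [leRHS]/cor_loss eqxx /cor_loss;
    case: eqP => // /eqP qneq.
have q0 : (0 < q - 1)%R by rewrite subr_gt0 lt_neqAle eq_sym qneq.
set phi := fun x : borel X => mu (bowen_ball f w k x e) `^ (q - 1).
have mphi : measurable_fun setT phi by exact: measurable_pow_ball_mass.
have phi0 x : 0 <= phi x by exact: poweR_ge0.
have phi_gt0 x : 0 < phi x by apply: poweR_gt0; exact: ball_mass_gt0.
have phi1 x : phi x <= 1 by apply: pow_ball_mass_le1; exact: ltW.
pose I := fine (\int[mu]_x phi x).
have IE : \int[mu]_x phi x = I%:E.
  rewrite /I fineK// ge0_fin_numE; last exact: integral_ge0.
  apply: le_lt_trans (ltry 1%R); apply: integral_pow_ball_mass_le1; exact: ltW.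
have I0 : (0 < I)%R.
  rewrite lt_neqAle -lee_fin -IE integral_ge0 ?andbT//; apply/eqP => I0.
  have ae0 : {ae mu, forall x : borel X, phi x = 0}.
    by apply: (ge0_integral_eq0_ae mphi phi0); rewrite IE -I0.
  have [x /= ] : exists x, phi x = 0.
    have mu_gt0 : 0 < mu [set: borel X].
      by rewrite [ltRHS](@probability_setT _ _ _ mu).
    have ? := ae_properfilter_algebraOfSetsType mu_gt0.
    exact: filter_ex ae0.
  by move=> h; have := phi_gt0 x; rewrite h ltxx.
have I1 : (I <= 1)%R.
  by rewrite -lee_fin -IE; apply: integral_pow_ball_mass_le1; exact: ltW.
have lphi x : - lne (phi x) =
    (q - 1)%:E * - lne (mu (bowen_ball f w k x e)).
  have := ball_mass_gt0 w k x e0; have := ball_mass_le1 w k x e.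
  rewrite /phi; case: (mu _) => // r _; rewrite lte_fin => r0.
  rewrite poweR_EFin !lne_EFin ?powR_gt0// ln_powR.
  by rewrite -!EFinN -EFinM mulrN.
have h : - lne I%:E <= \int[mu]_x - lne (phi x).
  rewrite -(@leeD2rE _ 1)//.
  have one : \int[mu]_x ((I^-1)%:E * phi x) = 1.
    rewrite ge0_integralZl//; last by rewrite lee_fin invr_ge0 ltW.
    by rewrite IE -EFinM mulVf// gt_eqF.
  rewrite -[X in _ <= _ + X]one -ge0_integralD//; first last.
  - by apply: measurable_funeM.
  - by move=> x _; rewrite mule_ge0// lee_fin invr_ge0 ltW.
  - apply: measurableT_comp => //; exact: measurableT_comp measurable_lne mphi.
  - by move=> x _; rewrite oppe_ge0 lne_le0.
  rewrite -[leLHS](integral_cst_probability mu).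
  apply: ge0_le_integral => //.
  - by move=> x _; rewrite /cst adde_ge0// oppe_ge0 lne_le0 lee_fin.
  - apply: emeasurable_funD; last exact: measurable_funeM.
    by apply: measurableT_comp => //;
        exact: measurableT_comp measurable_lne mphi.
  - move=> x _; rewrite /cst; have := phi_gt0 x; have := phi1 x.
    case: (phi x) => // r r1.
    rewrite lte_fin => r0; rewrite !lne_EFin// -!EFinN -EFinM -!EFinD lee_fin.
    have : (ln (r / I) <= r / I - 1)%R.
      rewrite -{1}(subrK 1%R (r / I)%R) addrC le_ln1Dx// ltrBrDl subrr.
      exact: divr_gt0.
    by rewrite ln_div ?posrE// mulrC; lra.
rewrite muleC lee_pdivrMr//.
rewrite muleC -ge0_integralZl//; first last.
- by rewrite lee_fin ltW.
- by move=> x _; exact: lne_ball_mass_ge0.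
- exact: measurable_lne_ball_mass.
rewrite IE; apply: le_trans h _; rewrite le_eqVlt; apply/orP; left; apply/eqP.
by apply: eq_integral => x _; exact: lphi.
Qed.

End correlation_entropy.

(** * Correlation entropies of order q >= 1 *)

Section correlation_rates.
Context {R : realType} {X : pmetricType R} {m : nat}.
Context (f : 'I_m.+1 -> X -> X) (hf : forall i, continuous (f i)).
Context (P : probability (words m) R) (mu : probability (borel X) R).
Context (p : 'I_m.+1 -> R) (hp : forall i, 0 < p i).
Hypothesis hX : compact [set: X].
Hypothesis hP : bernoulli_measure p P.
Hypothesis invF : measure_invariant (P \x mu)%E (skew_product f).
Hypothesis ergF : measure_ergodic (P \x mu)%E (skew_product f).
Hypothesis hsupp : full_support mu.
Hypothesis hunif : uniform_local_entropy f P mu.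
Implicit Types (w : words m) (k n K j : nat) (q e : R).
Local Notation nu := (P \x mu)%E.
Local Open Scope ereal_scope.

Definition loss_rate q e k : \bar R :=
  (k%:R^-1)%:E * \int[P]_w cor_loss f mu q w k e.

Lemma loss_rate_ge0 q e k : (1 <= q)%R -> 0 <= loss_rate q e k.
Proof.
move=> q1; rewrite mule_ge0 ?lee_fin//; apply: integral_ge0 => w _.
exact: cor_loss_ge0.
Qed.

Lemma loss_rate_nonincreasing q e e' k : (1 <= q)%R -> (e <= e')%R ->
  loss_rate q e' k <= loss_rate q e k.
Proof.
move=> q1 ee; rewrite lee_wpmul2l ?lee_fin//.
apply: ge0_le_integral => //; try exact: measurable_cor_loss.
- by move=> w _; exact: cor_loss_ge0.
- by move=> w _; exact: cor_loss_nonincreasing.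
Qed.

(** The Bowen ball of radius e contains the atom of any partition of mesh e, so
    the correlation integrals cost no more than the entropy of that
    partition. *)
Lemma limsup_loss_rate_le q e : (1 <= q)%R -> (0 < e)%R ->
  limn_esup (loss_rate q e) <= metric_entropy f P mu.
Proof.
move=> q1 e0; have [s [sym [msym sur fine]]] := fine_partition hX e0.
have cvP := cvg_partition_entropy hf invF msym.
apply: (@le_trans _ _ (partition_entropy f P mu (fun i => sym @^-1` [set i]))).
  apply: (limn_esup_le_lim (N := 0%N) _ cvP) => k _.
  rewrite lee_wpmul2l ?lee_fin// fubini_tonelli1//; last 2 first.
  - exact: measurable_information.
  - exact: information_ge0.
  apply: ge0_le_integral => //; try exact: measurable_cor_loss.
  - by move=> w _; exact: cor_loss_ge0.
  - apply: measurable_fun_fubini_tonelli_F; first exact: measurable_information.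
    exact: information_ge0.
  move=> w _; apply: le_trans (cor_loss_le1 hf hsupp w k q1 e0) _.
  rewrite /cor_loss eqxx; apply: ge0_le_integral => //.
  - by move=> x _; exact: lne_ball_mass_ge0.
  - exact: measurable_lne_ball_mass.
  - exact: measurable_information_fiber.
  move=> x _; rewrite /information leeN2 lee_lne ?in_itv/= ?leey ?andbT//.
  apply: le_measure; rewrite ?inE; first exact: measurable_atom.
    exact: measurable_bowen_ball.
  move=> y h; apply/(bowen_ballP _ _ _ _ _ (ltW e0)) => i ik; apply: fine.
  by rewrite -h.
apply: ereal_sup_ubound; exists s, (fun i => sym @^-1` [set i]); split => //.
split.
- by apply/seteqP; split => // x _; exists (sym x).
- by move=> i j _ _ [x [/= <- <-]].
- by move=> i _; have [x xi] := sur i; exists x.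
Qed.

(** By uniformity one scale and one length serve almost all points of a fibre,
    so that the bound on the local entropy passes to the integral over the
    fibre. *)
Lemma uniform_cor_loss q (c : R) : (1 <= q)%R -> (0 <= c)%R ->
  c%:E < metric_entropy f P mu ->
  {ae P, forall w, exists e0 : R, (0 < e0)%R /\ forall e, (0 < e <= e0)%R ->
     exists K, forall k, (K < k)%N ->
       c%:E <= (k%:R^-1)%:E * cor_loss f mu q w k e}.
Proof.
move=> q1 c0 /lte_EFin_slack[j0 /(_ j0 (leqnn _)) ch].
set d : R := (j0.+1%:R^-1)%R in ch.
have d0 : (0 < d)%R by rewrite /d.
have cd0 : (0 <= c + d)%R by exact: addr_ge0 c0 (ltW d0).
(* The slack d above c pays for the error allowed in the uniform limit. *)
have := local_entropy_gt_ae hf hp hP invF ergF cd0 ch => /ae_xsection ent.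
have unif_ae := hunif; rewrite /uniform_local_entropy in unif_ae.
apply: filterS2 ent unif_ae => w entw [A [mA A1 unif]].
have [e0 [e00 he]] := unif d d0; exists e0; split => // e ee0.
have [K hK] := he e ee0; exists K => k Kk.
have k0 : (0 < k)%N by exact: leq_trans Kk.
rewrite lee_pdivlMl ?ltr0n// -EFinM mulrC.
apply: cor_loss_ge => //; first by rewrite mulr_ge0.
have aeA : {ae mu, forall x : borel X, A x}.
  exists (~` A); split => //; first exact: measurableC.
  by rewrite probability_setC// A1 subee.
apply: filterS2 entw aeA => x /= entx Ax; apply/rate_geP => //.
apply: le_trans (hK k Kk x Ax).
by rewrite leeBrDr// -EFinD ltW.
Qed.

(** Uniformity makes the correlation integrals decay at the rate of the local
    entropy in almost every fibre, at a scale that depends on the fibre; Fatou's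
    lemma is applied on the fibres where a given scale is good. *)
Lemma liminf_loss_rate_ge q (c : R) : (1 <= q)%R ->
  c%:E < metric_entropy f P mu ->
  exists2 e0 : R, (0 < e0)%R &
    forall e, (0 < e <= e0)%R -> c%:E <= limn_einf (loss_rate q e).
Proof.
move=> q1 ch; have [c0|c0] := ltP c 0%R.
  exists 1%R => // e _; apply: (@limn_einf_ge _ _ _ 0%N) => k _.
  by apply: le_trans (loss_rate_ge0 _ _ q1); rewrite lee_fin ltW.
have [j0 /(_ j0 (leqnn _)) ch'] := lte_EFin_slack ch.
set d : R := (j0.+1%:R^-1)%R in ch'; have d0 : (0 < d)%R by rewrite /d.
pose c' : R := (c + d)%R; have c'0 : (0 < c')%R by rewrite ltr_wpDl.
pose u n k w := (k%:R^-1)%:E * cor_loss f mu q w k n.+1%:R^-1.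
have mu_ n k : measurable_fun [set: words m] (u n k).
  by apply: measurable_funeM; exact: measurable_cor_loss.
have u0 n k w : 0 <= u n k w by rewrite mule_ge0 ?lee_fin ?cor_loss_ge0.
pose Y n w := limn_einf (fun k => u n k w).
have mY n : measurable_fun [set: words m] (Y n).
  exact: measurable_fun_limn_einf.
pose G n := [set w : words m | c'%:E <= Y n w].
have mG n : measurable (G n).
  by rewrite -[X in measurable X]setTI; exact: emeasurable_fun_c_infty.
(* With this bound, c' P (G n) >= c' - d = c. *)
have [n Gn] : exists n, (fine (P (~` G n)) < d / c')%R.
  apply: exhaustion => //.
  - move=> n n' nn w; rewrite /G/= => /le_trans; apply.
    apply: (@le_limn_einf _ _ _ 0%N) => k _; rewrite lee_wpmul2l ?lee_fin//.
    apply: cor_loss_nonincreasing => //.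
    by rewrite lef_pV2 ?posrE// ler_nat.
  - apply: filterS (uniform_cor_loss q1 (ltW c'0) ch') => w [e0 [e00 he]].
    have [n ne] := harmonic_lt e00; exists n.
    have /he[K hK] : (0 < (n.+1%:R^-1 : R) <= e0)%R by rewrite invr_gt0
        ltr0n ltW.
    by apply: (@limn_einf_ge _ _ _ K.+1) => k Kk; exact: hK.
  - exact: divr_gt0.
exists n.+1%:R^-1%R => // e /andP[e0 en].
apply: (@le_trans _ _ (limn_einf (loss_rate q n.+1%:R^-1))); last first.
  by apply: (@le_limn_einf _ _ _ 0%N) => k _; exact: loss_rate_nonincreasing.
have rE k : loss_rate q n.+1%:R^-1 k = \int[P]_w u n k w.
  rewrite /loss_rate ge0_integralZl//.
  - exact: measurable_cor_loss.
  - by move=> w _; exact: cor_loss_ge0.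
rewrite (_ : loss_rate _ _ = fun k => \int[P]_w u n k w); last exact/funext.
apply: le_trans (fatou P measurableT (mu_ n) (fun k w _ => u0 n k w)).
apply: (@le_trans _ _ (c'%:E * P (G n))).
  have -> : P (G n) = (1 - fine (P (~` G n)))%:E.
    rewrite probability_setC// -[P (G n)]fineK ?fin_num_measure//.
    by rewrite -EFinB/= subKr.
  rewrite -EFinM lee_fin mulrBr mulr1 /c' -addrA lerDl subr_ge0 mulrC.
  by move: Gn; rewrite ltr_pdivlMr// => /ltW.
rewrite -integral_cst//; apply: (@le_trans _ _ (\int[P]_(w in G n) Y n w)).
  apply: ge0_le_integral => //.
  - by move=> w _; rewrite lee_fin ltW.
  - exact: measurable_funTS.
apply: ge0_subset_integral => // w _.
by apply: (@limn_einf_ge _ _ _ 0%N).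
Qed.

Theorem cor_entropy_exists q : (1 <= q)%R ->
  is_cor_entropy f P mu q (metric_entropy f P mu).
Proof.
move=> q1.
have E e : (fun k => (- k%:R^-1)%:E * cor_integral f P mu e k q) =
    loss_rate q e.
  by apply/funext => k; exact: cor_integralE.
rewrite /is_cor_entropy /upper_cor_entropy /lower_cor_entropy.
under eq_fun do rewrite E; under [in X in _ /\ X]eq_fun do rewrite E.
have [] := lim_at0_sandwich (lo := fun e => limn_einf (loss_rate q e))
  (hi := fun e => limn_esup (loss_rate q e)) (h := metric_entropy f P mu).
- by move=> e _; exact: limn_einf_sup.
- by move=> e e0; exact: limsup_loss_rate_le.
- by move=> c; exact: liminf_loss_rate_ge.
by [].
Qed.

End correlation_rates.

(** * Frequencies of pairs *)

Section pair_frequencies.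
Context {R : realType} {X : pmetricType R} {m : nat}.
Context (f : 'I_m.+1 -> X -> X) (hf : forall i, continuous (f i)).
Context (P : probability (words m) R) (mu : probability (borel X) R).
Context (I : finType) (nm : borel X -> I).
Hypothesis mnm : forall a, measurable (nm @^-1` [set a]).
Implicit Types (v : words m) (x : X) (n : nat) (S : pred (I * I)).
Local Notation F := (skew_product f).
Local Open Scope ereal_scope.

Lemma measurable_orbit_pairs (Q : rel X) x n :
  measurable_fun setT (fun v : words m => (#|[pred ij : 'I_n * 'I_n |
    Q (fiber_iter f v ij.1 x) (fiber_iter f v ij.2 x)]|%:R : R)%:E).
Proof.
apply: (@measurable_fun_prefix1 _ _ _ n) => v v' vv'; congr (_%:R%:E).
by apply: eq_card => ij; rewrite !inE !(eq_fiber_iter f _ vv')// ltnW.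
Qed.

Let mass a : R := fine (mu (nm @^-1` [set a])).
Let freq a n v x : nat :=
    visits F ([set: words m] `*` (nm @^-1` [set a])) n (v, x).

Definition pair_count S n v x : nat :=
  #|[pred ij : 'I_n * 'I_n |
      S (nm (fiber_iter f v ij.1 x), nm (fiber_iter f v ij.2 x))]|.

Lemma freqE a n v x :
    freq a n v x = (\sum_(i < n) (nm (fiber_iter f v i x) == a))%N.
Proof.
rewrite /freq /visits; apply: eq_bigr => i _; rewrite iter_skew_product.
congr nat_of_bool; apply/idP/eqP => [/set_mem[]//|nma].
by apply/mem_set; split.
Qed.

Lemma pair_countE S n v x :
  pair_count S n v x = (\sum_(ab | S ab) freq ab.1 n v x * freq ab.2 n v x)%N.
Proof.
rewrite /pair_count -sum1_card big_mkcond/=.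
transitivity (\sum_(ij : 'I_n * 'I_n) \sum_(ab | S ab)
    (nm (fiber_iter f v ij.1 x) == ab.1) *
        (nm (fiber_iter f v ij.2 x) == ab.2))%N.
  apply: eq_bigr => -[i j] _ /=; rewrite inE/=.
  set y := nm _; set z := nm _; case: ifPn => Syz.
    rewrite (bigD1 (y, z))//= !eqxx big1 ?addn0// => -[a b] /= /andP[_ ab].
    apply/eqP; rewrite muln_eq0 !eqb0 -negb_and; apply: contra ab.
    by move=> /andP[/eqP -> /eqP ->].
  rewrite big1// => -[a b] /= Sab; apply/eqP; rewrite muln_eq0 !eqb0 -negb_and.
  by apply: contra Syz => /andP[/eqP -> /eqP ->].
rewrite exchange_big/=; apply: eq_bigr => -[a b] _ /=.
rewrite !freqE big_distrlr/= pair_bigA/=.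
by apply: eq_bigr => -[i j].
Qed.

(** The number of pairs is a quadratic form in the numbers of visits to the
    cells, so its normalised value converges in almost every fibre; being
    bounded by 1, it converges in mean as well. *)
Lemma cvg_pair_frequency S x :
  {ae P, forall v : words m, forall a,
     ((freq a n v x)%:R / n%:R)%R @[n --> \oo] --> mass a} ->
  ((n%:R ^+ 2)^-1)%:E * \int[P]_v ((pair_count S n v x)%:R : R)%:E @[n --> \oo]
    --> (\sum_(ab | S ab) mass ab.1 * mass ab.2)%:E.
Proof.
move=> freq_cvg; set l := (\sum_(_ | _) _)%R.
pose g n v : R := ((n%:R ^+ 2)^-1 * (pair_count S n v x)%:R)%R.
have mg n : measurable_fun [set: words m] (EFin \o g n).
  apply/measurable_EFinP; apply: measurable_funM => //; apply/measurable_EFinP.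
  exact: (measurable_orbit_pairs (fun y z => S (nm y, nm z))).
have g01 n v : (0 <= g n v <= 1)%R.
  rewrite /g mulr_ge0 ?invr_ge0 ?exprn_ge0//=.
  have [->|n0] := eqVneq n 0%N; first by rewrite expr0n/= invr0 mul0r.
  rewrite mulrC ler_pdivrMr ?exprn_gt0 ?ltr0n ?lt0n// mul1r -natrX ler_nat.
  by apply: leq_trans (max_card _) _; rewrite card_prod card_ord mulnn.
have gcvg : {ae P, forall v : words m, [set: words m] v ->
    (EFin \o g n) v @[n --> \oo] --> cst l%:E v}.
  apply: filterS freq_cvg => v hv _; apply/fine_cvgP; split; first exact: nearW.
  rewrite [X in X @ _](_ : _ = fun n => (\sum_(ab | S ab)
      ((freq ab.1 n v x)%:R / n%:R) * ((freq ab.2 n v x)%:R / n%:R))%R).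
    apply: cvg_big => [|ab _]; first exact: add_continuous.
    by apply: cvgM; exact: hv.
  apply/funext => n /=; rewrite /g pair_countE natr_sum mulr_sumr.
  by apply: eq_bigr => ab _; rewrite natrM expr2 invfM; ring.
have mc : measurable_fun [set: words m] (cst l%:E) by exact: measurable_cst.
have i1 : P.-integrable [set: words m] (cst 1%:E).
  exact: finite_measure_integrable_cst.
have dom : {ae P, forall v n, [set: words m] v ->
    `|(EFin \o g n) v| <= cst 1%:E v}.
  apply: nearW => v n _ /=; rewrite lee_fin ger0_norm; have /andP[] :=
      g01 n v => //.
have [_ _] := dominated_convergence measurableT mg mc gcvg i1 dom.
rewrite integral_cst_probability; apply: cvg_trans.
apply: near_eq_cvg; apply: nearW => n; rewrite -ge0_integralZl//.
exact: (measurable_orbit_pairs (fun y z => S (nm y, nm z))).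
Qed.

Lemma integral_pair_mass S :
  \int[mu]_y mu [set z | S (nm y, nm z)] =
  (\sum_(ab | S ab) mass ab.1 * mass ab.2)%:E.
Proof.
have cellE (c : pred I) : mu [set z | c (nm z)] = (\sum_(b | c b) mass b)%:E.
  transitivity (\int[mu]_z (fun b => ((c b)%:R : R)%:E) (nm z)).
    have mc : measurable [set z | c (nm z)].
      have := measurable_fun_finite mnm (c : I -> bool).
      by move=> /(_ measurableT [set true]); rewrite setTI; apply.
    transitivity (\int[mu]_z (\1_[set z | c (nm z)] z)%:E).
      by rewrite integral_indic// setIT.
    apply: eq_integral => z _; rewrite indicE; congr (_%:R%:E).
    by congr nat_of_bool; apply/idP/idP; rewrite inE.
  rewrite (integral_finite mu mnm (c := fun b => ((c b)%:R : R)%:E));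
      last first.
    by move=> b; rewrite lee_fin.
  rewrite -sumEFin [RHS]big_mkcond/=; apply: eq_bigr => b _.
  rewrite /mass; case: (c b); last by rewrite mul0e.
  by rewrite mul1e fineK//; exact: fin_num_measure.
transitivity (\int[mu]_y (fun a => (\sum_(b | S (a, b)) mass b)%:E) (nm y)).
  by apply: eq_integral => y _; rewrite (cellE (fun b => S (nm y, b))).
have mass0 a : (0 <= mass a)%R by exact: fine_ge0.
rewrite (integral_finite mu mnm
    (c := fun a => (\sum_(b | S (a, b)) mass b)%:E)).
  have -> : (\sum_(ab | S ab) mass ab.1 * mass ab.2 =
      \sum_a \sum_(b | S (a, b)) mass a * mass b)%R.
    by rewrite pair_big_dep; apply: eq_big => -[a b].
  rewrite -sumEFin; apply: eq_bigr => a _; rewrite -mulr_sumr muleC EFinM.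
  by rewrite fineK//; exact: fin_num_measure.
by move=> a; rewrite lee_fin sumr_ge0.
Qed.

End pair_frequencies.

(** * Local correlation entropy *)

Section local_correlation.
Context {R : realType} {X : pmetricType R} {m : nat}.
Context (f : 'I_m.+1 -> X -> X) (hf : forall i, continuous (f i)).
Context (P : probability (words m) R) (mu : probability (borel X) R).
Implicit Types (w v : words m) (x y z : borel X) (k n : nat) (e r : R).
Local Notation F := (skew_product f).
Local Open Scope ereal_scope.

Definition equidistributed s (sym : borel X -> 'I_s) w k x : Prop :=
  {ae P, forall v : words m, forall a,
     ((visits F ([set: words m] `*` (itinerary f sym w k @^-1` [set a])) n
         (v, x))%:R
      / n%:R)%R @[n --> \oo] --> fine (mu (itinerary f sym w k @^-1` [set a]))}.

(** The correlation integral of order 2 of a single fibre. *)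
Definition corr_mass w k e : \bar R := \int[mu]_y mu (bowen_ball f w k y e).

Lemma corr_mass_ge0 w k e : 0 <= corr_mass w k e.
Proof. exact: integral_ge0. Qed.

Lemma cor_loss2E w k e : cor_loss f mu 2 w k e = - lne (corr_mass w k e).
Proof.
have e21 : (2 - 1 = 1 :> R)%R by lra.
rewrite /cor_loss ifF ?e21 ?invr1 ?mul1e; last by apply/negbTE/eqP; lra.
by congr (- lne _); apply: eq_integral => y _; rewrite poweRe1.
Qed.

Lemma eq_cor_sum w w' k e x n : same_prefix k w w' ->
  cor_sum f P x e w k n = cor_sum f P x e w' k n.
Proof.
move=> ww'; congr (_ * _); apply: eq_integral => v _; congr (_%:R%:E).
by apply: eq_card => ij; rewrite !inE (eq_bowen_dist f _ _ ww').
Qed.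

Section one_scale.
Context (s : nat) (sym : borel X -> 'I_s) (r : R).
Hypothesis msym : forall i, measurable (sym @^-1` [set i]).
Hypothesis r0 : (0 <= r)%R.
Hypothesis mesh : forall x y, sym x = sym y -> (mdist x y <= r)%R.
Context (w : words m) (k : nat) (x : borel X).
Hypothesis eqx : equidistributed sym w k x.

Local Notation nm := (itinerary f sym w k).

Let close_pair e : pred ({ffun 'I_k -> 'I_s} * {ffun 'I_k -> 'I_s}) :=
  fun ab => `[< exists y z,
    [/\ nm y = ab.1, nm z = ab.2 & bowen_ball f w k y e z] >].

Lemma itinerary_mesh y z : nm y = nm z -> bowen_ball f w k y r z.
Proof.
move=> /ffunP yz; apply/(bowen_ballP _ _ _ _ _ r0) => i ik; apply: mesh.
by have := yz (Ordinal ik); rewrite !ffunE.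
Qed.

Lemma close_pair_ball e y z : (0 <= e)%R -> close_pair e (nm y, nm z) ->
  bowen_ball f w k y (r + (e + r)) z.
Proof.
move=> e0 /asboolP[y' [z' [/= yy' zz' yz]]].
apply: (@bowen_ballD _ _ _ _ _ _ _ y') => //; first by rewrite addr_ge0.
  exact: itinerary_mesh.
by apply: (@bowen_ballD _ _ _ _ _ _ _ z') => //; exact: itinerary_mesh.
Qed.

Let mnm := @measurable_itinerary _ _ _ f hf s sym msym w k.

Let measurable_close e y :
  measurable ([set z | close_pair e (nm y, nm z)] : set (borel X)).
Proof.
have := measurable_fun_finite mnm (fun b => close_pair e (nm y, b)).
by move=> /(_ measurableT [set true]); rewrite setTI; apply.
Qed.

Let measurable_close_mass e :
  measurable_fun [set: borel X]
      (fun y => mu [set z | close_pair e (nm y, nm z)]).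
Proof.
exact: (measurable_fun_finite mnm
    (fun a => mu [set z | close_pair e (a, nm z)])).
Qed.

Lemma upper_cor_sum_le e : (0 < e)%R ->
  upper_cor_sum f P x e w k <= corr_mass w k (r + (e + r)).
Proof.
move=> e0; have cv :=
    @cvg_pair_frequency _ _ _ f P mu _ nm (close_pair e) x eqx.
apply: (le_trans (limn_esup_le_lim (N := 0%N) _ cv)) => [n _|].
  rewrite lee_wpmul2l ?lee_fin ?invr_ge0 ?exprn_ge0//.
  apply: ge0_le_integral => //.
  - exact: (measurable_orbit_pairs f
      (fun y z => (bowen_dist f w k y z <= e)%R)).
  - exact: (measurable_orbit_pairs f (fun y z => close_pair e (nm y, nm z))).
  move=> v _; rewrite lee_fin ler_nat /pair_count.
  apply/fintype.subset_leq_card/fintype.subsetP => ij.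
  rewrite !inE => close.
  by exists (fiber_iter f v ij.1 x), (fiber_iter f v ij.2 x).
rewrite -(integral_pair_mass mu mnm) /corr_mass.
apply: ge0_le_integral => //; first exact: measurable_ball_mass.
move=> y _; apply: le_measure; rewrite ?inE.
- exact: measurable_close.
- exact: measurable_bowen_ball.
by move=> z; exact/close_pair_ball/ltW.
Qed.

Lemma lower_cor_sum_ge e e' : (0 < e)%R -> (r + (e + r) <= e')%R ->
  corr_mass w k e <= lower_cor_sum f P x e' w k.
Proof.
move=> e0 ee'; have cv :=
    @cvg_pair_frequency _ _ _ f P mu _ nm (close_pair e) x eqx.
apply: le_trans (limn_einf_ge_lim (N := 0%N) _ cv) => [|n _]; last first.
  rewrite lee_wpmul2l ?lee_fin ?invr_ge0 ?exprn_ge0//.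
  apply: ge0_le_integral => //.
  - exact: (measurable_orbit_pairs f (fun y z => close_pair e (nm y, nm z))).
  - exact: (measurable_orbit_pairs f
      (fun y z => (bowen_dist f w k y z <= e')%R)).
  move=> v _; rewrite lee_fin ler_nat /pair_count.
  apply/fintype.subset_leq_card/fintype.subsetP => ij.
  rewrite !inE => /asboolP/(close_pair_ball (ltW e0)) close.
  exact: le_trans ee'.
rewrite -(integral_pair_mass mu mnm) /corr_mass.
apply: ge0_le_integral => //; first exact: measurable_ball_mass.
move=> y _; apply: le_measure; rewrite ?inE.
- exact: measurable_bowen_ball.
- exact: measurable_close.
by move=> z yz; apply/asboolP; exists y, z.
Qed.

End one_scale.

Hypothesis hX : compact [set: X].
Hypothesis invF : measure_invariant (P \x mu)%E (skew_product f).
Hypothesis ergF : measure_ergodic (P \x mu)%E (skew_product f).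

(** Each sandwich needs a generic point for one partition, of small mesh,
    refined along one finite word; partitions of mesh 1 / (l + 1) and finite
    words are countably many, so one null set serves all w, k and e. *)
Lemma corr_sum_sandwich_ae :
    {ae mu, forall x : borel X, forall w k e, (0 < e)%R ->
  corr_mass w k (e / 2) <= lower_cor_sum f P x e w k /\
  upper_cor_sum f P x e w k <= corr_mass w k (2 * e)}.
Proof.
have /choice[c hc] : forall l : nat, exists c : {s & borel X -> 'I_s},
    [/\ forall i, measurable (projT2 c @^-1` [set i]) &
        forall x y : X, projT2 c x = projT2 c y -> (mdist x y <= l.+1%:R^-1)%R].
  move=> l; have [|s [sym [msym _ mesh]]] :=
      fine_partition hX (e := l.+1%:R^-1).
    by rewrite invr_gt0.
  by exists (existT _ s sym).
have mF := measurable_skew_product hf.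
have aenu : {ae (P \x mu), forall vx : words m * borel X,
    forall l k (u : {ffun 'I_k -> 'I_m.+1}) a,
    ((visits F ([set: words m] `*`
        (itinerary f (projT2 (c l)) (extend_word u) k @^-1` [set a])) n vx)%:R
      / n%:R)%R @[n --> \oo] -->
    fine (mu (itinerary f (projT2 (c l)) (extend_word u) k @^-1` [set a]))}.
  apply/ae_foralln => l; apply/ae_foralln => k.
  apply: filter_forall => u; apply: filter_forall => a.
  have [msym _] := hc l.
  have mI := measurable_itinerary hf msym (extend_word u) (k := k) a.
  pose A : set (borel X) := itinerary f (projT2 (c l)) (extend_word u) k
      @^-1` [set a].
  have mE : measurable ([set: words m] `*` A) by exact: measurableX.
  have nuE : fine (mu A) = fine ((P \x mu)%E ([set: words m] `*` A)).
    rewrite product_measure1E//.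
    by rewrite [X in (X * _)%E](@probability_setT _ _ _ P) mul1e.
  rewrite -[fine (mu _)]/(fine (mu A)) nuE.
  by have := birkhoff_visits mF invF ergF mE; apply.
apply: filterS (ae_ysection aenu) => x aex w k e e0.
have e4 : (0 < e / 4)%R by rewrite divr_gt0.
have [l le4] := harmonic_lt e4.
have [msym mesh] := hc l.
have r0 : (0 <= l.+1%:R^-1 :> R)%R by [].
have eqx : equidistributed (projT2 (c l)) w k x.
  pose u := [ffun i : 'I_k => w i].
  have iE y : itinerary f (projT2 (c l)) w k y =
      itinerary f (projT2 (c l)) (extend_word u) k y.
    apply/ffunP => i; rewrite !ffunE.
    by rewrite (eq_fiber_iter f y (same_prefix_extend w) (ltnW (ltn_ord i))).
  rewrite /equidistributed.
  rewrite (_ : itinerary f (projT2 (c l)) w k =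
      itinerary f (projT2 (c l)) (extend_word u) k); last exact/funext.
  by apply: filterS aex => v hv a; exact: hv.
split.
  apply: (lower_cor_sum_ge msym r0 mesh eqx); first by rewrite divr_gt0.
  by move: le4; move: (l.+1%:R^-1)%R => t; lra.
apply: le_trans (upper_cor_sum_le msym r0 mesh eqx e0) _.
apply: ge0_le_integral => //; try exact: measurable_ball_mass.
move=> y _; apply: le_measure_bowen_ball => //.
by move: le4; move: (l.+1%:R^-1)%R => t; lra.
Qed.

Context (p : 'I_m.+1 -> R) (hp : forall i, (0 < p i)%R).
Hypothesis hP : bernoulli_measure p P.
Hypothesis hsupp : full_support mu.
Hypothesis hunif : uniform_local_entropy f P mu.

(** Replacing e by e / 2 or 2 e does not affect the limits in the scale, so the
    sandwich transfers the bounds for the order 2 to the correlation sums of a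
    generic point. *)
Theorem local_cor_entropy_exists : {ae mu, forall x : borel X,
  is_local_cor_entropy f P x (metric_entropy f P mu)}.
Proof.
apply: filterS corr_sum_sandwich_ae => x hx.
have q1 : (1 <= 2 :> R)%R by lra.
have lowup w k e : lower_cor_sum f P x e w k <= upper_cor_sum f P x e w k.
  exact: limn_einf_sup.
have lne_anti (a b : \bar R) : 0 <= a -> a <= b -> - lne b <= - lne a.
  move=> a0 ab; rewrite leeN2 lee_lne// in_itv/= leey andbT//.
  exact: le_trans ab.
have bounds w k e : (0 < e)%R ->
  [/\ cor_loss f mu 2 w k (2 * e) <= - lne (upper_cor_sum f P x e w k),
      - lne (upper_cor_sum f P x e w k) <= - lne (lower_cor_sum f P x e w k) &
      - lne (lower_cor_sum f P x e w k) <= cor_loss f mu 2 w k (e / 2)].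
  move=> e0; have [lo up] := hx w k e e0; rewrite !cor_loss2E.
  have low0 := le_trans (corr_mass_ge0 w k (e / 2)) lo.
  by split; apply: lne_anti => //;
      [exact: le_trans (lowup w k e)|exact: corr_mass_ge0].
have up0 w k e : (0 < e)%R -> 0 <= - lne (upper_cor_sum f P x e w k).
  by move=> /(bounds w k)[h _ _]; apply: le_trans h; exact: cor_loss_ge0.
have low0 w k e : (0 < e)%R -> 0 <= - lne (lower_cor_sum f P x e w k).
  move=> e0; have [_ h _] := bounds w k e e0.
  exact: le_trans (up0 w k e e0) h.
have mup k e : measurable_fun [set: words m]
    (fun w => - lne (upper_cor_sum f P x e w k)).
  apply: (@measurable_fun_prefix1 _ _ _ k) => w w' ww';
      congr (- lne (limn_esup _)).
  by apply/funext => n; exact: eq_cor_sum.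
have mlow k e : measurable_fun [set: words m]
    (fun w => - lne (lower_cor_sum f P x e w k)).
  apply: (@measurable_fun_prefix1 _ _ _ k) => w w' ww';
      congr (- lne (limn_einf _)).
  by apply/funext => n; exact: eq_cor_sum.
pose lo e := limn_einf (fun k => (- k%:R^-1)%:E *
  \int[P]_w lne (upper_cor_sum f P x e w k)).
pose hi e := limn_esup (fun k => (- k%:R^-1)%:E *
  \int[P]_w lne (lower_cor_sum f P x e w k)).
have loE e k : (0 < e)%R -> (- k%:R^-1)%:E *
    \int[P]_w lne (upper_cor_sum f P x e w k) =
    (k%:R^-1)%:E * \int[P]_w - lne (upper_cor_sum f P x e w k).
  by move=> e0; rewrite oppr_mule integral_opp_ge0// => w; exact: up0.
have hiE e k : (0 < e)%R -> (- k%:R^-1)%:E *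
    \int[P]_w lne (lower_cor_sum f P x e w k) =
    (k%:R^-1)%:E * \int[P]_w - lne (lower_cor_sum f P x e w k).
  by move=> e0; rewrite oppr_mule integral_opp_ge0// => w; exact: low0.
have lo_ge e : (0 < e)%R -> limn_einf (loss_rate f P mu 2 (2 * e)) <= lo e.
  move=> e0; apply: (@le_limn_einf _ _ _ 0%N) => k _; rewrite loE//.
  rewrite lee_wpmul2l ?lee_fin//; apply: ge0_le_integral => //.
  - by move=> w _; exact: cor_loss_ge0.
  - exact: measurable_cor_loss.
  - by move=> w _; have [] := bounds w k e e0.
have hi_le e : (0 < e)%R -> hi e <= limn_esup (loss_rate f P mu 2 (e / 2)).
  move=> e0; apply: (@le_limn_esup _ _ _ 0%N) => k _; rewrite hiE//.
  rewrite lee_wpmul2l ?lee_fin//; apply: ge0_le_integral => //.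
  - by move=> w _; exact: low0.
  - exact: measurable_cor_loss.
  - by move=> w _; have [] := bounds w k e e0.
have [] := lim_at0_sandwich (lo := lo) (hi := hi) (h := metric_entropy f P mu).
- move=> e e0; apply: le_trans (limn_einf_sup _) _.
  apply: (@le_limn_esup _ _ _ 0%N) => k _; rewrite loE// hiE//.
  rewrite lee_wpmul2l ?lee_fin//; apply: ge0_le_integral => //.
  - by move=> w _; exact: up0.
  - by move=> w _; have [] := bounds w k e e0.
- move=> e e0; apply: le_trans (hi_le e e0) _.
  by apply: limsup_loss_rate_le => //; rewrite divr_gt0.
- move=> c ch; have [e0 e00 he] :=
    liminf_loss_rate_ge hf hp hP invF ergF hunif q1 ch.
  exists (e0 / 2)%R; first by rewrite divr_gt0.
  move=> e /andP[e_gt0 ee0]; apply: le_trans (lo_ge e e_gt0); apply: he.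
  by rewrite mulr_gt0//= mulrC -ler_pdivlMr.
by [].
Qed.

End local_correlation.

Theorem theorem1p3 (R : realType) (X : pmetricType R) (m : nat)
    (f : 'I_m.+1 -> X -> X) (p : 'I_m.+1 -> R)
    (P : probability (words m) R) (mu : probability (borel X) R)
    (hX : compact [set: X])
    (hf : forall i, continuous (f i))
    (hp : forall i, 0 < p i) (hp1 : \sum_i p i = 1)
    (hP : bernoulli_measure p P)
    (hmu : G_ergodic f P mu)
    (hsupp : full_support mu)
    (hfin : (metric_entropy f P mu < +oo)%E)
    (hunif : uniform_local_entropy f P mu) :
  (forall q : R, 1 <= q ->
     is_cor_entropy f P mu q (metric_entropy f P mu)) /\
  {ae mu, forall x : borel X,
     is_cor_entropy f P mu 2 (metric_entropy f P mu) /\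
     is_local_cor_entropy f P x (metric_entropy f P mu)}.
Proof.
have [invF ergF] := hmu.
have cor q := cor_entropy_exists hf hp hX hP invF ergF hsupp hunif (q := q).
split=> //; have := local_cor_entropy_exists hf hX invF ergF hp hP hsupp hunif.
by apply: filterS => x; split => //; apply: cor; rewrite ler1n.
Qed.
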